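(* Let $f$ be a ($*$)-solution of the Boltzmann equation (BE) corresponding to some initial data $0\le f_0\in L^2\cap L^1_2$. Assume that $\langle v\rangle^2f_0\in L^2$ and that, for every $T$ with $0<T<T^*(f)$, $$\langle v\rangle^2f\in L^2\left([0,T],L^\infty_xL^2_v(\mathbb{R}^2\times\mathbb{R}^2)\right).$$ Then the following uniqueness holds in the class of ($*$)-solutions: for any ($*$)-solution $h$ of (BE) corresponding to the same initial data $f_0$, it holds that $T^*(h)=T^*(f)$, and $h(t,x,v)=f(t,x,v)$ for almost every $(t,x,v)\in I^*(f)\times\mathbb{R}^2\times\mathbb{R}^2$. There is no claim of uniqueness for $t>T^*(f)$.
   Context: Here $x,v\in\mathbb{R}^2$, $\langle v\rangle=(1+|v|^2)^{1/2}$. For functions $g,h$ of $(x,v)$ (or of $(t,x,v)$, with $t$ a parameter) set $$Q^+(g,h)(x,v)=\frac{1}{2\pi}\int_{\mathbb{R}^2\times\mathbb{S}^1}g(x,v')\,h(x,v_*')\,dv_*\,d\sigma,\qquad v'=\tfrac{v+v_*}{2}+\tfrac{|v-v_*|}{2}\sigma,\quad v_*'=\tfrac{v+v_*}{2}-\tfrac{|v-v_*|}{2}\sigma,$$ $Q^-(g,h)=g\,\rho_h$, $\rho_h(x)=\int_{\mathbb{R}^2}h(x,v)\,dv$. The Boltzmann equation (BE) is $(\partial_t+v\cdot\nabla_x)f=Q^+(f,f)-Q^-(f,f)$ for non-negative $f(t,x,v)$. $L^p$ without annotation means $L^p(\mathbb{R}^2_x\times\mathbb{R}^2_v)$; $L^q(I,\cdot)$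 is the Bochner space in $t\in I$; $C(I,L^p)$ denotes continuous functions $I\to L^p$; $L^\infty_xL^2_v$ is the mixed-norm Lebesgue space (essential supremum in $x$ of the $L^2_v$ norm). $\|h\|_{L^1_2}=\int(1+|x|^2+|v|^2)|h|\,dx\,dv$. Entropy: $H(h_0)=\int h_0\log h_0\,dx\,dv$ (with $0\log0=0$), with values in $(-\infty,+\infty]$ for $0\le h_0\in L^1_2$ and finite for $0\le h_0\in L^2\cap L^1_2$. Entropy dissipation: $[\mathcal{D}(h)](t,x)=\frac{1}{8\pi}\int_{\mathbb{S}^1\times\mathbb{R}^2\times\mathbb{R}^2}(h'h'_*-hh_* )\log\frac{h'h'_*}{hh_*}\,d\sigma\,dv\,dv_*$, where $h=h(t,x,v)$, $h_*=h(t,x,v_* )$, $h'=h(t,x,v')$, $h'_*=h(t,x,v'_* )$, with the convention that the integrand is set equal to $+\infty$ at any point $(t,x,v,v_*,\sigma)$ where any of $h,h_*,h',h'_*$ vanishes. Renormalized solution of (BE) on $[0,\infty)$: $0\le f\in L^1_{\mathrm{loc}}([0,\infty)\times\mathbb{R}^2\times\mathbb{R}^2)$ with $\frac{1}{1+f}Q^\pm(f,f)\in L^1_{\mathrm{loc}}$ and $(\partial_t+v\cdot\nabla_x)\log(1+f)=\frac{1}{1+f}(Q^+(f,f)-Q^-(f,f))$ in the sense of distributions. ($*$)-solution: a renormalized solution $f\ge0$ of (BE) on $[0,\infty)$ with $f\in C([0,\infty),L^1)$, $f(t=0)=f_0\in L^2\cap L^1_2$, for which there is $T^*(f)\in(0,\infty]$,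 with $I^*(f)=[0,T^*(f))$, such that: for each compact interval $J\subset I^*(f)$, $f\in C(J,L^2)$ and $Q^+(f,f)\in L^1(J,L^2)$; if $T^*(f)<\infty$ then $f\notin C([0,T^*(f)],L^2)$; and for almost every $t\in[0,\infty)$: $\int f(t)=\int f_0$, $\int vf(t)=\int vf_0$, $\int|v|^2f(t)\le\int|v|^2f_0$, $\int|x-vt|^2f(t)\le\int|x|^2f_0$ (all integrals $dx\,dv$ over $\mathbb{R}^2\times\mathbb{R}^2$), and $H(f(t))+\int_0^t\int_{\mathbb{R}^2}\mathcal{D}(f(s))\,dx\,ds\le H(f_0)$. *)

(* Defs.v *)
From HB Require Import structures.
From mathcomp Require Import all_boot all_order all_algebra.
From mathcomp Require Import all_classical all_reals all_analysis.
From mathcomp Require Import measurable_realfun.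

Set Implicit Arguments.
Unset Strict Implicit.
Unset Printing Implicit Defensive.

Import Order.TTheory GRing.Theory Num.Theory.
Import numFieldNormedType.Exports.

Local Open Scope classical_set_scope.
Local Open Scope ring_scope.

(* Elements of Lebesgue spaces are represented by Borel functions. A density  *)
(* in C([0,oo), L^1) is represented by a jointly Borel function of (t, (x,v)) *)
(* whose section at every time t >= 0 represents its value at t; the values   *)
(* at times t < 0 are irrelevant.                                             *)

Notation plane R := (R * R)%type.
Notation phase R := (plane R * plane R)%type.
Notation spacetime R := (R * phase R)%type.

(* The library instance making m1 \x m2 sigma-finite is shadowed by the one    *)
(* for finite measures, so it is stated again for leb2, leb4 and leb5.        *)
Lemma sigma_finite_prod (d1 d2 : measure_display) (T1 : measurableType d1)
    (T2 : measurableType d2) (R : realType)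
    (m1 : {sigma_finite_measure set T1 -> \bar R})
    (m2 : {sigma_finite_measure set T2 -> \bar R}) :
  sigma_finite setT (m1 \x m2)%E.
Proof.
have /sigma_finiteP[F [TF ndF Foo]] := sigma_finiteT m1.
have /sigma_finiteP[G [TG ndG Goo]] := sigma_finiteT m2.
exists (fun n => F n `*` G n).
  rewrite -setXTT TF TG predeqE => -[x y]; split.
    move=> [/= [n _ Fnx] [k _ Gky]]; exists (maxn n k) => //; split.
    - by move: x Fnx; exact/subsetPset/ndF/leq_maxl.
    - by move: y Gky; exact/subsetPset/ndG/leq_maxr.
  by move=> [n _ []/= ? ?]; split; exists n.
move=> k; have [? ?] := Foo k; have [? ?] := Goo k.
split; first exact: measurableX.
by rewrite product_measure1E// lte_mul_pinfty// ge0_fin_numE.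
Qed.

(* leb1, leb2, leb4, leb5 are the Lebesgue measures of R, R^2, R^2 x R^2 and  *)
(* R x R^2 x R^2. *)
Section Measures.
Variable R : realType.

Notation mR := (measurableTypeR R).

Definition leb1 : {sigma_finite_measure set mR -> \bar R} :=
  @lebesgue_measure R.

Definition leb2 : set (plane mR) -> \bar R := (leb1 \x leb1)%E.
HB.instance Definition _ := Measure.on leb2.
HB.instance Definition _ :=
  Measure_isSigmaFinite.Build _ _ _ leb2 (sigma_finite_prod leb1 leb1).

Definition leb4 : set (phase mR) -> \bar R := (leb2 \x leb2)%E.
HB.instance Definition _ := Measure.on leb4.
HB.instance Definition _ :=
  Measure_isSigmaFinite.Build _ _ _ leb4 (sigma_finite_prod leb2 leb2).

Definition leb5 : set (spacetime mR) -> \bar R := (leb1 \x leb4)%E.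
HB.instance Definition _ := Measure.on leb5.
HB.instance Definition _ :=
  Measure_isSigmaFinite.Build _ _ _ leb5 (sigma_finite_prod leb1 leb4).

End Measures.
Arguments leb1 {R}.
Arguments leb2 {R}.
Arguments leb4 {R}.
Arguments leb5 {R}.

Section Plane.
Variable R : realType.
Implicit Types v w : plane R.

(* The norm of the library on a product is the sup norm, whence: *)
Definition sqnorm v : R := v.1 ^+ 2 + v.2 ^+ 2.
Definition enorm v : R := Num.sqrt (sqnorm v).
Definition japanese v : R := Num.sqrt (1 + sqnorm v).

(* The circle is parametrized by arc length, theta ranging over [0, 2 pi[. *)
Definition circle (theta : R) : plane R := (cos theta, sin theta).
Definition angles : set R := `[0, 2 * pi[.

(* v' and v'_* *)
Definition vpost v w theta : plane R :=
  2^-1 *: (v + w) + (enorm (v - w) / 2) *: circle theta.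
Definition vpost_star v w theta : plane R :=
  2^-1 *: (v + w) - (enorm (v - w) / 2) *: circle theta.

End Plane.
Arguments angles {R}.

Section Collision.
Variable R : realType.
Implicit Types g h : phase R -> R.
Local Open Scope ereal_scope.

Definition Qplus g h (z : phase R) : \bar R :=
  ((2 * pi)^-1)%R%:E *
  \int[leb2 \x leb1]_(wt in setT `*` angles)
    (g (z.1, vpost z.2 wt.1 wt.2) * h (z.1, vpost_star z.2 wt.1 wt.2))%R%:E.

Definition density h (x : plane R) : \bar R := \int[leb2]_v (h (x, v))%:E.

Definition Qminus g h (z : phase R) : \bar R := (g z)%:E * density h z.1.

End Collision.

Section FunctionSpaces.
Variable R : realType.
Implicit Types (F : R -> phase R -> \bar R) (f : R -> phase R -> R).
Implicit Types (J : set R) (N : (phase R -> \bar R) -> \bar R).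

(* L^1_2 *)
Definition L12 (h : phase R -> R) : Prop :=
  measurable_fun setT h /\
  (\int[leb4]_z ((1 + sqnorm z.1 + sqnorm z.2) * `|h z|)%:E < +oo)%E.

(* C(J, L^p) *)
Definition C_Lp J (p : \bar R) f : Prop :=
  (forall t, J t -> f t \in Lfun leb4 p) /\
  (forall t0, J t0 ->
    ('N[leb4]_p[EFin \o (f t \- f t0)%R])%E @[t --> within J (nbhs t0)]
      --> 0%E).

Definition L2norm (g : phase R -> \bar R) : \bar R := ('N[leb4]_(2%:E)[g])%E.

(* L^oo_x L^2_v *)
Definition Linfty_L2norm (g : phase R -> \bar R) : \bar R :=
  ('N[leb2]_(+oo)[(fun x => 'N[leb2]_(2%:E)[(fun v => g (x, v))])])%E.

Definition simple_map N (s : R -> phase R -> R) : Prop :=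
  exists (m : nat) (A : 'I_m -> set R) (g : 'I_m -> phase R -> R),
    [/\ forall i, measurable (A i),
        forall i, measurable_fun setT (g i) /\ (N (EFin \o g i) < +oo)%E &
        forall t z, s t z = \sum_(i < m) \1_(A i) t * g i z].

Definition strongly_measurable J N F : Prop :=
  exists s : nat -> R -> phase R -> R,
    (forall n, simple_map N (s n)) /\
    {ae leb1, forall t, J t ->
      N (fun z => F t z - (s n t z)%:E)%E @[n --> \oo] --> 0%E}.

(* The Bochner space L^q(J, X), where N is the norm of X. Extended real       *)
(* values are allowed for the sake of Qplus; finiteness of the norm forces    *)
(* them to be finite almost everywhere when X is a Lebesgue space.            *)
Definition Bochner J (q : R) N F : Prop :=
  strongly_measurable J N F /\ (\int[leb1]_(t in J) (N (F t) `^ q) < +oo)%E.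

Definition future : set (spacetime R) := [set z | 0 <= z.1].

(* L^1_loc([0,oo) x R^2 x R^2) *)
Definition L1loc (G : spacetime R -> \bar R) : Prop :=
  measurable_fun future G /\
  (forall K, K `<=` future -> compact K -> leb5.-integrable K G).

End FunctionSpaces.
Arguments future R : clear implicits.

Section Distributions.
Variable R : realType.
Implicit Type phi : spacetime R -> R.

Fixpoint iter_derive (ds : seq (spacetime R)) phi : spacetime R -> R :=
  if ds is d :: ds' then fun z => 'D_d (iter_derive ds' phi) z else phi.

(* C^oo *)
Definition smooth phi : Prop := forall ds,
  continuous (iter_derive ds phi) /\
  (forall z d, derivable (iter_derive ds phi) z d).

(* Test functions on the open set (0,oo) x R^2 x R^2. *)
Definition test_function phi : Prop :=
  smooth phi /\
  exists K : set (spacetime R), [/\ compact K, K `<=` [set z | 0 < z.1] &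
                forall z, ~ K z -> phi z = 0].

(* d_t phi + v . grad_x phi at z = (t, (x, v)) *)
Definition transport phi (z : spacetime R) : R :=
  'D_((1, ((0, 0), (0, 0))) : spacetime R) phi z +
  'D_((0, (z.2.2, (0, 0))) : spacetime R) phi z.

End Distributions.

Section Boltzmann.
Variable R : realType.
Implicit Types (f : R -> phase R -> R) (h : phase R -> R).
Local Open Scope ereal_scope.

Definition renorm_Qplus f (z : spacetime R) : \bar R :=
  ((1 + f z.1 z.2)^-1)%R%:E * Qplus (f z.1) (f z.1) z.2.

Definition renorm_Qminus f (z : spacetime R) : \bar R :=
  ((1 + f z.1 z.2)^-1)%R%:E * Qminus (f z.1) (f z.1) z.2.

Record renormalized_solution f : Prop := {
  renorm_nonneg : {ae leb5, forall z, (0 <= z.1)%R -> (0 <= f z.1 z.2)%R} ;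
  renorm_L1loc : L1loc (fun z => (f z.1 z.2)%:E) ;
  renorm_Qplus_L1loc : L1loc (renorm_Qplus f) ;
  renorm_Qminus_L1loc : L1loc (renorm_Qminus f) ;
  renorm_eq : forall phi, test_function phi ->
    - (\int[leb5]_(z in future R)
         (ln (1 + f z.1 z.2) * transport phi z)%R%:E) =
    \int[leb5]_(z in future R)
      ((renorm_Qplus f z - renorm_Qminus f z) * (phi z)%:E)
}.

(* ln 0 = 0 in the library *)
Definition entropy h : \bar R := \int[leb4]_z (h z * ln (h z))%R%:E.

Definition dissipation_integrand (a b a' b' : R) : \bar R :=
  if [|| a == 0%R, b == 0%R, a' == 0%R | b' == 0%R] then +oo
  else ((a' * b' - a * b) * ln (a' * b' / (a * b)))%R%:E.

Definition dissipation h (x : plane R) : \bar R :=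
  ((8 * pi)^-1)%R%:E *
  \int[leb4 \x leb1]_(u in setT `*` angles)
    dissipation_integrand
      (h (x, u.1.1)) (h (x, u.1.2))
      (h (x, vpost u.1.1 u.1.2 u.2)) (h (x, vpost_star u.1.1 u.1.2 u.2)).

(* The balance laws between the data f0 and the value h at time t, where      *)
(* dissipated is the entropy dissipated up to time t.                         *)
Record balance_laws (f0 : phase R -> R) (t : R) h (dissipated : \bar R) : Prop := {
  bal_mass : \int[leb4]_z (h z)%:E = \int[leb4]_z (f0 z)%:E ;
  bal_momentum1 : \int[leb4]_z (z.2.1 * h z)%R%:E =
                  \int[leb4]_z (z.2.1 * f0 z)%R%:E ;
  bal_momentum2 : \int[leb4]_z (z.2.2 * h z)%R%:E =
                  \int[leb4]_z (z.2.2 * f0 z)%R%:E ;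
  bal_energy : \int[leb4]_z (sqnorm z.2 * h z)%R%:E <=
               \int[leb4]_z (sqnorm z.2 * f0 z)%R%:E ;
  bal_inertia : \int[leb4]_z (sqnorm (z.1 - t *: z.2)%R * h z)%R%:E <=
                \int[leb4]_z (sqnorm z.1 * f0 z)%R%:E ;
  bal_entropy : entropy h + dissipated <= entropy f0
}.

(* f is a star-solution with data f0 and T^*(f) = T; T is determined by f. *)
Record star_solution (f0 : phase R -> R) f (T : \bar R) : Prop := {
  star_renorm : renormalized_solution f ;
  star_C_L1 : C_Lp `[0%R, +oo[ 1 f ;
  star_init : {ae leb4, forall z, f 0%R z = f0 z} ;
  star_data_L2 : f0 \in Lfun leb4 2%:E ;
  star_data_L12 : L12 f0 ;
  star_time_gt0 : 0 < T ;
  star_C_L2 : forall a b : R, (0 <= a)%R -> (a <= b)%R -> b%:E < T ->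
    C_Lp `[a, b] 2%:E f ;
  star_Qplus : forall a b : R, (0 <= a)%R -> (a <= b)%R -> b%:E < T ->
    Bochner `[a, b] 1 (@L2norm R) (fun t => Qplus (f t) (f t)) ;
  star_maximal : forall b : R, T = b%:E -> ~ C_Lp `[0%R, b] 2%:E f ;
  star_balance : {ae leb1, forall t, (0 <= t)%R ->
    balance_laws f0 t (f t)
      (\int[leb1]_(s in `[0%R, t]) \int[leb2]_x dissipation (f s) x)}
}.

End Boltzmann.

(* Main.v *)
(* Weak-strong uniqueness in L^1. Along almost every characteristic, log (1 + g) of a renormalized
   solution g is absolutely continuous with derivative (Q^+ - Q^-) / (1 + g), so that g itself is
   absolutely continuous with derivative Q^+ - Q^-. For two solutions f and h with the same data put
   u = (f - h)_+ and w = (h - f)_+. Where f > h,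
     Q(f,f) - Q(h,h) <= Q^+(u,f) + Q^+(f,u) + f rho_w,
   and integrating along the characteristics, where int Q^+(a,b) dv = rho_a rho_b,
     |u(t)|_1 <= int_0^t k (2 |u|_1 + |w|_1),  k = esssup_x rho_f <= C |<v>^2 f|_{L^oo_x L^2_v}.
   Conservation of mass gives |u|_1 = |w|_1, and Gronwall's lemma gives u = w = 0 on [0, T^*(f)).
   By continuity in L^1 the solutions still agree at the smaller of T^*(f) and T^*(h), where the
   continuity in L^2 of one would contradict the maximality of the other if the times differed. *)

Require Import Defs.
From HB Require Import structures.
From mathcomp Require Import all_boot all_order all_algebra.
From mathcomp Require Import all_classical all_reals all_analysis.
From mathcomp Require Import measurable_realfun ess_sup_inf.
From mathcomp Require Import ring lra.
Import Order.TTheory GRing.Theory Num.Theory.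
Import numFieldNormedType.Exports.
Local Open Scope classical_set_scope.
Local Open Scope ring_scope.
Set Implicit Arguments.
Unset Strict Implicit.

(** * Smooth plateau functions *)

(** Only f is assumed to have a density bounded in x, so no term of the estimate may pair the
    difference with h. This dictates its one-sided form: f f_* <= h h_* + u f_* + f u_* leaves only
    u and f to be paired, whereas the same estimate for w would bring in rho_h; the missing control
    of w has to come from a conservation law. The exponent 2 of the weight makes <v>^(-2) square
    integrable over the plane, and square integrability on a bounded time interval makes k
    integrable. The other obstacle is the meaning of the equation, which is tested only with smooth
    functions compactly supported at positive times, and only through log (1 + f). Test functions of
    (t, x - t v, v) localize it to characteristics, and continuity in L^1 yields it at each fixed t
    > 0, starting from the initial time. The return from log (1 + f) to f is a chain rule for
    functions that are merely absolutely continuous; it is proved from primitives, without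
    differentiation almost everywhere. *)

Section Flat.
Variable R : realType.

(** x^(-n) e^(-1/x), extended by 0 to x <= 0. [flat 0] is the classical smooth function all of whose
    derivatives vanish at 0; the higher indices arise by differentiating it. *)
Definition flat (n : nat) (x : R) : R :=
  if 0 < x then x^-1 ^+ n * expR (- x^-1) else 0.

Lemma flat_ge0 n x : 0 <= flat n x.
Proof.
rewrite /flat; case: ifPn => // x0.
by rewrite mulr_ge0 ?expR_ge0// exprn_ge0// invr_ge0 ltW.
Qed.

(** With y = 1/x this is y^(n+1) / (n+1)! <= e^y, a single term of the exponential series. This
    decay, available for every n, is what gives differentiability at 0. *)
Lemma flat_le n x : flat n x <= n.+1`!%:R * `|x|.
Proof.
rewrite /flat; case: ifPn => x0; last by rewrite mulr_ge0.
have y0 : 0 < x^-1 by rewrite invr_gt0.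
have f0 : (0 : R) < n.+1`!%:R by rewrite ltr0n fact_gt0.
rewrite expRN gtr0_norm// ler_pdivrMr ?expR_gt0//.
have H : x^-1 ^+ n.+1 / n.+1`!%:R <= expR x^-1.
  by apply: le_trans (expR_ge1Dxn n (ltW y0)); rewrite lerDr.
apply: le_trans (ler_wpM2l _ H); last by rewrite mulr_ge0// ltW.
rewrite exprS [leRHS](_ : _ = (x * x^-1) * (n.+1`!%:R / n.+1`!%:R) * x^-1 ^+ n); last by ring.
by rewrite !divff ?mul1r// gt_eqF.
Qed.

Lemma flat_derive n (x : R) :
  is_derive x (1 : R) (flat n : R -> R) (flat n.+2 x - n%:R * flat n.+1 x).
Proof.
case: (ltrgtP x 0) => [x0|x0|->].
- rewrite [X in is_derive _ _ _ X](_ : _ = 0); last first.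
    by rewrite /flat !ltNge !(ltW x0)/= mulr0 subrr.
  apply: (@near_eq_is_derive _ _ _ (cst 0)).
  near=> y; rewrite /flat ltNge ltW//=.
  by near: y; exact: lt_nbhsl.
- apply: (@near_eq_is_derive _ _ _ (fun y : R => y^-1 ^+ n * expR (- y^-1) : R)).
    near=> y; rewrite /flat ifT//.
    by near: y; exact: lt_nbhsr.
  have xn0 : x != 0 by rewrite gt_eqF.
  have h1 : is_derive x 1 (fun y : R => y^-1) (- x ^- 2).
    apply: is_derive_eq.
      by apply: is_deriveV => //; exact: is_derive_id.
    by rewrite /= /GRing.scale/= mulr1.
  have h2 : is_derive x 1 (fun y : R => expR (- y^-1)) (expR (- x^-1) * x ^- 2).
    apply: (@is_derive1_comp _ expR (fun y => - y^-1) x).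
    by have := is_deriveN h1; rewrite opprK.
  have h3 := is_deriveX n h1.
  rewrite [X in is_derive _ _ X _](_ : _ =
    (fun y : R => y^-1) ^+ n * (fun y : R => expR (- y^-1))); last first.
    by apply/funext => y; rewrite !fctE.
  apply: (is_derive_eq (is_deriveM h3 h2)).
  rewrite /flat x0 /GRing.scale /=; case: n {h3} => [|n]/=.
    rewrite !mulr0n !fctE/= expr0 !mul0r !mulr0 addr0 subr0 mul1r; field; by [].
  rewrite fctE /= -!exprVn !exprS expr0; ring.
- rewrite [X in is_derive _ _ _ X](_ : _ = 0); last first.
    by rewrite /flat ltxx mulr0 subrr.
  have H0 : (fun h : R => n.+2`!%:R * `|h|) @ 0^' --> (0 : R).
    rewrite -[X in _ --> X](mulr0 n.+2`!%:R); apply: cvgM; first exact: cvg_cst.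
    apply/cvgr0Pnorm_lt => e e0; near=> h; rewrite normr_id; near: h.
    exact: (@dnbhs0_lt _ R^o).
  have C : (fun h : R => h^-1 *: ((flat n \o shift 0) (h *: 1) - flat n 0)) @ 0^' --> (0 : R).
    apply: (@squeeze_cvgr _ _ _ R (fun h : R => - (n.+2`!%:R * `|h|)) (fun h : R => n.+2`!%:R * `|h|) (fun h : R => h^-1 *: ((flat n \o shift 0) (h *: 1) - flat n 0))).
    + near=> h.
      have h0 : h != 0 by near: h; exact: nbhs_dnbhs_neq.
      (* The difference quotient of [flat n] at 0 is [flat n.+1], which [flat_le] squeezes to 0. *)
      have -> : h^-1 *: ((flat n \o shift 0) (h *: 1) - flat n 0) = flat n.+1 h.
        rewrite /= addr0 /flat ltxx subr0 /GRing.scale/= mulr1.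
        by case: ifPn => _; rewrite ?mulr0// exprS mulrA.
      by rewrite flat_le andbT (le_trans _ (flat_ge0 _ _))// oppr_le0 mulr_ge0.
    + by rewrite -[X in _ --> X]oppr0; exact: cvgN.
    + exact: H0.
  apply: DeriveDef; first by apply/cvg_ex; exists 0.
  exact/cvg_lim.
Unshelve. all: by end_near. Qed.

Lemma flat_continuous n : continuous (flat n).
Proof.
move=> x; apply: differentiable_continuous; apply/derivable1_diffP.
by case: (flat_derive n x).
Qed.

(** A smooth step, equal to 0 for x <= 0 and to 1 for x >= 1; the factors e normalize, since
    [flat 0 1] is 1/e. Nesting [flat 0] avoids the quotient of the usual construction, quotients not
    being among the operations of [elementary]. *)
Definition plateau (x : R) : R := expR 1 * flat 0 (1 - expR 1 * flat 0 (1 - x)).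

Section Elementary.
Variable V : normedModType R.

(* Since the derivative of flat n is a combination of flat n.+1 and flat n.+2, this class is
   closed under directional derivatives; its elements are therefore smooth. *)
Inductive elementary : (V -> R) -> Prop :=
| elementary_cst c : elementary (fun=> c)
| elementary_lin L : (forall (a : R) u v, L (a *: u + v) = a * L u + L v) ->
    continuous L -> elementary L
| elementary_add s1 s2 : elementary s1 -> elementary s2 ->
    elementary (fun z => s1 z + s2 z)
| elementary_mul s1 s2 : elementary s1 -> elementary s2 ->
    elementary (fun z => s1 z * s2 z)
| elementary_flat n s : elementary s -> elementary (fun z => flat n (s z)).

Lemma elementary_continuous s : elementary s -> continuous s.
Proof.
elim=> [c|L _ cL|s1 s2 _ c1 _ c2|s1 s2 _ c1 _ c2|n s' _ cs] z.
- exact: cvg_cst.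
- exact: cL.
- exact: (cvgD (c1 z) (c2 z)).
- exact: (cvgM (c1 z) (c2 z)).
- by apply: (@continuous_comp _ _ _ s' (flat n)); [exact: cs|exact: flat_continuous].
Qed.

Lemma is_derive_lin (L : V -> R) (z d : V) :
  (forall (a : R) u v, L (a *: u + v) = a * L u + L v) ->
  is_derive z d L (L d).
Proof.
move=> HL.
have C : (fun h : R => h^-1 *: ((L \o shift z) (h *: d) - L z)) @ 0^' --> L d.
  apply: cvg_near_cst; near=> h.
  have h0 : h != 0 by near: h; exact: nbhs_dnbhs_neq.
  by rewrite /= HL addrK /GRing.scale/= mulKf.
apply: DeriveDef; first by apply/cvg_ex; exists (L d).
exact/cvg_lim.
Unshelve. all: by end_near. Qed.

(** Restricted to the line h |-> h d + z, this is the chain rule in one variable. *)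
Lemma is_derive_comp_dir (g : R -> R) (s : V -> R) (z d : V) (a b : R) :
  is_derive (s z) (1 : R) g a -> is_derive z d s b ->
  is_derive z d (fun y => g (s y)) (a * b).
Proof.
move=> dg [ds eb].
have e0 : s (0 *: d + z) = s z by rewrite scale0r add0r.
have h0 : is_derive (0 : R) (1 : R) (fun h : R => s (h *: d + z)) b.
  have /derivable1P dd := ds.
  apply: DeriveDef => //; rewrite -eb /derive.
  apply: (congr1 (fun F : R -> R => lim (F @ 0^'))).
  by apply/funext => h /=; rewrite scale0r !addr0 add0r /GRing.scale/= mulr1.
have [dgs egs] : is_derive (0 : R) (1 : R) (g \o (fun h : R => s (h *: d + z))) (a * b).
  by apply: is_derive1_comp h0; rewrite e0.
apply: DeriveDef; first exact/derivable1P.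
rewrite -egs /derive; apply: (congr1 (fun F : R -> R => lim (F @ 0^'))).
apply/funext => h /=.
by rewrite scale0r addr0 add0r /GRing.scale/= mulr1.
Qed.

Lemma elementary_derive s : elementary s -> forall d : V,
  exists2 s', elementary s' & forall z, is_derive z d s (s' z).
Proof.
elim=> [c|L HL cL|s1 s2 e1 IH1 e2 IH2|s1 s2 e1 IH1 e2 IH2|n s0 e0 IH] d.
- exists (fun=> 0); first exact: elementary_cst.
  by move=> z; exact: is_derive_cst.
- exists (fun=> L d); first exact: elementary_cst.
  by move=> z; exact: is_derive_lin.
- have [s1' e1' d1] := IH1 d; have [s2' e2' d2] := IH2 d.
  exists (fun z => s1' z + s2' z); first exact: elementary_add.
  by move=> z; exact: is_deriveD (d1 z) (d2 z).
- have [s1' e1' d1] := IH1 d; have [s2' e2' d2] := IH2 d.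
  exists (fun z => s1 z * s2' z + s2 z * s1' z).
    by apply: elementary_add; apply: elementary_mul.
  by move=> z; exact: is_deriveM (d1 z) (d2 z).
- have [s' e' ds] := IH d.
  exists (fun z => (flat n.+2 (s0 z) + - n%:R * flat n.+1 (s0 z)) * s' z).
    apply: elementary_mul => //; apply: elementary_add; first exact: elementary_flat.
    by apply: elementary_mul; [exact: elementary_cst|exact: elementary_flat].
  move=> z; have H := flat_derive n (s0 z).
  by have := is_derive_comp_dir H (ds z); rewrite mulNr.
Qed.

Lemma elementary_plateau s : elementary s -> elementary (fun z => plateau (s z)).
Proof.
move=> es; rewrite /plateau.
apply: elementary_mul; first exact: elementary_cst.
apply: elementary_flat.
rewrite (_ : (fun z => _) = (fun z => 1 + (- expR 1) * flat 0 (1 + (-1) * s z))); last first.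
  by apply/funext => z; rewrite mulN1r mulNr.
apply: elementary_add; first exact: elementary_cst.
apply: elementary_mul; first exact: elementary_cst.
apply: elementary_flat.
apply: elementary_add; first exact: elementary_cst.
by apply: elementary_mul => //; exact: elementary_cst.
Qed.

End Elementary.

Lemma elementary_smooth (phi : spacetime R -> R) : elementary phi -> smooth phi.
Proof.
move=> ephi ds.
have : elementary (iter_derive ds phi).
  elim: ds => //= d ds IH.
  have [s' es' ds'] := elementary_derive IH d.
  by rewrite (_ : (fun z => _) = s')//; apply/funext => z; case: (ds' z).
move=> e; split; first exact: elementary_continuous.
by move=> z d; have [s' _ /(_ z)[]] := elementary_derive e d.
Qed.

Lemma flat_nondecreasing0 : {homo flat 0 : x y / x <= y}.
Proof.
move=> x y xy; rewrite /flat; case: ifPn => x0; last first.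
  by case: ifPn => // _; rewrite expr0 mul1r expR_ge0.
rewrite (lt_le_trans x0 xy) !expr0 !mul1r ler_expR lerN2.
by rewrite lef_pV2 ?posrE// (lt_le_trans x0 xy).
Qed.

Lemma plateau_nondecreasing : {homo plateau : x y / x <= y}.
Proof.
move=> x y xy; rewrite /plateau; rewrite ler_pM2l ?expR_gt0//.
apply: flat_nondecreasing0; rewrite lerB// ler_pM2l ?expR_gt0//.
by apply: flat_nondecreasing0; rewrite lerB.
Qed.

Lemma plateau_0 x : x <= 0 -> plateau x = 0.
Proof.
move=> x0; rewrite /plateau; set y := _ - _.
suff : y <= 0 by rewrite /flat => /le_gtF ->; rewrite mulr0.
rewrite /y subr_le0 -[X in X <= _](expRxMexpNx_1 1) ler_pM2l ?expR_gt0//.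
have -> : expR (- 1) = flat 0 1 by rewrite /flat ltr01 expr0 mul1r invr1.
by apply: flat_nondecreasing0; rewrite lerBrDl gerDr.
Qed.

Lemma plateau_1 x : 1 <= x -> plateau x = 1.
Proof.
move=> x1; rewrite /plateau [flat 0 (1 - x)]/flat ltNge subr_le0 x1/= mulr0 subr0.
by rewrite /flat ltr01 expr0 mul1r invr1 expRxMexpNx_1.
Qed.

Lemma plateau_ge0 x : 0 <= plateau x.
Proof. by rewrite /plateau mulr_ge0 ?expR_ge0 ?flat_ge0. Qed.

Lemma plateau_le1 x : plateau x <= 1.
Proof.
have [x1|/ltW x1] := leP 1 x; first by rewrite plateau_1.
by rewrite -(plateau_1 (lexx 1)); exact: plateau_nondecreasing.
Qed.

End Flat.

(** * Almost everywhere statements *)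

Section AlmostEverywhere.
Context d (T : measurableType d) (R : realType) (m : {measure set T -> \bar R}).
Implicit Types P Q : T -> Prop.

Lemma ae_imp P Q : {ae m, forall x, P x} -> (forall x, P x -> Q x) ->
  {ae m, forall x, Q x}.
Proof. by move=> [N [mN N0 PN]] PQ; exists N; split => // x nQ; apply: PN => /= /PQ. Qed.

Lemma ae_and P Q : {ae m, forall x, P x} -> {ae m, forall x, Q x} ->
  {ae m, forall x, P x /\ Q x}.
Proof.
move=> hP hQ; have := @filterI _ _ (ae_filter_ringOfSetsType m) _ _ hP hQ.
exact.
Qed.

End AlmostEverywhere.

(** * Measure-preserving maps *)

Section Preserves.
Context d (T : measurableType d) (R : realType).
Implicit Types (m : {measure set T -> \bar R}) (p q : T -> T).

Definition preserves (m : set T -> \bar R) p :=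
  measurable_fun setT p /\ forall A, measurable A -> m (p @^-1` A) = m A.

Lemma preserves_id (m : set T -> \bar R) : preserves m id.
Proof. by split => //; exact: measurable_id. Qed.

Lemma preserves_comp m p q : preserves m p -> preserves m q -> preserves m (p \o q).
Proof.
move=> [mp hp] [mq hq]; split; first exact: measurableT_comp.
move=> A mA; rewrite comp_preimage hq ?hp//.
by rewrite -[X in measurable X]setTI; exact: mp.
Qed.

Lemma preserves_preimage m p A : preserves m p -> measurable A -> measurable (p @^-1` A).
Proof. by move=> [mp _] mA; rewrite -[X in measurable X]setTI; exact: mp. Qed.

Lemma preserves_ge0_integral m p (D : set T) (f : T -> \bar R) : preserves m p ->
  measurable D -> measurable_fun D f -> (forall x, D x -> (0 <= f x)%E) ->
  (\int[m]_(x in p @^-1` D) f (p x) = \int[m]_(x in D) f x)%E.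
Proof.
move=> [mp hp] mD mf f0.
pose mp' := isMeasurableFun.Build _ _ _ _ _ mp.
pose p' : {mfun T >-> T} := HB.pack p mp'.
rewrite -(ge0_integral_pushforward mp m mD mf); last by move=> x /[!inE]; exact: f0.
rewrite (eq_measure_integral m (m1 := pushforward m p'))//.
by move=> A mA _; exact: hp.
Qed.

Lemma preserves_integrable m p (D : set T) (f : T -> \bar R) : preserves m p ->
  measurable D -> m.-integrable D f -> m.-integrable (p @^-1` D) (f \o p).
Proof.
move=> hp mD /integrableP[mf fi]; apply/integrableP; split.
  apply: (measurable_comp mD) => //; first by move=> _ [x + <-].
  by apply: measurable_funS hp.1.
have := @preserves_ge0_integral m p D (fun x => `|f x|%E) hp mD.
move=> ->//; exact: measurableT_comp.
Qed.

(** No integrability is required: an integral is by definition the difference of the integrals of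
    the positive and negative parts, and each of these is transported. *)
Lemma preserves_integral m p (D : set T) (f : T -> \bar R) : preserves m p ->
  measurable D -> measurable_fun D f ->
  (\int[m]_(x in p @^-1` D) f (p x) = \int[m]_(x in D) f x)%E.
Proof.
move=> hp mD mf; rewrite [LHS]integralE [RHS]integralE.
congr (_ - _)%E.
- rewrite -(preserves_ge0_integral hp mD (measurable_funepos mf))//.
  by apply: eq_integral => x _; rewrite !funeposE.
- rewrite -(preserves_ge0_integral hp mD (measurable_funeneg mf))//.
  by apply: eq_integral => x _; rewrite !funenegE.
Qed.

Lemma preserves_ae m p (P : set T) : preserves m p ->
  {ae m, forall x, P x} -> {ae m, forall x, P (p x)}.
Proof.
move=> hp [N [mN N0 PN]]; exists (p @^-1` N); split.
- exact: preserves_preimage hp mN.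
- by rewrite hp.2.
- by move=> x Px; apply: PN.
Qed.

End Preserves.

Section PreservesProd.
Context d1 d2 (T1 : measurableType d1) (T2 : measurableType d2) (R : realType).
Variables (m1 : {sigma_finite_measure set T1 -> \bar R}).
Variables (m2 : {sigma_finite_measure set T2 -> \bar R}).

(** Sections of the preimage are preimages of sections, so it suffices to integrate over the base.
    Translations of the plane, shears and the free flow are all maps of this kind or of the kind of
    [preserves_fiber1], and rotations are composed of them. *)
Lemma preserves_fiber2 (p : T1 * T2 -> T2) :
  measurable_fun setT p -> (forall x, preserves m2 (fun y => p (x, y))) ->
  preserves (m1 \x m2)%E (fun z => (z.1, p z)).
Proof.
move=> mp hp; split; first by apply: measurable_fun_pair => //; exact: measurable_fst.
move=> A mA; rewrite /product_measure1; apply: eq_integral => x _ /=.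
rewrite -[RHS](hp x).2; last exact: measurable_xsection.
by congr (m2 _); apply/seteqP; split => y; rewrite /xsection /= !inE.
Qed.

Lemma product_measure12 A : measurable A -> (m1 \x m2)%E A = (m1 \x^ m2)%E A.
Proof.
by move=> mA; apply: product_measure_unique mA => B C mB mC; exact: product_measure2E.
Qed.

(** The argument of [preserves_fiber2], once the product measure is written as an integral over the
    second factor. *)
Lemma preserves_fiber1 (p : T1 * T2 -> T1) :
  measurable_fun setT p -> (forall y, preserves m1 (fun x => p (x, y))) ->
  preserves (m1 \x m2)%E (fun z => (p z, z.2)).
Proof.
move=> mp hp.
have mq : measurable_fun setT (fun z : T1 * T2 => (p z, z.2)).
  by apply: measurable_fun_pair => //; exact: measurable_snd.
split => // A mA; rewrite !product_measure12//; last first.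
  by rewrite -[X in measurable X]setTI; exact: mq.
rewrite /product_measure2; apply: eq_integral => y _ /=.
rewrite -[RHS](hp y).2; last exact: measurable_ysection.
by congr (m1 _); apply/seteqP; split => x; rewrite /ysection /= !inE.
Qed.

End PreservesProd.

Section Translation.
Variable R : realType.
Local Notation mR := (measurableTypeR R).

(** The pushforward gives every half-open interval its length, which characterizes Lebesgue
    measure. *)
Lemma preserves_translation (a : R) : preserves (@leb1 R) (fun x : mR => x + a : mR).
Proof.
have mp : measurable_fun setT (fun x : mR => x + a : mR).
  by apply: measurable_funD => //; exact: measurable_cst.
split => // A mA.
pose mp' := isMeasurableFun.Build _ _ _ _ _ mp.
pose p' : {mfun mR >-> mR} := HB.pack (fun x : mR => x + a : mR) mp'.
apply/esym; apply: (@lebesgue_measure_unique _ (pushforward (@lebesgue_measure R) p')) => //.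
move=> X [[u v] _ <-]/=; rewrite /pushforward /=.
rewrite (_ : _ @^-1` _ = `]u - a, v - a]%classic); last first.
  by apply/seteqP; split => x /=; rewrite !in_itv/= ltrBlDr lerBrDr.
rewrite !lebesgue_measure_itv/= !lte_fin ltrD2r; case: ifP => // _.
by rewrite -!EFinB opprB addrA subrK.
Qed.

Lemma preserves_plane_translation (a : plane R) :
  preserves (@leb2 R) (fun x : plane mR => x + a : plane mR).
Proof.
rewrite (_ : (fun x => _) = (fun z : plane mR => (z.1 + a.1, z.2) : plane mR) \o
   (fun z : plane mR => (z.1, z.2 + a.2) : plane mR)); last first.
  by apply/funext => -[x y].
apply: preserves_comp.
  apply: (@preserves_fiber1 _ _ _ _ _ _ _ (fun z : plane mR => z.1 + a.1)).
    by apply: measurable_funD; [exact: measurable_fst|exact: measurable_cst].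
  by move=> y; exact: preserves_translation.
apply: (@preserves_fiber2 _ _ _ _ _ _ _ (fun z : plane mR => z.2 + a.2)).
  by apply: measurable_funD; [exact: measurable_snd|exact: measurable_cst].
by move=> y; exact: preserves_translation.
Qed.

End Translation.

(** * The collision change of variables *)

Ltac measurable_step := first [ assumption | lazymatch goal with
  | |- measurable_fun _ (fun z => (@?a z, @?b z)) => apply: measurable_fun_pair
  | |- measurable_fun _ (fun z => @?a z + @?b z)%R => apply: measurable_funD
  | |- measurable_fun _ (fun z => - @?a z)%R => apply: measurable_funN
  | |- measurable_fun _ (fun z => @?a z * @?b z)%R => apply: measurable_funM
  | |- measurable_fun _ (fun z => @?a z ^+ _)%R => apply: measurable_funX
  | |- measurable_fun _ (fun z => z.1) => exact: measurable_fst
  | |- measurable_fun _ (fun z => z.2) => exact: measurable_snd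
  | |- measurable_fun _ fst => exact: measurable_fst
  | |- measurable_fun _ snd => exact: measurable_snd
  | |- measurable_fun _ (fun z => (@?a z).1) => apply: (measurableT_comp measurable_fst)
  | |- measurable_fun _ (fun z => (@?a z).2) => apply: (measurableT_comp measurable_snd)
  | |- measurable_fun _ (fun z => z) => exact: measurable_id
  | |- measurable_fun _ (fun _ => _) => exact: measurable_cst
  end ].
Ltac mf := repeat measurable_step.

Section Tonelli.
Context d1 d2 (T1 : measurableType d1) (T2 : measurableType d2) (R : realType).
Variables (m1 : {sigma_finite_measure set T1 -> \bar R}).
Variables (m2 : {sigma_finite_measure set T2 -> \bar R}).
Local Open Scope ereal_scope.

Lemma tonelli_setX (A : set T1) (B : set T2) (f : T1 * T2 -> \bar R) :
  measurable A -> measurable B -> measurable_fun (A `*` B) f -> (forall z, (A `*` B) z -> 0 <= f z) ->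
  \int[m1 \x m2]_(z in A `*` B) f z = \int[m1]_(x in A) \int[m2]_(y in B) f (x, y).
Proof.
move=> mA mB mf f0; have mAB : measurable (A `*` B) by exact: measurableX.
rewrite integral_mkcond fubini_tonelli1; last 2 first.
- exact/(measurable_restrictT f mAB).
- by move=> z; rewrite /patch; case: ifPn => // /set_mem; exact: f0.
rewrite [RHS]integral_mkcond; apply: eq_integral => x _.
rewrite /fubini_F {2}/patch; case: ifPn => [/set_mem xA|xA].
  rewrite [RHS]integral_mkcond; apply: eq_integral => y _; rewrite /patch.
  by case: ifPn => [/set_mem[/= _ yB]|yB]; [rewrite mem_set|rewrite ifF//; apply/negbTE; apply: contra yB => /set_mem yB; exact: mem_set].
rewrite integral0_eq// => y _; rewrite /patch ifF//; apply/negbTE.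
by apply: contra xA => /set_mem[/= xA _]; exact: mem_set.
Qed.

End Tonelli.

Section Rotation.
Variable R : realType.
Local Notation mR := (measurableTypeR R).

Definition rotation (theta : R) (u : plane R) : plane R :=
  (cos theta * u.1 - sin theta * u.2, sin theta * u.1 + cos theta * u.2).

Lemma preserves_shear1 (a : R) :
  preserves (@leb2 R) (fun u : plane mR => (u.1 + a * u.2, u.2) : plane mR).
Proof.
apply: (@preserves_fiber1 _ _ _ _ _ _ _ (fun u : plane mR => u.1 + a * u.2)); first by mf.
by move=> y; exact: (preserves_translation (a * y)).
Qed.

Lemma preserves_shear2 (a : R) :
  preserves (@leb2 R) (fun u : plane mR => (u.1, u.2 + a * u.1) : plane mR).
Proof.
apply: (@preserves_fiber2 _ _ _ _ _ _ _ (fun u : plane mR => u.2 + a * u.1)); first by mf.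
by move=> y; exact: (preserves_translation (a * y)).
Qed.

(* A rotation of nonzero sine is a product of three shears. *)
Lemma preserves_rotation_sin (theta : R) : sin theta != 0 ->
  preserves (@leb2 R) (rotation theta).
Proof.
move=> s0; pose a := (cos theta - 1) / sin theta.
have := preserves_comp (preserves_shear1 a)
  (preserves_comp (preserves_shear2 (sin theta)) (preserves_shear1 a)).
congr preserves; apply/funext => -[x y]; rewrite /rotation /a /=.
have h := cos2Dsin2 theta.
congr pair; last by field.
rewrite [LHS](_ : _ = cos theta * x + (cos theta ^+ 2 - 1) / sin theta * y); last by field.
have -> : cos theta ^+ 2 - 1 = - sin theta ^+ 2 by rewrite -h; ring.
by field.
Qed.

(** The half-turn has zero sine and so escapes the factorization into shears; it is the square of
    the quarter-turn. *)
Lemma preserves_opp : preserves (@leb2 R) (fun u : plane mR => - u : plane mR).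
Proof.
have h : preserves (@leb2 R) (rotation (pi / 2)).
  by apply: preserves_rotation_sin; rewrite sin_pihalf oner_neq0.
have := preserves_comp h h.
congr preserves; apply/funext => -[x y].
by rewrite /rotation /= sin_pihalf cos_pihalf; apply: (f_equal2 pair) => /=; ring.
Qed.

Lemma preserves_rotation (theta : R) : preserves (@leb2 R) (rotation theta).
Proof.
have [s0|] := eqVneq (sin theta) 0; last exact: preserves_rotation_sin.
have /eqP := cos2Dsin2 theta; rewrite s0 expr0n/= addr0 sqrf_eq1 => /orP[]/eqP c.
  have := preserves_id (@leb2 R); congr preserves.
  by apply/funext => -[x y]; rewrite /rotation s0 c /=; apply: (f_equal2 pair); ring.
have := preserves_opp; congr preserves.
by apply/funext => -[x y]; rewrite /rotation s0 c /=; apply: (f_equal2 pair) => /=; ring.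
Qed.

Lemma polar_angle (u : plane R) : exists2 alpha : R, 0 <= alpha <= 2 * pi &
  u = (enorm u * cos alpha, enorm u * sin alpha).
Proof.
case: u => x y; set r := enorm (x, y).
have r2 : r ^+ 2 = x ^+ 2 + y ^+ 2.
  by rewrite /r /enorm sqr_sqrtr// /sqnorm/= addr_ge0// sqr_ge0.
have r0 : 0 <= r by exact: sqrtr_ge0.
have pi0 := pi_ge0 R.
have [re0|rn0] := eqVneq r 0.
  exists 0; first by rewrite lexx/=; lra.
  move: r2; rewrite re0 expr0n/= => /esym/eqP; rewrite paddr_eq0 ?sqr_ge0//.
  by rewrite !sqrf_eq0 => /andP[/eqP-> /eqP->]; rewrite !mul0r.
have rp : 0 < r by rewrite lt_neqAle eq_sym rn0.
have hx : -1 <= x / r <= 1.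
  by rewrite -ler_norml normrM normfV (gtr0_norm rp) ler_pdivrMr// mul1r -(ler_pXn2r (n:=2))//
    ?nnegrE// real_normK ?num_real// r2 lerDl sqr_ge0.
have [a0 aE] := acos_def hx.
have sE : r * Num.sqrt (1 - (x / r) ^+ 2) = `|y|.
  rewrite -sqrtr_sqr -[X in X * _](gtr0_norm rp) -[`|r|]sqrtr_sqr -sqrtrM ?sqr_ge0//.
  congr Num.sqrt; rewrite mulrBr mulr1 exprMn exprVn mulrCA divff ?expf_neq0//.
  by rewrite mulr1 r2; ring.
have xE : r * (x / r) = x by field.
have [y0|y0] := leP 0 y.
  exists (acos (x / r)); first by case/andP: a0 => a0 a1; rewrite a0/=; lra.
  by rewrite aE sin_acos// xE sE ger0_norm.
exists (2 * pi - acos (x / r)); first by case/andP: a0 => a0 a1; apply/andP; split; lra.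
rewrite cosB sinB.
rewrite [2 * pi]mulr_natl sin2pi cos2pi aE sin_acos// mul1r !mul0r addr0 sub0r mul1r mulrN.
by rewrite xE sE ltr0_norm// opprK.
Qed.

Lemma sin_per (x : R) : sin (x + 2 * pi) = sin x.
Proof. by rewrite sinD mulr_natl sin2pi cos2pi mulr1 mulr0 addr0. Qed.

Lemma cos_per (x : R) : cos (x + 2 * pi) = cos x.
Proof. by rewrite cosD mulr_natl sin2pi cos2pi mulr1 mulr0 subr0. Qed.

Local Open Scope ereal_scope.

Lemma measurable_angles : measurable (@angles R : set mR).
Proof. exact: measurable_itv. Qed.

(** The shifted window [alpha, 2 pi + alpha[ is cut at 2 pi, and the part beyond is carried back to
    [0, alpha[ by periodicity. *)
Lemma integral_angles_shift (k : R -> \bar R) (alpha : R) :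
  (0 <= alpha <= 2 * pi)%R -> measurable_fun (setT : set mR) k ->
  (forall x, 0 <= k x) -> (forall x, k (x + 2 * pi)%R = k x) ->
  \int[leb1]_(t in angles) k (t + alpha)%R = \int[leb1]_(t in angles) k t.
Proof.
move=> /andP[a0 a1] mk k0 kp.
have tr (a b c : R) : \int[leb1]_(t in `[a, b[) k (t + c)%R =
    \int[leb1]_(t in `[(a + c)%R, (b + c)%R[) k t.
  rewrite -(preserves_ge0_integral (preserves_translation c) _ (measurable_funTS mk))//.
  rewrite (_ : _ @^-1` _ = `[a, b[%classic)//.
  by apply/seteqP; split => x /=; rewrite !in_itv/= lerD2r ltrD2r.
have spl (a b c : R) : (a <= b)%R -> (b <= c)%R -> \int[leb1]_(t in `[a, c[) k t =
    \int[leb1]_(t in `[a, b[) k t + \int[leb1]_(t in `[b, c[) k t.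
  move=> ab bc; rewrite -ge0_integral_setU//.
  - congr integral; apply/seteqP; split => x /=; rewrite !in_itv/=.
      by move=> /andP[ax xc]; have [xb|bx] := ltP x b; [left|right]; rewrite ?ax ?xc.
    by move=> [|] /andP[h1 h2]; apply/andP; split => //; [exact: lt_le_trans bc|exact: le_trans h1].
  - exact: measurable_funTS.
  - by apply/disj_setPS => x [/=]; rewrite !in_itv/= => /andP[_ xb] /andP[bx _]; move: (lt_le_trans xb bx); rewrite ltxx.
rewrite /angles tr add0r (spl alpha (2 * pi)%R)//; last by rewrite lerDl.
rewrite [RHS](spl _ alpha)// addeC; congr (_ + _).
have := tr 0%R alpha (2 * pi)%R; rewrite add0r [(alpha + _)%R]addrC => <-.
by apply: eq_integral => t _; rewrite kp.
Qed.

End Rotation.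

Section IntegralParam.
Context d1 d2 (T1 : measurableType d1) (T2 : measurableType d2) (R : realType).
Variables (m1 : {sigma_finite_measure set T1 -> \bar R}).
Variables (m2 : {sigma_finite_measure set T2 -> \bar R}).
Local Open Scope ereal_scope.
Variables (B : set T2) (f : T1 * T2 -> \bar R).
Hypotheses (mB : measurable B) (mf : measurable_fun setT f) (f0 : forall z, 0 <= f z).

Let fB := f \_ (setT `*` B).

Let mfB : measurable_fun setT fB.
Proof.
by apply/(measurable_restrictT f (measurableX measurableT mB)); exact: measurable_funTS.
Qed.

Let fB0 z : 0 <= fB z.
Proof. by rewrite /fB /patch; case: ifP. Qed.

Let fBE x y : fB (x, y) = ((fun y => f (x, y)) \_ B) y.
Proof.
rewrite /fB /patch; case: (pselect (B y)) => By.
  by rewrite !mem_set.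
by rewrite !memNset// => -[].
Qed.

Lemma measurable_integral_param :
  measurable_fun setT (fun x => \int[m2]_(y in B) f (x, y)).
Proof.
have := measurable_fun_fubini_tonelli_F (m2 := m2) fB mfB fB0.
congr measurable_fun; apply/funext => x; rewrite /fubini_F [RHS]integral_mkcond.
by apply: eq_integral => y _; rewrite fBE.
Qed.

Lemma tonelli_swap : \int[m1]_x \int[m2]_(y in B) f (x, y) =
  \int[m2]_(y in B) \int[m1]_x f (x, y).
Proof.
have := fubini_tonelli (m1 := m1) (m2 := m2) fB mfB fB0.
have -> : \int[m1]_x \int[m2]_y fB (x, y) = \int[m1]_x \int[m2]_(y in B) f (x, y).
  apply: eq_integral => x _; rewrite [RHS]integral_mkcond.
  by apply: eq_integral => y _; rewrite fBE.
move=> ->; rewrite [RHS]integral_mkcond; apply: eq_integral => y _.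
rewrite /patch; case: ifPn => By.
  by apply: eq_integral => x _; rewrite fBE /patch By.
by apply: integral0_eq => x _; rewrite fBE /patch (negbTE By).
Qed.

End IntegralParam.

Section Collision.
Variable R : realType.
Local Notation mR := (measurableTypeR R).
Local Open Scope ereal_scope.

Lemma measurable_cos : measurable_fun (setT : set mR) (@cos R : mR -> mR).
Proof. exact: continuous_measurable_fun (@continuous_cos R). Qed.

Lemma measurable_sin : measurable_fun (setT : set mR) (@sin R : mR -> mR).
Proof. exact: continuous_measurable_fun (@continuous_sin R). Qed.

Lemma measurable_sqrt : measurable_fun (setT : set mR) (@Num.sqrt R : mR -> mR).
Proof. exact: continuous_measurable_fun (@sqrt_continuous R). Qed.

(** Rotating u by t adds t to its polar angle, so that the rotations of u run through the circle of
    radius |u| from a shifted starting point. *)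
Lemma integral_circle (k : plane mR -> \bar R) (u : plane R) :
  measurable_fun setT k -> (forall z, 0 <= k z) ->
  \int[leb1]_(t in angles) k (enorm u * cos t, enorm u * sin t)%R =
  \int[leb1]_(t in angles) k (rotation t u).
Proof.
move=> mk k0; have [alpha ha ue] := polar_angle u.
pose k' (t : mR) := k (enorm u * cos t, enorm u * sin t)%R.
have mk' : measurable_fun setT k'.
  apply: (measurableT_comp mk); apply: measurable_fun_pair.
    by apply: measurable_funM; [exact: measurable_cst|exact: measurable_cos].
  by apply: measurable_funM; [exact: measurable_cst|exact: measurable_sin].
have kp x : k' (x + 2 * pi)%R = k' x by rewrite /k' cos_per sin_per.
have k'0 x : 0 <= k' x by exact: k0.
rewrite -[LHS](integral_angles_shift ha mk' k'0 kp).
apply: eq_integral => t _; rewrite /k' /rotation {3 4 5 6}ue/= cosD sinD.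
by congr (k _); apply: (f_equal2 pair); ring.
Qed.

Lemma measurable_rotation : measurable_fun setT
  (fun z : plane mR * mR => rotation z.2 z.1 : plane mR).
Proof.
have mc : measurable_fun setT (fun z : plane mR * mR => cos z.2 : mR).
  by apply: (measurableT_comp measurable_cos); exact: measurable_snd.
have ms : measurable_fun setT (fun z : plane mR * mR => sin z.2 : mR).
  by apply: (measurableT_comp measurable_sin); exact: measurable_snd.
by rewrite /rotation; mf.
Qed.

Lemma angles_measure : leb1 (@angles R) = (2 * pi)%:E.
Proof.
have pi0 := pi_gt0 R.
rewrite (_ : leb1 _ = @lebesgue_measure R angles)// /angles lebesgue_measure_itv/=.
by rewrite lte_fin ifT ?sube0// mulr_gt0.
Qed.

(** Once the integrals are exchanged, each rotation preserves the measure of the plane, and every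
    angle contributes the same amount. *)
Lemma integral_rotation (k : plane mR -> \bar R) :
  measurable_fun setT k -> (forall z, 0 <= k z) ->
  \int[leb2]_u \int[leb1]_(t in angles) k (enorm u * cos t, enorm u * sin t)%R =
  (2 * pi)%:E * \int[leb2]_u k u.
Proof.
move=> mk k0.
under eq_integral do rewrite integral_circle//.
have mf := measurableT_comp mk measurable_rotation.
have -> := @tonelli_swap _ _ _ _ _ leb2 leb1 angles (k \o (fun z : plane mR * mR => rotation z.2 z.1))
  (@measurable_angles R) mf (fun=> k0 _).
rewrite (eq_integral (fun=> \int[leb2]_u k u)); last first.
  move=> t _ /=; by rewrite -[RHS](preserves_ge0_integral (preserves_rotation t)).
rewrite integral_cst; last exact: measurable_angles.
by rewrite muleC; congr (_ * _); exact: angles_measure.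
Qed.

(** The pair of velocities with centre of mass c = [z.1] and relative velocity u = [z.2]. *)
Definition center_relative (z : plane R * plane R) : plane R * plane R :=
  ((z.1 + 2^-1 *: z.2)%R, (z.1 - 2^-1 *: z.2)%R).

(** The map is composed of c |-> v = c + u/2 at fixed u and u |-> v - u at fixed v; both are measure
    preserving on fibres, so no Jacobian appears. *)
Lemma preserves_center_relative :
  preserves (@leb4 R) (center_relative : phase mR -> phase mR).
Proof.
have h1 : measurable_fun setT (fun z : phase mR => (z.1 + 2^-1 *: z.2)%R : plane mR).
  rewrite (_ : (fun z => _) = (fun z => ((z.1.1 + 2^-1 * z.2.1)%R, (z.1.2 + 2^-1 * z.2.2)%R))); last exact/funext.
  by mf.
have h2 : measurable_fun setT (fun z : phase mR => (z.1 - z.2)%R : plane mR).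
  rewrite (_ : (fun z => _) = (fun z => ((z.1.1 - z.2.1)%R, (z.1.2 - z.2.2)%R))); last exact/funext.
  by mf.
have p1 : preserves (@leb4 R) (fun z : phase mR => ((z.1 + 2^-1 *: z.2)%R, z.2) : phase mR).
  apply: (@preserves_fiber1 _ _ _ _ _ _ _ (fun z : phase mR => (z.1 + 2^-1 *: z.2)%R : plane mR)) => // u /=.
  exact: (preserves_plane_translation (2^-1 *: u)%R).
have p2 : preserves (@leb4 R) (fun z : phase mR => (z.1, (z.1 - z.2)%R) : phase mR).
  apply: (@preserves_fiber2 _ _ _ _ _ _ _ (fun z : phase mR => (z.1 - z.2)%R : plane mR)) => // v /=.
  have := preserves_comp (preserves_plane_translation v) (@preserves_opp R).
  by congr preserves; apply/funext => u /=; rewrite addrC.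
have := preserves_comp p2 p1.
congr preserves; apply/funext => -[[v1 v2] [u1 u2]] /=.
apply: (f_equal2 pair) => //; apply: (f_equal2 pair) => /=.
  by rewrite /GRing.scale/=; field.
by rewrite /GRing.scale/=; field.
Qed.

Lemma measurable_enorm : measurable_fun setT (@enorm R : plane mR -> mR).
Proof.
apply: (measurableT_comp measurable_sqrt); rewrite /sqnorm.
by apply: measurable_funD; mf.
Qed.

Lemma measurable_post : measurable_fun setT (fun z : phase mR * mR =>
  (vpost z.1.1 z.1.2 z.2, vpost_star z.1.1 z.1.2 z.2) : phase mR).
Proof.
have mc : measurable_fun setT (fun z : phase mR * mR => cos z.2 : mR).
  by apply: (measurableT_comp measurable_cos); exact: measurable_snd.
have ms : measurable_fun setT (fun z : phase mR * mR => sin z.2 : mR).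
  by apply: (measurableT_comp measurable_sin); exact: measurable_snd.
have me : measurable_fun setT (fun z : phase mR * mR => enorm (z.1.1 - z.1.2)%R : mR).
  apply: (measurableT_comp measurable_enorm).
  rewrite (_ : (fun z => _) = (fun z : phase mR * mR => ((z.1.1.1 - z.1.2.1)%R, (z.1.1.2 - z.1.2.2)%R))); last exact/funext.
  by mf.
apply: measurable_fun_pair.
  rewrite (_ : (fun z => _) = (fun z : phase mR * mR =>
   ((2^-1 * (z.1.1.1 + z.1.2.1) + (enorm (z.1.1 - z.1.2) / 2) * cos z.2)%R,
    (2^-1 * (z.1.1.2 + z.1.2.2) + (enorm (z.1.1 - z.1.2) / 2) * sin z.2)%R))); last exact/funext.
  by mf.
rewrite (_ : (fun z => _) = (fun z : phase mR * mR =>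
   ((2^-1 * (z.1.1.1 + z.1.2.1) - (enorm (z.1.1 - z.1.2) / 2) * cos z.2)%R,
    (2^-1 * (z.1.1.2 + z.1.2.2) - (enorm (z.1.1 - z.1.2) / 2) * sin z.2)%R))); last exact/funext.
by mf.
Qed.

Lemma post_center_relative (z : plane R * plane R) theta :
  let: (v, w) := center_relative z in
  (vpost v w theta, vpost_star v w theta) =
  center_relative (z.1, (enorm z.2 * cos theta, enorm z.2 * sin theta)%R).
Proof.
case: z => [c u] /=; rewrite /vpost /vpost_star.
have -> : (c + 2^-1 *: u - (c - 2^-1 *: u) = u)%R.
  by rewrite opprD opprK addrACA subrr add0r -scalerDl [(2^-1 + 2^-1)%R](_ : _ = 1%R) ?scale1r//; field.
have -> : (2^-1 *: (c + 2^-1 *: u + (c - 2^-1 *: u)) = c)%R.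
  by rewrite addrACA subrr addr0 scalerDr -scalerDl [(2^-1 + 2^-1)%R](_ : _ = 1%R) ?scale1r//; field.
rewrite /center_relative /=.
have -> : ((enorm u / 2) *: circle theta = 2^-1 *: (enorm u * cos theta, enorm u * sin theta) :> plane R)%R.
  by apply: (f_equal2 pair); rewrite /GRing.scale/=; field.
by [].
Qed.

(* The pre-post-collisional change of variables: in terms of the centre of mass c and the
   relative velocity u, a collision only rotates u. *)
Lemma collision_integral (Phi : phase mR -> \bar R) :
  measurable_fun setT Phi -> (forall z, 0 <= Phi z) ->
  \int[leb2]_v \int[leb2 \x leb1]_(wt in setT `*` angles)
    Phi (vpost v wt.1 wt.2, vpost_star v wt.1 wt.2) =
  (2 * pi)%:E * \int[leb4]_z Phi z.
Proof.
move=> mP P0.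
pose L (z : phase mR) := \int[leb1]_(t in angles) Phi (vpost z.1 z.2 t, vpost_star z.1 z.2 t).
have mL : measurable_fun setT L.
  apply: (@measurable_integral_param _ _ _ _ _ leb1 angles (fun z : phase mR * mR => Phi (vpost z.1.1 z.1.2 z.2, vpost_star z.1.1 z.1.2 z.2))) => //.
    exact: measurable_angles.
  by apply: (measurableT_comp mP); exact: measurable_post.
have L0 z : 0 <= L z by apply: integral_ge0.
transitivity (\int[leb4]_z L z).
  have -> : \int[leb4]_z L z = \int[leb2]_v fubini_F leb2 L v := fubini_tonelli1 L mL L0.
  apply: eq_integral => v _; rewrite /fubini_F.
  pose K (wt : plane mR * mR) := Phi (vpost v wt.1 wt.2, vpost_star v wt.1 wt.2).
  have mK : measurable_fun setT K.
    have mg : measurable_fun setT (fun wt : plane mR * mR => ((v, wt.1), wt.2)) by mf.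
    exact: (measurableT_comp mP (measurableT_comp measurable_post mg)).
  exact: (@tonelli_setX _ _ _ _ _ leb2 leb1 setT angles K measurableT
    (@measurable_angles R) (measurable_funTS mK) (fun z _ => P0 _)).
have [mA hA] := preserves_center_relative.
pose PA (z : phase mR) := Phi (center_relative z).
have mPA : measurable_fun setT PA by exact: (measurableT_comp mP mA).
have PA0 z : 0 <= PA z by exact: P0.
have mLA : measurable_fun setT (fun z : phase mR => L (center_relative z)) by exact: (measurableT_comp mL mA).
have LA0 z : 0 <= L (center_relative z) by exact: L0.
rewrite -(preserves_ge0_integral preserves_center_relative measurableT mL)// preimage_setT.
rewrite -[in RHS](preserves_ge0_integral preserves_center_relative measurableT mP)// preimage_setT.
rewrite [LHS](fubini_tonelli1 (m1 := leb2) (m2 := leb2) _ mLA LA0).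
have -> : \int[leb4]_x Phi (center_relative x) = \int[leb2]_c fubini_F leb2 PA c := fubini_tonelli1 PA mPA PA0.
rewrite -ge0_integralZl//; last 3 first.
- exact: measurable_fun_fubini_tonelli_F.
- by move=> x _; apply: integral_ge0.
- by rewrite lee_fin mulr_ge0// pi_ge0.
apply: eq_integral => c _; rewrite /fubini_F.
have mPc : measurable_fun setT (fun u => PA (c, u)) by exact: measurable_fun_pair2.
rewrite -[RHS](integral_rotation mPc (fun u => PA0 (c, u))).
apply: eq_integral => u _; rewrite /L; apply: eq_integral => t _.
by have := post_center_relative (c, u) t; rewrite /PA /center_relative => ->.
Qed.

End Collision.

(** * Test functions along characteristics *)

Section PlateauDerivative.
Variable R : realType.

Definition plateau' (x : R) : R :=
  expR 1 * (flat 2 (1 - expR 1 * flat 0 (1 - x)) * (expR 1 * flat 2 (1 - x))).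

Lemma plateau_derive (x : R) : is_derive x (1 : R) (@plateau R : R -> R) (plateau' x).
Proof.
have df (y : R) : is_derive y (1 : R) (flat 0 : R -> R) (flat 2 y).
  by have := flat_derive 0 y; rewrite mul0r subr0.
have d1 : is_derive x (1 : R) (fun y : R => 1 - y : R) (- 1).
  have := is_deriveB (is_derive_cst (1 : R) x (1 : R)) (is_derive_id x (1 : R)).
  by rewrite sub0r.
have d2 : is_derive x (1 : R) (fun y : R => 1 - expR 1 * flat 0 (1 - y) : R)
    (expR 1 * flat 2 (1 - x)).
  have d3 := @is_derive1_comp _ (flat 0) (fun y : R => 1 - y) x _ _ (df (1 - x)) d1.
  have d4 := is_deriveM (is_derive_cst (expR 1 : R) x (1 : R)) d3.
  have d5 : is_derive x (1 : R) (fun y : R => 1 - expR 1 * flat 0 (1 - y) : R) _ :=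
    is_deriveB (is_derive_cst (1 : R) x (1 : R)) d4.
  apply: (is_derive_eq d5); rewrite /GRing.scale/= mulr0 addr0; ring.
have d5 := @is_derive1_comp _ (flat 0) (fun y : R => 1 - expR 1 * flat 0 (1 - y)) x _ _ (df _) d2.
have d6 : is_derive x (1 : R) (@plateau R : R -> R) _ :=
  is_deriveM (is_derive_cst (expR 1 : R) x (1 : R)) d5.
apply: (is_derive_eq d6); rewrite /GRing.scale/= mulr0 addr0 /plateau'; ring.
Qed.

Lemma flat_nonpos n (x : R) : x <= 0 -> flat n x = 0.
Proof. by rewrite /flat => /le_gtF ->. Qed.

Lemma plateau'_ge0 x : 0 <= plateau' x.
Proof.
by rewrite mulr_ge0 ?expR_ge0// mulr_ge0 ?flat_ge0// mulr_ge0 ?expR_ge0 ?flat_ge0.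
Qed.

Lemma plateau'_ge1 x : 1 <= x -> plateau' x = 0.
Proof.
by move=> x1; rewrite /plateau' [flat 2 (1 - x)]flat_nonpos ?subr_le0// !mulr0.
Qed.

Lemma plateau'_le0 x : x <= 0 -> plateau' x = 0.
Proof.
move=> x0; rewrite /plateau' flat_nonpos ?mul0r ?mulr0//.
rewrite subr_le0 -[X in X <= _](expRxMexpNx_1 1) ler_pM2l ?expR_gt0//.
have -> : expR (- 1) = flat 0 1 :> R by rewrite /flat ltr01 expr0 mul1r invr1.
by apply: flat_nondecreasing0; rewrite lerBrDl gerDr.
Qed.

Lemma plateau'_continuous : continuous plateau'.
Proof.
have c1 : continuous (fun y : R => 1 - y).
  by move=> x; apply: cvgB; [exact: cvg_cst|exact: cvg_id].
have c2 n : continuous (fun y : R => flat n (1 - y)).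
  by move=> x; apply: (@continuous_comp _ _ _ (fun y : R => 1 - y) (flat n)); [exact: c1|exact: flat_continuous].
have c3 : continuous (fun y : R => 1 - expR 1 * flat 0 (1 - y)).
  move=> x; apply: cvgB; first exact: cvg_cst.
  by apply: cvgM; [exact: cvg_cst|exact: c2].
move=> x; apply: cvgM; first exact: cvg_cst.
apply: cvgM; last by apply: cvgM; [exact: cvg_cst|exact: c2].
by apply: (@continuous_comp _ _ _ (fun y : R => 1 - expR 1 * flat 0 (1 - y)) (flat 2)); [exact: c3|exact: flat_continuous].
Qed.

End PlateauDerivative.

Section TestFunctions.
Variable R : realType.
Local Notation mR := (measurableTypeR R).

Lemma elementary_comp (V : normedModType R) (P : R -> R) (s : V -> R) :
  elementary P -> elementary s -> elementary (fun z => P (s z)).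
Proof.
move=> eP es; elim: eP => [c|L HL _|p q _ ep _ eq|p q _ ep _ eq|n p _ ep].
- exact: elementary_cst.
- have -> : (fun z => L (s z)) = (fun z => L 1 * s z).
    apply/funext => z; have := HL (s z) 1 0.
    have L0 : L 0 = 0 by have := HL 1 0 0; rewrite scale1r add0r mul1r => /eqP; rewrite -subr_eq0 opprD addrA subrr sub0r oppr_eq0 => /eqP.
    by rewrite L0 !addr0 /GRing.scale/= mulr1 mulrC.
  by apply: elementary_mul => //; exact: elementary_cst.
- exact: elementary_add.
- exact: elementary_mul.
- exact: elementary_flat.
Qed.

(** The factor n + 1 sharpens the two edges: with n the functions tend to the indicator of ]a, b[,
    while they stay smooth, between 0 and 1, and zero outside ]a, b[. *)
Definition bump (n : nat) (a b y : R) : R :=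
  flat 0 (n.+1%:R * (y - a)) * flat 0 (n.+1%:R * (b - y)).

Lemma elementary_id : elementary (@id R).
Proof. by apply: elementary_lin => // x; exact: cvg_id. Qed.

Lemma elementary_bump n a b : elementary (bump n a b).
Proof.
have e (c d : R) : elementary (fun y : R => c * (y + d)).
  apply: elementary_mul; first exact: elementary_cst.
  by apply: elementary_add; [exact: elementary_id|exact: elementary_cst].
apply: elementary_mul; apply: elementary_flat; first exact: e.
have := e (- n.+1%:R) (- b); congr elementary; apply/funext => y; ring.
Qed.

Lemma flat0_le1 (x : R) : flat 0 x <= 1.
Proof.
rewrite /flat; case: ifPn => // x0; rewrite expr0 mul1r -expR0 ler_expR oppr_le0.
by rewrite invr_ge0 ltW.
Qed.

Lemma bump_ge0 n a b y : 0 <= bump n a b y.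
Proof. by rewrite mulr_ge0// flat_ge0. Qed.

Lemma bump_le1 n a b y : bump n a b y <= 1.
Proof. by rewrite mulr_ile1// ?flat_ge0 ?flat0_le1. Qed.

Lemma bump_out n a b y : y \notin `]a, b[ -> bump n a b y = 0.
Proof.
rewrite in_itv/= negb_and -!leNgt => /orP[h|h].
  by rewrite /bump flat_nonpos ?mul0r// mulr_ge0_le0// subr_le0.
by rewrite /bump [X in _ * X]flat_nonpos ?mulr0// mulr_ge0_le0// subr_le0.
Qed.

Lemma cvg_flat0_scale (c : R) : 0 < c -> flat 0 (n.+1%:R * c) @[n --> \oo] --> (1 : R).
Proof.
move=> c0; rewrite -[X in _ --> X]expR0.
have -> : (fun n => flat 0 (n.+1%:R * c)) = (fun n => expR (- (c^-1 * n.+1%:R^-1))).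
  by apply/funext => n; rewrite /flat mulr_gt0// expr0 mul1r invfM mulrC.
have h : (fun n => - (c^-1 * n.+1%:R^-1)) @ \oo --> (0 : R).
  rewrite -[X in _ --> X]oppr0 -[X in _ --> - X](mulr0 c^-1).
  by apply: cvgN; apply: cvgM; [exact: cvg_cst|exact: cvg_harmonic].
by apply: (@continuous_cvg _ _ _ _ _ _ expR _ _ h); exact: continuous_expR.
Qed.

Lemma cvg_bump a b y : bump n a b y @[n --> \oo] --> ((y \in `]a, b[)%:R : R).
Proof.
have [|yab] := boolP (y \in `]a, b[); last first.
  by apply: cvg_near_cst; apply: nearW => n; rewrite bump_out.
rewrite in_itv/= => /andP[ay yb]; rewrite /= -[X in _ --> X]mulr1.
by apply: cvgM; apply: cvg_flat0_scale; rewrite subr_gt0.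
Qed.

Lemma measurable_bump n a b : measurable_fun (setT : set mR) (bump n a b : mR -> mR).
Proof.
apply: continuous_measurable_fun; exact: elementary_continuous (elementary_bump n a b).
Qed.

(* p lists the end points of the four sides of a box. *)
Definition bumps n (p : (plane R * plane R) * (plane R * plane R)) (z : phase R) : R :=
  bump n p.1.1.1 p.1.1.2 z.1.1 * bump n p.1.2.1 p.1.2.2 z.1.2 *
  (bump n p.2.1.1 p.2.1.2 z.2.1 * bump n p.2.2.1 p.2.2.2 z.2.2).

(** [shear] follows the free flow from time 0 to time t, from Lagrangian coordinates, where a
    characteristic is a line of constant (x, v), to the coordinates of the equation; [unshear] goes
    back. *)
Definition unshear (z : spacetime R) : spacetime R :=
  (z.1, (z.2.1 - z.1 *: z.2.2, z.2.2)).

Definition shear (z : spacetime R) : spacetime R :=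
  (z.1, (z.2.1 + z.1 *: z.2.2, z.2.2)).

Lemma shearK : cancel shear unshear.
Proof. by move=> [t [x v]]; rewrite /shear /unshear /= addrK. Qed.

Lemma unshearK : cancel unshear shear.
Proof. by move=> [t [x v]]; rewrite /shear /unshear /= subrK. Qed.

(** The function rises on [d, 2 d] and falls on [t - d, t]. It starts at d and not at 0 because test
    functions have compact support in positive times. *)
Definition cutoff (d t tau : R) : R := plateau ((tau - d) / d) * plateau ((t - tau) / d).

Definition cutoff' (d t tau : R) : R :=
  plateau' ((tau - d) / d) / d - plateau' ((t - tau) / d) / d.

(* A function of (t, x - t v, v): the transport operator only differentiates the cutoff. *)
Definition testfun d t n p (z : spacetime R) : R :=
  cutoff d t z.1 * bumps n p (unshear z).2.

Lemma elementary_proj : let V := (spacetime R : normedModType R) in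
  [/\ @elementary R V (fun z => z.1), @elementary R V (fun z => z.2.1.1),
      @elementary R V (fun z => z.2.1.2), @elementary R V (fun z => z.2.2.1) &
      @elementary R V (fun z => z.2.2.2)].
Proof.
have c1 : continuous (fun z : spacetime R => z.1) by move=> z; exact: cvg_fst.
have c2 : continuous (fun z : spacetime R => z.2) by move=> z; exact: cvg_snd.
have c21 : continuous (fun z : spacetime R => z.2.1).
  by move=> z; apply: (@continuous_comp _ _ _ snd fst); [exact: c2|exact: cvg_fst].
have c22 : continuous (fun z : spacetime R => z.2.2).
  by move=> z; apply: (@continuous_comp _ _ _ snd snd); [exact: c2|exact: cvg_snd].
have c211 : continuous (fun z : spacetime R => z.2.1.1).
  by move=> z; apply: (@continuous_comp _ _ _ (fun z : spacetime R => z.2.1) fst); [exact: c21|exact: cvg_fst].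
have c212 : continuous (fun z : spacetime R => z.2.1.2).
  by move=> z; apply: (@continuous_comp _ _ _ (fun z : spacetime R => z.2.1) snd); [exact: c21|exact: cvg_snd].
have c221 : continuous (fun z : spacetime R => z.2.2.1).
  by move=> z; apply: (@continuous_comp _ _ _ (fun z : spacetime R => z.2.2) fst); [exact: c22|exact: cvg_fst].
have c222 : continuous (fun z : spacetime R => z.2.2.2).
  by move=> z; apply: (@continuous_comp _ _ _ (fun z : spacetime R => z.2.2) snd); [exact: c22|exact: cvg_snd].
have l2 (a : R) (u v : spacetime R) : (a *: u + v).2 = a *: u.2 + v.2 by [].
have l1 (a : R) (u v : phase R) : (a *: u + v).1 = a *: u.1 + v.1 by [].
have r1 (a : R) (u v : phase R) : (a *: u + v).2 = a *: u.2 + v.2 by [].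
have l0 (a : R) (u v : plane R) : (a *: u + v).1 = a * u.1 + v.1 by [].
have r0 (a : R) (u v : plane R) : (a *: u + v).2 = a * u.2 + v.2 by [].
move=> V; split.
- by apply: elementary_lin c1.
- by apply: elementary_lin c211 => a u v; rewrite l2 l1 l0.
- by apply: elementary_lin c212 => a u v; rewrite l2 l1 r0.
- by apply: elementary_lin c221 => a u v; rewrite l2 r1 l0.
- by apply: elementary_lin c222 => a u v; rewrite l2 r1 r0.
Qed.

Lemma elementary_testfun d t n p : elementary (testfun d t n p).
Proof.
have [e0 e1 e2 e3 e4] := elementary_proj.
have eN (V : normedModType R) (s : V -> R) : elementary s -> elementary (fun z => - s z).
  move=> es; rewrite (_ : (fun z => _) = (fun z => -1 * s z)); last by apply/funext => z; rewrite mulN1r.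
  by apply: elementary_mul => //; exact: elementary_cst.
have eB (V : normedModType R) (s1 s2 : V -> R) : elementary s1 -> elementary s2 -> elementary (fun z => s1 z - s2 z).
  by move=> h1 h2; apply: elementary_add => //; exact: eN.
have ec c := @elementary_cst R (spacetime R : normedModType R) c.
apply: elementary_mul.
  by apply: elementary_mul; apply: elementary_plateau; apply: elementary_mul => //; exact: eB.
rewrite /bumps /=.
apply: elementary_mul; apply: elementary_mul; apply: (elementary_comp (elementary_bump _ _ _)) => //; apply: eB => //; exact: elementary_mul.
Qed.

Lemma plateau_scaled_derive (c d tau : R) :
  is_derive tau (1 : R) (fun y : R => plateau ((y - c) / d) : R) (plateau' ((tau - c) / d) / d) /\
  is_derive tau (1 : R) (fun y : R => plateau ((c - y) / d) : R) (- (plateau' ((c - tau) / d) / d)).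
Proof.
split.
  have d1 : is_derive tau (1 : R) (fun y : R => (y - c) / d : R) _ :=
    is_deriveM (is_deriveB (is_derive_id tau (1 : R)) (is_derive_cst (c : R) tau (1 : R)))
      (is_derive_cst (d^-1 : R) tau (1 : R)).
  have d2 := @is_derive1_comp _ (@plateau R) (fun y : R => (y - c) / d) tau _ _ (plateau_derive _) d1.
  by apply: (is_derive_eq d2); rewrite /GRing.scale/=; ring.
have d1 : is_derive tau (1 : R) (fun y : R => (c - y) / d : R) _ :=
  is_deriveM (is_deriveB (is_derive_cst (c : R) tau (1 : R)) (is_derive_id tau (1 : R)))
    (is_derive_cst (d^-1 : R) tau (1 : R)).
have d2 := @is_derive1_comp _ (@plateau R) (fun y : R => (c - y) / d) tau _ _ (plateau_derive _) d1.
by apply: (is_derive_eq d2); rewrite /GRing.scale/=; ring.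
Qed.

(** As 2 d <= t - d, each plateau equals 1 where the other one varies, which reduces the product
    rule to the difference [cutoff']. *)
Lemma cutoff_derive (d t tau : R) : 0 < d -> 3 * d <= t ->
  is_derive tau (1 : R) (cutoff d t : R -> R) (cutoff' d t tau).
Proof.
move=> d0 dt.
have [h1 _] := plateau_scaled_derive d d tau.
have [_ h2] := plateau_scaled_derive t d tau.
have h3 : is_derive tau (1 : R) (cutoff d t : R -> R) _ := is_deriveM h1 h2.
apply: (is_derive_eq h3); rewrite /GRing.scale/= /cutoff'.
have [t2|t2] := leP (2 * d) tau.
  have -> : plateau ((tau - d) / d) = 1 by rewrite plateau_1// ler_pdivlMr//; lra.
  have -> : plateau' ((tau - d) / d) = 0 by rewrite plateau'_ge1// ler_pdivlMr//; lra.
  by ring.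
have -> : plateau ((t - tau) / d) = 1 by rewrite plateau_1// ler_pdivlMr//; lra.
have -> : plateau' ((t - tau) / d) = 0 by rewrite plateau'_ge1// ler_pdivlMr//; lra.
by ring.
Qed.

Lemma is_derive_coord (z dir : spacetime R) :
  [/\ is_derive z dir (fun z : spacetime R => z.1) dir.1,
      is_derive z dir (fun z : spacetime R => z.2.1.1) dir.2.1.1,
      is_derive z dir (fun z : spacetime R => z.2.1.2) dir.2.1.2,
      is_derive z dir (fun z : spacetime R => z.2.2.1) dir.2.2.1 &
      is_derive z dir (fun z : spacetime R => z.2.2.2) dir.2.2.2].
Proof.
by split; [apply: (@is_derive_lin _ _ (fun z : spacetime R => z.1))
 |apply: (@is_derive_lin _ _ (fun z : spacetime R => z.2.1.1))
 |apply: (@is_derive_lin _ _ (fun z : spacetime R => z.2.1.2))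
 |apply: (@is_derive_lin _ _ (fun z : spacetime R => z.2.2.1))
 |apply: (@is_derive_lin _ _ (fun z : spacetime R => z.2.2.2))].
Qed.

(** The contributions e1, ..., e4 of the four bumps can stay anonymous: in the sum of the two
    directions that make up [transport], e1 and e2 occur with the coefficient v - v and e3, e4 with
    0. *)
Lemma is_derive_testfun (d t : R) n p (z : spacetime R) : 0 < d -> 3 * d <= t ->
  exists e1 e2 e3 e4 : R, forall dir : spacetime R,
  is_derive z dir (testfun d t n p)
   (cutoff' d t z.1 * dir.1 * bumps n p (unshear z).2 +
    (e1 * (dir.2.1.1 - (z.1 * dir.2.2.1 + z.2.2.1 * dir.1)) +
     e2 * (dir.2.1.2 - (z.1 * dir.2.2.2 + z.2.2.2 * dir.1)) +
     e3 * dir.2.2.1 + e4 * dir.2.2.2)).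
Proof.
move=> d0 dt.
have db a b (y : R) : exists b', is_derive y (1 : R) (bump n a b : R -> R) b'.
  have [b' _ hb] := elementary_derive (elementary_bump n a b) (1 : R).
  by exists (b' y).
set y1 := z.2.1.1 - z.1 * z.2.2.1; set y2 := z.2.1.2 - z.1 * z.2.2.2.
have [b1 h1] := db p.1.1.1 p.1.1.2 y1; have [b2 h2] := db p.1.2.1 p.1.2.2 y2.
have [b3 h3] := db p.2.1.1 p.2.1.2 z.2.2.1; have [b4 h4] := db p.2.2.1 p.2.2.2 z.2.2.2.
pose B1 := bump n p.1.1.1 p.1.1.2 y1; pose B2 := bump n p.1.2.1 p.1.2.2 y2.
pose B3 := bump n p.2.1.1 p.2.1.2 z.2.2.1; pose B4 := bump n p.2.2.1 p.2.2.2 z.2.2.2.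
pose A := cutoff d t z.1.
exists (A * b1 * B2 * B3 * B4), (A * B1 * b2 * B3 * B4), (A * B1 * B2 * b3 * B4), (A * B1 * B2 * B3 * b4) => dir.
have [i0 i1 i2 i3 i4] := is_derive_coord z dir.
have c0 := is_derive_comp_dir (cutoff_derive z.1 d0 dt) i0.
have c1 := is_derive_comp_dir (s := fun z : spacetime R => z.2.1.1 - z.1 * z.2.2.1) h1 (is_deriveB i1 (is_deriveM i0 i3)).
have c2 := is_derive_comp_dir (s := fun z : spacetime R => z.2.1.2 - z.1 * z.2.2.2) h2 (is_deriveB i2 (is_deriveM i0 i4)).
have c3 := is_derive_comp_dir (s := fun z : spacetime R => z.2.2.1) h3 i3.
have c4 := is_derive_comp_dir (s := fun z : spacetime R => z.2.2.2) h4 i4.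
have h : is_derive z dir (testfun d t n p) _ :=
  is_deriveM c0 (is_deriveM (is_deriveM c1 c2) (is_deriveM c3 c4)).
apply: (is_derive_eq h); rewrite !fctE /bumps /GRing.scale /=.
rewrite -/y1 -/y2 /A /B1 /B2 /B3 /B4; ring.
Qed.

Lemma transport_testfun (d t : R) n p (z : spacetime R) : 0 < d -> 3 * d <= t ->
  transport (testfun d t n p) z = cutoff' d t z.1 * bumps n p (unshear z).2.
Proof.
move=> d0 dt; rewrite /transport.
have [e1 [e2 [e3 [e4 h]]]] := is_derive_testfun n p z d0 dt.
have [_ ->] := h (1, ((0, 0), (0, 0))); have [_ ->] := h (0, (z.2.2, (0, 0))).
by rewrite /=; ring.
Qed.

Definition cbox (p : (plane R * plane R) * (plane R * plane R)) : set (phase R) :=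
  (`[p.1.1.1, p.1.1.2] `*` `[p.1.2.1, p.1.2.2]) `*`
  (`[p.2.1.1, p.2.1.2] `*` `[p.2.2.1, p.2.2.2]).

Definition obox (p : (plane R * plane R) * (plane R * plane R)) : set (phase R) :=
  (`]p.1.1.1, p.1.1.2[ `*` `]p.1.2.1, p.1.2.2[) `*`
  (`]p.2.1.1, p.2.1.2[ `*` `]p.2.2.1, p.2.2.2[).

Lemma compact_cbox p : compact (cbox p).
Proof. by apply: compact_setX; apply: compact_setX; exact: segment_compact. Qed.

Lemma bumps_out n p z : ~ obox p z -> bumps n p z = 0.
Proof.
move=> h; rewrite /bumps.
have [h1|/bump_out->] := boolP (z.1.1 \in `]p.1.1.1, p.1.1.2[); last by rewrite !mul0r.
have [h2|/bump_out->] := boolP (z.1.2 \in `]p.1.2.1, p.1.2.2[); last by rewrite mulr0 mul0r.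
have [h3|/bump_out->] := boolP (z.2.1 \in `]p.2.1.1, p.2.1.2[); last by rewrite mul0r mulr0.
have [h4|/bump_out->] := boolP (z.2.2 \in `]p.2.2.1, p.2.2.2[); last by rewrite !mulr0.
by case: h; split; split.
Qed.

Lemma bumps_ge0 n p z : 0 <= bumps n p z.
Proof. by apply: mulr_ge0; apply: mulr_ge0; exact: bump_ge0. Qed.

Lemma bumps_le1 n p z : bumps n p z <= 1.
Proof. by apply: mulr_ile1; try apply: mulr_ge0; try apply: mulr_ile1; rewrite ?bump_ge0 ?bump_le1. Qed.

Lemma cvg_bumps p z : bumps n p z @[n --> \oo] --> (\1_(obox p) z : R).
Proof.
have -> : \1_(obox p) z = (z.1.1 \in `]p.1.1.1, p.1.1.2[)%:R * (z.1.2 \in `]p.1.2.1, p.1.2.2[)%:R *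
    ((z.2.1 \in `]p.2.1.1, p.2.1.2[)%:R * (z.2.2 \in `]p.2.2.1, p.2.2.2[)%:R) :> R.
  rewrite -!natrM !mulnb indicE; congr ((nat_of_bool _)%:R).
  apply/idP/idP; first by move=> /set_mem[[/= -> ->] [/= -> ->]].
  by move=> /andP[/andP[h1 h2] /andP[h3 h4]]; apply/mem_set; split; split.
by apply: cvgM; apply: cvgM; exact: cvg_bump.
Qed.

Lemma measurable_bumps n p : measurable_fun (setT : set (phase mR)) (bumps n p : phase mR -> mR).
Proof.
have h a b (g : phase mR -> mR) : measurable_fun setT g ->
    measurable_fun setT (fun z => bump n a b (g z) : mR).
  by move=> mg; apply: (measurableT_comp (measurable_bump n a b)).
apply: measurable_funM; apply: measurable_funM; apply: h.
- exact: (measurableT_comp measurable_fst measurable_fst).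
- exact: (measurableT_comp measurable_snd measurable_fst).
- exact: (measurableT_comp measurable_fst measurable_snd).
- exact: (measurableT_comp measurable_snd measurable_snd).
Qed.

Lemma shear_continuous : continuous shear.
Proof.
move=> z.
have c1 : (fun z : spacetime R => z.1) @ z --> z.1 by exact: cvg_fst.
have c2 : (fun z : spacetime R => z.2) @ z --> z.2 by exact: cvg_snd.
have c21 : (fun z : spacetime R => z.2.1) @ z --> z.2.1.
  by apply: (@continuous_comp _ _ _ snd fst); [exact: c2|exact: cvg_fst].
have c22 : (fun z : spacetime R => z.2.2) @ z --> z.2.2.
  by apply: (@continuous_comp _ _ _ snd snd); [exact: c2|exact: cvg_snd].
exact: (cvg_pair c1 (cvg_pair (cvgD c21 (cvgZ c1 c22)) c22)).
Qed.

(** A box that moves with the free flow. Such sets carry the supports of the test functions, and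
    their compactness gives access to the local integrability of a renormalized solution. *)
Definition sheared_box (a b : R) p : set (spacetime R) := unshear @^-1` (`[a, b] `*` cbox p).

Lemma compact_sheared_box a b p : compact (sheared_box a b p).
Proof.
have -> : sheared_box a b p = shear @` (`[a, b] `*` cbox p).
  apply/seteqP; split => z.
    by move=> h; exists (unshear z) => //; exact: unshearK.
  by move=> [y hy <-]; change ((`[a, b] `*` cbox p) (unshear (shear y))); rewrite shearK.
apply: continuous_compact; first exact: continuous_subspaceT shear_continuous.
by apply: compact_setX; [exact: segment_compact|exact: compact_cbox].
Qed.

Lemma obox_cbox p : obox p `<=` cbox p.
Proof.
by move=> z [[/= h1 h2] [/= h3 h4]]; split; split => /=; apply: subset_itv_oo_cc.
Qed.

Lemma cutoff_out (d t tau : R) : 0 < d -> ~ `]d, t[%classic tau -> cutoff d t tau = 0.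
Proof.
move=> d0 /negP; rewrite /= in_itv/= negb_and -!leNgt /cutoff => /orP[h|h].
  by rewrite plateau_0 ?mul0r// pmulr_lle0 ?invr_gt0// subr_le0.
by rewrite [X in _ * X]plateau_0 ?mulr0// pmulr_lle0 ?invr_gt0// subr_le0.
Qed.

Lemma test_function_testfun (d t : R) n p : 0 < d -> 3 * d <= t ->
  test_function (testfun d t n p).
Proof.
move=> d0 dt; split; first exact: elementary_smooth (elementary_testfun _ _ _ _).
exists (sheared_box d t p); split.
- exact: compact_sheared_box.
- by move=> z [/= + _]; rewrite in_itv/= => /andP[/(lt_le_trans d0)].
move=> z hz; rewrite /testfun; apply: contrapT => h; apply: hz; split => /=.
  apply: contrapT => hh; apply: h; rewrite cutoff_out ?mul0r// => /subset_itv_oo_cc; exact: hh.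
by apply: contrapT => hh; apply: h; rewrite bumps_out ?mulr0// => /obox_cbox.
Qed.

End TestFunctions.

(** * Measures with a density, and classes of sets that determine a finite measure *)

Section DensityMeasure.
Context d (T : measurableType d) (R : realType) (mu : {measure set T -> \bar R}).
Variable f : T -> \bar R.
Hypotheses (mf : measurable_fun setT f) (f0 : forall x, (0 <= f x)%E).
Local Open Scope ereal_scope.

(** Measurability and sign are arguments of the definition, so that the structure of a measure can
    be attached to it. *)
Definition density_measure of measurable_fun setT f & (forall x, 0 <= f x) :=
  fun A => \int[mu]_(x in A) f x.

Local Notation nu := (density_measure mf f0).

Let nu0 : nu set0 = 0. Proof. by rewrite /density_measure integral_set0. Qed.

Let nu_ge0 A : 0 <= nu A. Proof. exact: integral_ge0. Qed.

Let nu_sigma_additive : semi_sigma_additive nu.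
Proof.
move=> F mF tF mUF; rewrite /density_measure ge0_integral_bigcup//; last exact: measurable_funTS.
by apply: is_cvg_ereal_nneg_natsum_cond => n _ _; exact: integral_ge0.
Qed.

HB.instance Definition _ := isMeasure.Build _ _ _ nu nu0 nu_ge0 nu_sigma_additive.

End DensityMeasure.

Section Determining.
Variable R : realType.
Local Notation mR := (measurableTypeR R).

Definition determining d (T : measurableType d) (G : set (set T)) :=
  (forall A, G A -> measurable A) /\
  forall m1 m2 : {measure set T -> \bar R}, (m1 setT < +oo)%E ->
    (forall A, G A -> m1 A = m2 A) -> forall A, measurable A -> m1 A = m2 A.

(** Open intervals are stable under intersection and generate the Borel sets, and the intervals ]-k,
    k[ exhaust the line. *)
Lemma determining_itv : determining (@RGenOpens.G R : set (set mR)).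
Proof.
split; first by move=> _ [x [y ->]]; exact: measurable_itv.
move=> m1 m2 fm h A mA.
pose g (k : nat) : set mR := `](- k%:R)%R, k%:R[%classic.
have mE : (measurable : set (set mR)) = <<s RGenOpens.G (R:=R) >> by exact: RGenOpens.measurableE.
have GI : setI_closed (RGenOpens.G (R:=R)).
  move=> _ _ [a [b ->]] [c [e ->]]; exists (Num.max a c), (Num.min b e).
  by apply/seteqP; split => x /=; rewrite !in_itv/= gt_max lt_min; [move=> [/andP[-> ->] /andP[-> ->]]|move=> /andP[/andP[-> ->] /andP[-> ->]]].
have Gg k : RGenOpens.G (R:=R) (g k) by exists (- k%:R), k%:R.
have cov : \bigcup_k (g k) = setT.
  apply/seteqP; split => // x _.
  have := archi_boundP (normr_ge0 x); set k := Num.bound _ => hk.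
  by exists k => //=; rewrite /g/= in_itv/= -ltr_norml.
have fg k : (m1 (g k) < +oo)%E.
  by apply: le_lt_trans fm; apply: le_measure; rewrite ?inE//; exact: measurable_itv.
exact: (@measure_unique _ R mR _ g mE GI Gg cov m1 m2 h fg A mA).
Qed.

Lemma slice_measure1 d1 d2 (T1 : measurableType d1) (T2 : measurableType d2)
    (m : {measure set (T1 * T2)%type -> \bar R}) (B : set T2) : measurable B ->
  exists n : {measure set T1 -> \bar R}, forall C, n C = m (C `*` B).
Proof.
move=> mB; have mTB : measurable (setT `*` B : set (T1 * T2)) by exact: measurableX.
pose n : {measure set T1 -> \bar R} := pushforward (mrestr m mTB) (fst : T1 * T2 -> T1).
exists (n (@measurable_fst _ _ T1 T2)) => C.
rewrite /n /= /pushforward /mrestr; congr (m _); apply/seteqP; split => -[x y] /=.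
  by move=> [? []].
by move=> [].
Qed.

Lemma slice_measure2 d1 d2 (T1 : measurableType d1) (T2 : measurableType d2)
    (m : {measure set (T1 * T2)%type -> \bar R}) (A : set T1) : measurable A ->
  exists n : {measure set T2 -> \bar R}, forall C, n C = m (A `*` C).
Proof.
move=> mA; have mAT : measurable (A `*` setT : set (T1 * T2)) by exact: measurableX.
pose n : {measure set T2 -> \bar R} := pushforward (mrestr m mAT) (snd : T1 * T2 -> T2).
exists (n (@measurable_snd _ _ T1 T2)) => C.
rewrite /n /= /pushforward /mrestr; congr (m _); apply/seteqP; split => -[x y] /=.
  by move=> [? []].
by move=> [].
Qed.

(** One factor is freed at a time. For B in [G2] the slices C |-> m (C x B) agree on [G1], hence on
    all measurable C; then, for any measurable A, the slices C |-> m (A x C) agree on [G2], hence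
    everywhere. Measurable rectangles determine the product measure. *)
Lemma determining_prod d1 d2 (T1 : measurableType d1) (T2 : measurableType d2)
    (G1 : set (set T1)) (G2 : set (set T2)) :
  determining G1 -> determining G2 ->
  determining [set A `*` B | A in G1 & B in G2].
Proof.
move=> [mG1 d1'] [mG2 d2']; split.
  by move=> _ [A GA [B GB <-]]; apply: measurableX; [exact: mG1|exact: mG2].
move=> m1 m2 fm h.
have mX (A : set T1) (B : set T2) : measurable A -> measurable B -> measurable (A `*` B) by exact: measurableX.
have h1 A B : measurable A -> G2 B -> m1 (A `*` B) = m2 (A `*` B).
  move=> mA GB; have mB := mG2 B GB; 
  have [n1 E1] := slice_measure1 m1 mB; have [n2 E2] := slice_measure1 m2 mB.
  rewrite -E1 -E2; apply: d1' => //.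
    by rewrite E1; apply: le_lt_trans fm; apply: le_measure; rewrite ?inE//; exact: mX.
  by move=> C GC; rewrite E1 E2; apply: h; exists C => //; exists B.
have h2 A B : measurable A -> measurable B -> m1 (A `*` B) = m2 (A `*` B).
  move=> mA mB; 
  have [n1 E1] := slice_measure2 m1 mA; have [n2 E2] := slice_measure2 m2 mA.
  rewrite -E1 -E2; apply: d2' => //.
    by rewrite E1; apply: le_lt_trans fm; apply: le_measure; rewrite ?inE//; exact: mX.
  by move=> C GC; rewrite E1 E2; exact: h1.
move=> X mX'; apply: (@measure_unique _ _ _ [set A `*` B | A in measurable & B in measurable] (fun=> setT)) => //.
- exact: measurable_prod_measurableType.
- move=> _ _ [A1 mA1 [A2 mA2 <-]] [B1 mB1 [B2 mB2 <-]].
  by rewrite -setXI; exists (A1 `&` B1); [exact: measurableI|exists (A2 `&` B2) => //; exact: measurableI].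
- by move=> _; exists setT => //; exists setT => //; rewrite setXTT.
- by rewrite bigcup_const//; exists 0%N.
- by move=> _ [A mA [B mB <-]]; exact: h2.
Qed.

Lemma determining_obox : determining (range (@obox R) : set (set (phase mR))).
Proof.
have := determining_prod (determining_prod determining_itv determining_itv)
  (determining_prod determining_itv determining_itv).
congr determining; apply/seteqP; split.
  move=> _ [_ [_ [a1 [b1 ->]] [_ [a2 [b2 ->]] <-]] [_ [_ [a3 [b3 ->]] [_ [a4 [b4 ->]] <-]] <-]].
  by exists (((a1, b1), (a2, b2)), ((a3, b3), (a4, b4))).
move=> _ [p _ <-].
exists (`]p.1.1.1, p.1.1.2[ `*` `]p.1.2.1, p.1.2.2[).
  by exists `]p.1.1.1, p.1.1.2[%classic; [eexists; eexists; reflexivity|exists `]p.1.2.1, p.1.2.2[%classic => //; eexists; eexists; reflexivity].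
exists (`]p.2.1.1, p.2.1.2[ `*` `]p.2.2.1, p.2.2.2[) => //.
by exists `]p.2.1.1, p.2.1.2[%classic; [eexists; eexists; reflexivity|exists `]p.2.2.1, p.2.2.2[%classic => //; eexists; eexists; reflexivity].
Qed.

Lemma measurable_obox p : measurable (obox p : set (phase mR)).
Proof. by apply: determining_obox.1; exists p. Qed.

Lemma obox_setI p q : exists r, @obox R p `&` obox q = obox r.
Proof.
exists (((Num.max p.1.1.1 q.1.1.1, Num.min p.1.1.2 q.1.1.2), (Num.max p.1.2.1 q.1.2.1, Num.min p.1.2.2 q.1.2.2)),
  ((Num.max p.2.1.1 q.2.1.1, Num.min p.2.1.2 q.2.1.2), (Num.max p.2.2.1 q.2.2.1, Num.min p.2.2.2 q.2.2.2))).
apply/seteqP; split => z.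
  move=> [[[/= +  +] [/= + +]] [[/= + +] [/= + +]]]; rewrite !in_itv/=.
  move=> /andP[? ?] /andP[? ?] /andP[? ?] /andP[? ?] /andP[? ?] /andP[? ?] /andP[? ?] /andP[? ?].
  by split; split => /=; rewrite in_itv/= gt_max lt_min; apply/andP; split; apply/andP.
move=> [[/= + +] [/= + +]]; rewrite !in_itv/= !gt_max !lt_min.
move=> /andP[/andP[? ?] /andP[? ?]] /andP[/andP[? ?] /andP[? ?]] /andP[/andP[? ?] /andP[? ?]] /andP[/andP[? ?] /andP[? ?]].
by split; split; split => /=; rewrite in_itv/=; apply/andP.
Qed.

(** The positive and negative parts of [V] are densities of two finite measures that agree on [G],
    hence on all measurable sets. *)
Lemma determining_ae0 d (T : measurableType d) (G : set (set T)) (mu : {measure set T -> \bar R})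
    (V : T -> \bar R) : determining G -> mu.-integrable setT V ->
  (forall A, G A -> (\int[mu]_(x in A) V x = 0)%E) -> {ae mu, forall x, V x = 0%E}.
Proof.
move=> [mG dG] iV h; have mV := measurable_int mu iV.
have mVp := measurable_funepos mV; have mVn := measurable_funeneg mV.
pose m1 := density_measure mu mVp (funepos_ge0 V).
pose m2 := density_measure mu mVn (funeneg_ge0 V).
have fin1 A : measurable A -> (\int[mu]_(x in A) V^\+ x)%E \is a fin_num.
  move=> mA; apply: integrable_fin_num => //.
  by apply: integrable_funepos => //; exact: integrableS iV.
have fin2 A : measurable A -> (\int[mu]_(x in A) V^\- x)%E \is a fin_num.
  move=> mA; apply: integrable_fin_num => //.
  by apply: integrable_funeneg => //; exact: integrableS iV.
have E A : measurable A -> m1 A = m2 A.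
  apply: dG; first by rewrite ltey_eq fin1.
  move=> B GB; have mB := mG B GB; have := h B GB; rewrite integralE.
  rewrite -(fineK (fin1 B mB)) -(fineK (fin2 B mB)) -EFinB => -[] /eqP.
  rewrite subr_eq0 => /eqP e; rewrite /m1 /m2 /= /density_measure.
  by rewrite -(fineK (fin1 B mB)) -(fineK (fin2 B mB)) e.
have h2 : ae_eq mu setT V (cst 0%E).
  apply: integral_ae_eq => //.
  move=> A _ mA; rewrite integral0 integralE.
  by have := E A mA; rewrite /m1 /m2 /density_measure => ->; rewrite subee// fin2.
by apply: (ae_imp h2) => x; exact.
Qed.

End Determining.

(** * Primitives and Gronwall's lemma *)

Section Primitive.
Variable R : realType.
Local Notation mu := (@lebesgue_measure R).
Implicit Types (G : R -> R) (T s t : R).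

Definition primitive G t : R := \int[mu]_(s in `[0, t]) G s.

Lemma primitive0 G : primitive G 0 = 0.
Proof. by rewrite /primitive set_itv1 Rintegral_set1. Qed.

Lemma itv0_integrable G T t : t <= T ->
  mu.-integrable `[0, T] (EFin \o G) -> mu.-integrable `[0, t] (EFin \o G).
Proof.
move=> tT; apply: integrableS => // x /=.
by rewrite !in_itv/= => /andP[-> /le_trans]; exact.
Qed.

Lemma primitiveB G T s t : 0 <= s -> s <= t -> t <= T ->
  mu.-integrable `[0, T] (EFin \o G) ->
  primitive G t - primitive G s = \int[mu]_(x in `]s, t]) G x.
Proof.
move=> s0 st tT iG; rewrite /primitive Rintegral_itvB ?bnd_simp//.
exact: itv0_integrable iG.
Qed.

Lemma primitive_continuous G T : 0 <= T ->
  mu.-integrable `[0, T] (EFin \o G) -> {within `[0, T], continuous (primitive G)}.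
Proof. by move=> T0 iG; exact: (parameterized_integral_continuous T0 iG). Qed.

Lemma itvoc_integrable G T s t : 0 <= s -> t <= T ->
  mu.-integrable `[0, T] (EFin \o G) -> mu.-integrable `]s, t] (EFin \o G).
Proof.
move=> s0 tT; apply: integrableS => // x /=; rewrite !in_itv/= => /andP[sx xt].
by rewrite (le_trans s0 (ltW sx)) (le_trans xt).
Qed.

Lemma norm_primitiveB G T s t : 0 <= s -> s <= t -> t <= T ->
  mu.-integrable `[0, T] (EFin \o G) ->
  `|primitive G t - primitive G s| <=
    primitive (fun x => `|G x|) t - primitive (fun x => `|G x|) s.
Proof.
move=> s0 st tT iG; have iGn := integrable_norm iG.
rewrite (primitiveB s0 st tT iG) (primitiveB s0 st tT iGn).
by apply: le_normr_Rintegral => //; exact: itvoc_integrable iG.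
Qed.

Lemma primitive_norm_homo G T s t : 0 <= s -> s <= t -> t <= T ->
  mu.-integrable `[0, T] (EFin \o G) ->
  primitive (fun x => `|G x|) s <= primitive (fun x => `|G x|) t.
Proof.
by move=> s0 st tT iG; rewrite -subr_ge0; exact: le_trans (norm_primitiveB s0 st tT iG).
Qed.

(* Quadratic smallness is halved at each bisection of the range of g. *)
Lemma quadratic_const (Phi g : R -> R) (C s t : R) : s <= t ->
  {within `[s, t], continuous g} ->
  (forall x y, s <= x -> x <= y -> y <= t -> g x <= g y) ->
  (forall x y, s <= x -> x <= y -> y <= t ->
     `|Phi y - Phi x| <= C * (g y - g x) ^+ 2) ->
  Phi t = Phi s.
Proof.
move=> st cg hg hP.
have H n x y : s <= x -> x <= y -> y <= t ->
    `|Phi y - Phi x| <= C * (g y - g x) ^+ 2 / 2 ^+ n.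
  elim: n x y => [|n IH] x y sx xy yt; first by rewrite expr0 divr1 hP.
  have cxy : {within `[x, y], continuous g}.
    apply: continuous_subspaceW cg => z /=; rewrite !in_itv/= => /andP[xz zy].
    by rewrite (le_trans sx)// (le_trans zy).
  have gxy := hg x y sx xy yt.
  have [|c] := IVT (v := (g x + g y) / 2) xy cxy.
    by rewrite min_l// max_r//; apply/andP; split; lra.
  rewrite in_itv/= => /andP[xc cy] gc.
  have h1 := IH x c sx xc (le_trans cy yt).
  have h2 := IH c y (le_trans sx xc) cy yt.
  rewrite -(subrKA (Phi c)); apply: le_trans (ler_normD _ _) _.
  apply: le_trans (lerD h2 h1) _; rewrite gc (exprS 2 n).
  by rewrite le_eqVlt; apply/orP; left; apply/eqP; field; rewrite expf_neq0.
apply/eqP; rewrite -subr_eq0 -normr_le0; apply/ler_addgt0Pr => e e0; rewrite add0r.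
set A := C * (g t - g s) ^+ 2.
have A0 : 0 <= A by apply: le_trans (hP s t _ _ _).
have [n hn] : exists n : nat, A / e <= n%:R.
  exists (Num.bound (A / e)); apply/ltW; apply: archi_boundP.
  by rewrite divr_ge0// ltW.
apply: le_trans (H n s t _ _ _) _ => //; rewrite -/A.
rewrite ler_pdivrMr ?exprn_gt0// mulrC -ler_pdivrMr//.
apply: le_trans hn _; rewrite -natrX ler_nat; exact/ltnW/ltn_expl.
Qed.

(** Everything follows from 1 + x <= e^x: the remainder is nonnegative and at most (e^b - e^a) (b -
    a), and the difference of the exponentials is in turn bounded by e^B |b - a|. *)
Lemma expR_taylor1 (B a b : R) : a <= B -> b <= B ->
  `|expR b - expR a - expR a * (b - a)| <= expR B * (b - a) ^+ 2.
Proof.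
move=> aB bB.
have h1 : 0 <= expR b - expR a - expR a * (b - a).
  have := expR_ge1Dx (b - a); rewrite -(ler_pM2l (expR_gt0 a)) -expRD [a + _]addrC subrK.
  by lra.
rewrite ger0_norm//.
have h2 : expR b - expR a <= expR b * (b - a).
  have := expR_ge1Dx (a - b); rewrite -(ler_pM2l (expR_gt0 b)) -expRD [b + _]addrC subrK.
  by lra.
have [ab|ba] := leP a b.
  have h3 : expR b <= expR B by rewrite ler_expR.
  have h4 : expR b - expR a <= expR B * (b - a).
    by apply: le_trans h2 _; rewrite ler_wpM2r// subr_ge0.
  have h5 : (expR b - expR a) * (b - a) <= expR B * (b - a) * (b - a).
    by rewrite ler_wpM2r// subr_ge0.
  have h6 : expR b * (b - a) - expR a * (b - a) = (expR b - expR a) * (b - a) by ring.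
  by rewrite expr2; lra.
have h3 : expR a <= expR B by rewrite ler_expR.
have h4 : expR a * (a - b) >= expR a - expR b.
  have := expR_ge1Dx (b - a); rewrite -(ler_pM2l (expR_gt0 a)) -expRD [a + _]addrC subrK.
  by lra.
have h5 : expR a * (a - b) <= expR B * (a - b) by rewrite ler_wpM2r// subr_ge0 ltW.
have h6 : (expR a - expR b) * (a - b) <= expR B * (a - b) * (a - b).
  by rewrite ler_wpM2r ?subr_ge0 ?(ltW ba)//; lra.
have h7 : expR b - expR a - expR a * (b - a) <= (expR a - expR b) * (a - b).
  have -> : (expR a - expR b) * (a - b) = expR b * (b - a) - expR a * (b - a) by ring.
  by lra.
have -> : expR B * (b - a) ^+ 2 = expR B * (a - b) * (a - b) by ring.
exact: le_trans h7 h6.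
Qed.

Lemma expR_lipschitz (B a b : R) : a <= B -> b <= B ->
  `|expR b - expR a| <= expR B * `|b - a|.
Proof.
wlog ab : a b / a <= b.
  move=> H aB bB; have [ab|/ltW ba] := leP a b; first exact: H.
  by rewrite distrC [`|b - a|]distrC; exact: H.
move=> aB bB; rewrite !ger0_norm ?subr_ge0 ?ler_expR//.
have := expR_ge1Dx (a - b); rewrite -(ler_pM2l (expR_gt0 b)) -expRD [b + _]addrC subrK => h.
have : expR b * (b - a) <= expR B * (b - a) by rewrite ler_wpM2r ?subr_ge0// ler_expR.
by lra.
Qed.

Section Chain.
Variables (G : R -> R) (F0 T : R).
Hypotheses (T0 : 0 <= T) (iG : mu.-integrable `[0, T] (EFin \o G)).

Let F t := F0 + primitive G t.
Let g := primitive (fun x => `|G x|).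
Let B := F0 + g T.

Let F_le t : 0 <= t -> t <= T -> F t <= B.
Proof.
move=> t0 tT; rewrite lerD2l; apply: le_trans (primitive_norm_homo t0 tT (lexx _) iG).
have := norm_primitiveB (lexx 0) t0 tT iG; rewrite !primitive0 !subr0.
by apply: le_trans; exact: ler_norm.
Qed.

Lemma primitive_affine_continuous : {within `[0, T], continuous F}.
Proof.
move=> x; apply: cvgD; first exact: cvg_cst.
exact: (primitive_continuous T0 iG).
Qed.

Lemma expR_primitive_continuous : {within `[0, T], continuous (expR \o F)}.
Proof.
move=> x; have := @continuous_expR R (F x); apply: continuous_comp.
exact: primitive_affine_continuous.
Qed.

Lemma expR_primitive_integrable :
  mu.-integrable `[0, T] (EFin \o (fun x => expR (F x) * G x)).
Proof.
have := @integrableMr _ _ _ mu `[0, T]%classic _ (expR \o F) (EFin \o G) _ _ iG.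
apply => //.
  by apply: subspace_continuous_measurable_fun => //; exact: expR_primitive_continuous.
exists (expR B); split; first exact: num_real.
move=> M BM x /=; rewrite in_itv/= => /andP[x0 xT].
by rewrite ger0_norm ?expR_ge0// (le_trans _ (ltW BM))// ler_expR F_le.
Qed.

(** The chain rule for the exponential of an absolutely continuous function. Instead of
    differentiating, one bounds the increment over [x, y] of the defect [Phi] of the identity by a
    multiple of (g y - g x)^2, where g is the primitive of |G|; by [quadratic_const] such a defect
    is constant. *)
Lemma expR_primitive t : 0 <= t -> t <= T ->
  expR (F t) - expR F0 = primitive (fun x => expR (F x) * G x) t.
Proof.
move=> t0 tT.
pose Phi t := expR (F t) - primitive (fun x => expR (F x) * G x) t.
suff : Phi t = Phi 0.
  rewrite /Phi /F !primitive0 addr0 subr0 => <-; by rewrite subKr.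
(* One [expR B] pays for the Taylor remainder of the exponential, the other for freezing the factor
   e^F at the left end x under the integral; [B] bounds F on [0, T]. *)
apply: (@quadratic_const Phi g (expR B *+ 2)) => //.
- have := primitive_continuous T0 (integrable_norm iG).
  apply: continuous_subspaceW => z /=; rewrite !in_itv/= => /andP[-> zt].
  exact: le_trans tT.
- by move=> x y x0 xy yt; exact: (primitive_norm_homo x0 xy (le_trans yt tT) iG).
move=> x y x0 xy yt.
have yT := le_trans yt tT; have y0 := le_trans x0 xy; have xT := le_trans xy yT.
have iE := expR_primitive_integrable.
have mD : measurable (`]x, y]%classic : set (measurableTypeR R)) by exact: measurable_itv.
rewrite (_ : Phi y - Phi x = (expR (F y) - expR (F x) - expR (F x) * (F y - F x)) -
   \int[mu]_(z in `]x, y]) ((expR (F z) - expR (F x)) * G z)); last first.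
  have i1 := itvoc_integrable x0 yT iE.
  have i0 := itvoc_integrable x0 yT iG.
  have i2 : mu.-integrable `]x, y] (EFin \o (fun z => expR (F x) * G z)).
    have := integrableZl mD (expR (F x)) i0.
    by apply: eq_integrable => // z _ /=; rewrite EFinM.
  rewrite [X in _ = _ - X](_ : _ = \int[mu]_(z in `]x, y]) (expR (F z) * G z) -
      expR (F x) * \int[mu]_(z in `]x, y]) G z); last first.
    have e2 := RintegralZl (expR (F x)) mD i0.
    have e3 := RintegralB mD i1 i2.
    transitivity (\int[mu]_(z in `]x, y]) (expR (F z) * G z - expR (F x) * G z)).
      by apply: eq_Rintegral => z _; rewrite mulrBl.
    by rewrite [LHS]e3; congr (_ - _); exact: e2.
  have eE := primitiveB x0 xy yT iE; have eG := primitiveB x0 xy yT iG.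
  have eF : F y - F x = primitive G y - primitive G x by rewrite /F opprD addrACA subrr add0r.
  have id4 (a b c d e : R) : (a - b) - (c - d) = (a - c - c * e) - ((b - d) - c * e) by ring.
  by rewrite -[X in _ = _ - (X - _)]eE -[X in _ = _ - (_ - _ * X)]eG eF; exact: id4.
have dF z : x <= z -> z <= y -> `|F z - F x| <= g y - g x.
  move=> xz zy; rewrite /F opprD addrACA subrr add0r.
  apply: le_trans (norm_primitiveB x0 xz (le_trans zy yT) iG) _.
  by rewrite lerD2r; exact: (primitive_norm_homo (le_trans x0 xz) zy yT iG).
have gxy0 : 0 <= g y - g x by apply: le_trans (dF y xy (lexx _)).
apply: le_trans (ler_normB _ _) _; rewrite mulr2n mulrDl; apply: lerD.
  apply: le_trans (expR_taylor1 (F_le x0 xT) (F_le y0 yT)) _.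
  rewrite ler_pM2l ?expR_gt0// -(real_normK (num_real (F y - F x))).
  by rewrite ler_pXn2r ?nnegrE// dF.
have iD : mu.-integrable `]x, y] (EFin \o (fun z => (expR (F z) - expR (F x)) * G z)).
  have := integrableB mD (itvoc_integrable x0 yT iE)
    (integrableZl mD (expR (F x)) (itvoc_integrable x0 yT iG)).
  by apply: eq_integrable => // z _ /=; rewrite mulrBl.
apply: le_trans (le_normr_Rintegral _ iD) _ => //.
have iN := itvoc_integrable x0 yT (integrable_norm iG).
apply: (@le_trans _ _ (\int[mu]_(z in `]x, y]) (expR B * (g y - g x) * `|G z|))).
  apply: le_Rintegral => //.
  - exact: (integrable_norm iD).
  - have := integrableZl mD (expR B * (g y - g x)) iN.
    by apply: eq_integrable => // z _ /=; rewrite EFinM.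
  move=> z /=; rewrite in_itv/= => /andP[/ltW xz zy]; rewrite normrM ler_wpM2r//.
  apply: le_trans (expR_lipschitz (F_le x0 xT) (F_le (le_trans x0 xz) (le_trans zy yT))) _.
  by rewrite ler_pM2l ?expR_gt0// dF.
rewrite (RintegralZl _ mD iN) -(primitiveB x0 xy yT (integrable_norm iG)) -/g.
by rewrite expr2 mulrA.
Qed.

End Chain.

(* Integrate from the last zero of the primitive only. *)
Lemma primitive_pos_le (alpha : R -> R) (beta : R -> \bar R) T : 0 <= T ->
  mu.-integrable `[0, T] (EFin \o alpha) ->
  measurable_fun (`[0, T]%classic : set (measurableTypeR R)) beta ->
  (forall x, (0 <= beta x)%E) ->
  {ae mu, forall x : R, `[0, T]%classic x -> 0 < primitive alpha x ->
    ((alpha x)%:E <= beta x)%E} ->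
  ((Num.max (primitive alpha T) 0)%:E <= \int[mu]_(x in `[0%R, T]) beta x)%E.
Proof.
move=> T0 ia mb b0 hab; set a := primitive alpha.
have [aT|aT] := leP (a T) 0; first exact: integral_ge0.
have ca := primitive_continuous T0 ia; rewrite -/a in ca.
pose S : set R := [set x | 0 <= x /\ x <= T /\ a x <= 0].
have S0 : S 0 by split => //; split => //; rewrite /a primitive0.
have bS : ubound S T by move=> x [_ []].
have hS : has_sup S by split; [exists 0|exists T].
set s := sup S.
have s0 : 0 <= s by apply: ub_le_sup => //; exists T.
have sT : s <= T by apply: ge_sup => //; exists 0.
have as0 : a s <= 0.
  rewrite leNgt; apply/negP => as0.
  have sin : `[0, T]%classic s by rewrite /= in_itv/= s0.
  have : \forall x \near within `[0, T] (nbhs s), 0 < a x.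
    rewrite (nbhs_subspace_in sin).
    exact: (@cvgr_gt R _ (nbhs_subspace s) _ a (a s) (ca s) 0 as0).
  move=> [e /= e0 he].
  have [x [x0 [xT ax]] sx] := sup_adherent e0 hS.
  have xs : x <= s by apply: ub_le_sup; [exists T|split].
  suff : 0 < a x by rewrite ltNge ax.
  apply: (he x) => /=; last by rewrite in_itv/= x0.
  by rewrite ger0_norm ?subr_ge0//; move: sx; rewrite -/s; lra.
have sltT : s < T.
  by rewrite lt_neqAle sT andbT; apply: contraTneq aT => <-; rewrite -leNgt.
have apos x : s < x -> x <= T -> 0 < a x.
  move=> sx xT; rewrite ltNge; apply/negP => ax.
  suff : x <= s by rewrite leNgt sx.
  by apply: ub_le_sup; [exists T|split => //; exact: le_trans s0 (ltW sx)].
have ioc := itvoc_integrable s0 (lexx T) ia.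
have mD : measurable (`]s, T]%classic : set (measurableTypeR R)) by exact: measurable_itv.
have mD0 : measurable (`[0, T]%classic : set (measurableTypeR R)) by exact: measurable_itv.
have sub : `]s, T]%classic `<=` `[0, T]%classic.
  by move=> x /=; rewrite !in_itv/= => /andP[sx ->]; rewrite (le_trans s0 (ltW sx)).
have mbs : measurable_fun (`]s, T]%classic : set (measurableTypeR R)) beta.
  exact: measurable_funS mb.
apply: (@le_trans _ _ (a T - a s)%:E); first by rewrite lee_fin; lra.
rewrite (primitiveB s0 sT (lexx T) ia) /Rintegral fineK; last exact: integrable_fin_num.
apply: (@le_trans _ _ (\int[mu]_(x in `]s, T]) (EFin \o alpha)^\+ x)%E).
  apply: le_integral => //; first exact: integrable_funepos.
  by move=> x _; rewrite funeposE le_max lexx.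
apply: (@le_trans _ _ (\int[mu]_(x in `]s, T]) beta x)%E).
  apply: ae_ge0_le_integral => //.
    by apply: measurable_funepos; case/integrableP : ioc.
  apply: (ae_imp hab) => /= x H xs; rewrite funeposE ge_max b0 andbT.
  by apply: H; [exact: sub|move: xs; rewrite in_itv/= => /andP[? ?]; exact: apos].
exact: ge0_subset_integral.
Qed.

(** Let K be the primitive of 2 k. The integral of k e^K is (e^K - 1) / 2, so each substitution of U
    <= c e^K into the integral inequality halves c, starting from c = M. Continuity of U is thereby
    avoided: a bound and measurability suffice. *)
Lemma gronwall (k U : R -> R) (M T : R) : 0 <= T ->
  mu.-integrable `[0, T] (EFin \o k) ->
  measurable_fun (`[0, T]%classic : set (measurableTypeR R)) U ->
  (forall t, 0 <= t -> t <= T -> 0 <= k t) ->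
  (forall t, 0 <= t -> t <= T -> 0 <= U t <= M) ->
  (forall t, 0 <= t -> t <= T ->
    ((U t)%:E <= \int[mu]_(s in `[0%R, t]) (k s * U s)%R%:E)%E) ->
  forall t, 0 <= t -> t <= T -> U t = 0.
Proof.
move=> T0 ik mU k0 UM hU.
have i2 : mu.-integrable `[0, T] (EFin \o (fun s => 2 * k s)).
  have mD : measurable (`[0, T]%classic : set (measurableTypeR R)) by exact: measurable_itv.
  have := integrableZl mD 2 ik.
  by apply: eq_integrable => // z _ /=; rewrite EFinM.
pose K := primitive (fun s => 2 * k s).
have H n t : 0 <= t -> t <= T -> U t <= M / 2 ^+ n * expR (K t).
  elim: n t => [|n IH] t t0 tT.
    rewrite expr0 divr1; have /andP[U0 UMt] := UM t t0 tT.
    have K0 : 1 <= expR (K t).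
      rewrite -expR0 ler_expR; apply: Rintegral_ge0 => x /=; rewrite in_itv/= => /andP[x0 xt].
      by rewrite mulr_ge0// k0// (le_trans xt).
    by apply: (le_trans UMt); rewrite ler_peMr//; exact: le_trans UMt.
  have M0 : 0 <= M by case/andP: (UM 0 (lexx 0) T0); exact: le_trans.
  have ie := expR_primitive_integrable 0 T0 i2.
  have iet := itv0_integrable tT ie.
  have mD : measurable (`[0, t]%classic : set (measurableTypeR R)) by exact: measurable_itv.
  have ee := expR_primitive 0 T0 i2 t0 tT.
  pose c := M / 2 ^+ n.+1.
  have c0 : 0 <= c by rewrite divr_ge0// exprn_ge0.
  have E : (\int[mu]_(s in `[0%R, t]) (c * (expR (0 + primitive (fun s => 2 * k s) s) * (2 * k s)))%R%:E =
      (c * (expR (K t) - 1))%:E)%E.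
    under eq_integral do rewrite EFinM.
    rewrite (integralZl mD iet) -[X in (_ * X)%E]fineK; last exact: integrable_fin_num.
    rewrite -EFinM; congr (_ * _)%:E.
    by move: ee; rewrite expR0 add0r => ->.
  rewrite -lee_fin; apply: (le_trans (hU t t0 tT)).
  apply: (@le_trans _ _ (c * (expR (K t) - 1))%:E); last first.
    by rewrite lee_fin ler_wpM2l// gerBl.
  rewrite -E; apply: ge0_le_integral => //.
  - move=> x /=; rewrite in_itv/= => /andP[x0 xt].
    have xT := le_trans xt tT.
    by rewrite lee_fin mulr_ge0 ?k0//; case/andP: (UM x x0 xT).
  - apply/measurable_EFinP; apply: measurable_funM.
      apply/measurable_EFinP; have /integrableP[+ _] := itv0_integrable tT ik.
      exact.
    by apply: measurable_funS mU => // x /=; rewrite !in_itv/= => /andP[-> /le_trans]; exact.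
  - apply/measurable_EFinP; apply: measurable_funM => //.
    by apply/measurable_EFinP; case/integrableP : iet.
  - move=> x /=; rewrite in_itv/= => /andP[x0 xt]; have xT := le_trans xt tT.
    rewrite lee_fin add0r -/K.
    rewrite [leRHS](_ : _ = k x * (M / 2 ^+ n * expR (K x))); last first.
      by rewrite /c (exprS 2 n); field; rewrite expf_neq0.
    by rewrite ler_wpM2l ?k0// IH.
move=> t t0 tT; apply/eqP; rewrite eq_le; have /andP[-> _] := UM t t0 tT; rewrite andbT.
apply/ler_addgt0Pr => e e0; rewrite add0r.
set A := M * expR (K t).
have A0 : 0 <= A.
  by rewrite mulr_ge0 ?expR_ge0//; case/andP: (UM t t0 tT) => h1; exact: le_trans h1.
have [n hn] : exists n : nat, A / e <= n%:R.
  exists (Num.bound (A / e)); apply/ltW; apply: archi_boundP.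
  by rewrite divr_ge0// ltW.
apply: le_trans (H n t t0 tT) _.
rewrite mulrAC -/A ler_pdivrMr ?exprn_gt0// mulrC -ler_pdivrMr//.
apply: le_trans hn _; rewrite -natrX ler_nat; exact/ltnW/ltn_expl.
Qed.

End Primitive.

(** * Mild formulation along characteristics *)

Section Shear.
Variable R : realType.
Local Notation mR := (measurableTypeR R).

Definition transl (t : R) (z : phase R) : phase R := (z.1 + t *: z.2, z.2).

Definition untransl (t : R) (z : phase R) : phase R := (z.1 - t *: z.2, z.2).

Lemma translK t : cancel (transl t) (untransl t).
Proof. by move=> [x v]; rewrite /transl /untransl /= addrK. Qed.

Lemma measurable_transl2 : measurable_fun setT
  (fun z : spacetime mR => transl z.1 z.2 : phase mR).
Proof.
rewrite (_ : (fun z => _) = (fun z : spacetime mR =>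
  ((z.2.1.1 + z.1 * z.2.2.1, z.2.1.2 + z.1 * z.2.2.2), z.2.2))); last exact/funext.
by mf.
Qed.

Lemma measurable_untransl2 : measurable_fun setT
  (fun z : spacetime mR => untransl z.1 z.2 : phase mR).
Proof.
rewrite (_ : (fun z => _) = (fun z : spacetime mR =>
  ((z.2.1.1 - z.1 * z.2.2.1, z.2.1.2 - z.1 * z.2.2.2), z.2.2))); last exact/funext.
by mf.
Qed.

Lemma preserves_transl t : preserves (@leb4 R) (transl t : phase mR -> phase mR).
Proof.
apply: (@preserves_fiber1 _ _ _ _ _ _ _ (fun z : phase mR => z.1 + t *: z.2 : plane mR)).
  rewrite (_ : (fun z => _) = (fun z : phase mR =>
    (z.1.1 + t * z.2.1, z.1.2 + t * z.2.2))); last exact/funext.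
  by mf.
by move=> v /=; exact: (preserves_plane_translation (t *: v)).
Qed.

Lemma preserves_shear : preserves (@leb5 R) (@shear R : spacetime mR -> spacetime mR).
Proof.
apply: (@preserves_fiber2 _ _ _ _ _ _ _ (fun z : spacetime mR => transl z.1 z.2 : phase mR)).
  exact: measurable_transl2.
exact: preserves_transl.
Qed.

Lemma measurable_unshear : measurable_fun setT (@unshear R : spacetime mR -> spacetime mR).
Proof. by apply: measurable_fun_pair; [exact: measurable_fst|exact: measurable_untransl2]. Qed.

Lemma measurable_cbox p : measurable (@cbox R p : set (phase mR)).
Proof. by apply: measurableX; apply: measurableX; exact: measurable_itv. Qed.

Lemma measurable_future : measurable (future R : set (spacetime mR)).
Proof.
rewrite (_ : future R = `[0, +oo[%classic `*` setT).
  by apply: measurableX => //; exact: measurable_itv.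
apply/seteqP; split => z; first by move=> z0; split => //=; rewrite in_itv/= andbT.
by move=> [/= + _]; rewrite in_itv/= andbT.
Qed.

Lemma measurable_cutoff (d t : R) : measurable_fun (setT : set mR) (cutoff d t : mR -> mR).
Proof.
have cp : continuous (@plateau R) by exact: elementary_continuous (elementary_plateau (elementary_id R)).
have mp : measurable_fun (setT : set mR) (@plateau R : mR -> mR) by exact: continuous_measurable_fun cp.
apply: measurable_funM.
  apply: (measurableT_comp mp); by mf.
by apply: (measurableT_comp mp); mf.
Qed.

Lemma measurable_plateau' : measurable_fun (setT : set mR) (@plateau' R : mR -> mR).
Proof. exact: continuous_measurable_fun (@plateau'_continuous R). Qed.

Lemma measurable_cutoff' (d t : R) : measurable_fun (setT : set mR) (cutoff' d t : mR -> mR).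
Proof.
apply: measurable_funB; apply: measurable_funM => //; try exact: measurable_cst;
apply: (measurableT_comp measurable_plateau'); by mf.
Qed.

Lemma cutoff_ge0 (d t tau : R) : 0 <= cutoff d t tau.
Proof. by rewrite mulr_ge0// plateau_ge0. Qed.

Lemma cutoff_le1 (d t tau : R) : cutoff d t tau <= 1.
Proof. by rewrite mulr_ile1// ?plateau_ge0 ?plateau_le1. Qed.

Lemma cutoff'_out (d t tau : R) : 0 < d -> 3 * d <= t -> ~ `[0, t]%classic tau ->
  cutoff' d t tau = 0.
Proof.
move=> d0 dt /negP; rewrite /= in_itv/= negb_and -!ltNge /cutoff' => /orP[h|h].
  rewrite plateau'_le0 ?plateau'_ge1 ?mul0r ?subr0//.
    by rewrite ler_pdivlMr//; lra.
  by rewrite pmulr_lle0 ?invr_gt0//; lra.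
rewrite plateau'_ge1; last by rewrite ler_pdivlMr//; lra.
by rewrite plateau'_le0 ?mul0r ?subr0// pmulr_lle0 ?invr_gt0//; lra.
Qed.

(** By [flat_le], [flat 2] is at most 3! = 6 on ]-oo, 1]; [plateau'] has two such factors and two
    factors e. *)
Lemma plateau'_le (x : R) : plateau' x <= 36 * expR 1 ^+ 2.
Proof.
have K0 : 0 <= 36 * expR 1 ^+ 2 :> R by rewrite mulr_ge0 ?exprn_ge0 ?expR_ge0.
have [x0|x0] := leP x 0; first by rewrite plateau'_le0.
have [x1|x1] := leP 1 x; first by rewrite plateau'_ge1.
have h (y : R) : y <= 1 -> flat 2 y <= 6.
  move=> y1; have [y0|y0] := leP y 0; first by rewrite flat_nonpos.
  apply: le_trans (flat_le 2 y) _; rewrite gtr0_norm//.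
  have -> : (3`!)%:R = 6 :> R by [].
  by lra.
rewrite /plateau'.
have h1 : flat 2 (1 - expR 1 * flat 0 (1 - x)) <= 6.
  by apply: h; rewrite gerBl mulr_ge0 ?expR_ge0 ?flat_ge0.
have h2 : flat 2 (1 - x) <= 6 by apply: h; lra.
have -> : 36 * expR 1 ^+ 2 = expR 1 * (6 * (expR 1 * 6)) :> R by ring.
rewrite ler_pM2l ?expR_gt0//; apply: ler_pM; rewrite ?flat_ge0//.
  by rewrite mulr_ge0 ?expR_ge0 ?flat_ge0.
by rewrite ler_pM2l ?expR_gt0.
Qed.

Lemma cutoff'_bounded (d t : R) : 0 < d -> [bounded cutoff' d t tau | tau in [set: R]].
Proof.
move=> d0; exists (2 * (36 * expR 1 ^+ 2 / d)); split; first exact: num_real.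
move=> M hM tau _; apply: le_trans (ltW hM).
have h (x : R) : `|plateau' x / d| <= 36 * expR 1 ^+ 2 / d.
  by rewrite ger0_norm ?divr_ge0 ?plateau'_ge0 ?(ltW d0)// ler_pM2r ?invr_gt0// plateau'_le.
by apply: le_trans (ler_normB _ _) _; rewrite mulr_natl mulr2n lerD.
Qed.

End Shear.

Arguments measurable_future R : clear implicits.

Lemma dominated_cvg_real d (T : measurableType d) (R : realType)
    (m : {measure set T -> \bar R}) (f_ : nat -> T -> R) (f g : T -> R) :
  (forall n, measurable_fun setT (f_ n)) ->
  (forall x, f_ n x @[n --> \oo] --> f x) ->
  m.-integrable setT (EFin \o g) -> (forall n x, `|f_ n x| <= g x) ->
  (\int[m]_x (f_ n x)%:E)%E @[n --> \oo] --> (\int[m]_x (f x)%:E)%E.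
Proof.
move=> mf_ ff ig fg.
have mf : measurable_fun setT f by exact: (measurable_fun_cvg mf_).
have mf_E n : measurable_fun setT (fun x => (f_ n x)%:E) by exact/measurable_EFinP.
have mfE : measurable_fun setT (fun x => (f x)%:E) by exact/measurable_EFinP.
have h1 : {ae m, forall x, setT x -> (f_ n x)%:E @[n --> \oo] --> (f x)%:E}.
  by apply/aeW => x _; apply: cvg_EFin; [exact: nearW|exact: ff].
have h2 : {ae m, forall x n, setT x -> (`|(f_ n x)%:E| <= (EFin \o g) x)%E}.
  by apply/aeW => x n _; rewrite /= lee_fin.
by have [_ _] := dominated_convergence measurableT mf_E mfE h1 ig h2.
Qed.

(** * Approximate unit masses at the two ends of a time interval *)

Section Averaging.
Variable R : realType.
Local Notation mu := (@lebesgue_measure R).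

Lemma average_close (w m : R -> R) (c e t : R) : 0 <= t -> 0 <= e ->
  {within `[0, t], continuous w} -> {within `[0, t], continuous m} ->
  (forall x, 0 <= w x) -> \int[mu]_(x in `[0, t]) w x = 1 ->
  (forall x, 0 <= x -> x <= t -> w x != 0 -> `|m x - c| <= e) ->
  `|\int[mu]_(x in `[0, t]) (w x * m x) - c| <= e.
Proof.
move=> t0 e0 cw cm w0 w1 h.
have mD : measurable (`[0, t]%classic : set (measurableTypeR R)) by exact: measurable_itv.
have ci (k : R -> R) : {within `[0, t], continuous k} -> mu.-integrable `[0, t] (EFin \o k).
  by move=> ck; apply: continuous_compact_integrable => //; exact: segment_compact.
have cwm : {within `[0, t], continuous (fun x => w x * m x)}.
  by move=> x; apply: cvgM; [exact: cw|exact: cm].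
have iw := ci _ cw; have iwm := ci _ cwm.
have iwc : mu.-integrable `[0, t] (EFin \o (fun x => c * w x)).
  have := integrableZl mD c iw.
  by apply: eq_integrable => // z _ /=; rewrite EFinM.
have iwe : mu.-integrable `[0, t] (EFin \o (fun x => e * w x)).
  have := integrableZl mD e iw.
  by apply: eq_integrable => // z _ /=; rewrite EFinM.
have -> : \int[mu]_(x in `[0, t]) (w x * m x) - c =
    \int[mu]_(x in `[0, t]) (w x * m x - c * w x).
  by rewrite (RintegralB mD iwm iwc) (RintegralZl _ mD iw) w1 mulr1.
have iB : mu.-integrable `[0, t] (EFin \o (fun x => w x * m x - c * w x)).
  by have := integrableB mD iwm iwc; apply: eq_integrable => // z _ /=; rewrite EFinB.
apply: le_trans (le_normr_Rintegral mD iB) _.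
apply: (@le_trans _ _ (\int[mu]_(x in `[0, t]) (e * w x))).
  apply: le_Rintegral => //; first exact: integrable_norm iB.
  move=> x /=; rewrite in_itv/= => /andP[x0 xt].
  have -> : w x * m x - c * w x = (m x - c) * w x by ring.
  rewrite normrM (ger0_norm (w0 x)).
  have [->|wn0] := eqVneq (w x) 0; first by rewrite !mulr0.
  by rewrite ler_wpM2r// h.
by rewrite (RintegralZl _ mD iw) w1 mulr1.
Qed.

Lemma scaled_plateau'_continuous (c d : R) :
  continuous (fun y : R => plateau' ((y - c) / d) / d) /\
  continuous (fun y : R => plateau' ((c - y) / d) / d).
Proof.
have h (g : R -> R) : continuous g -> continuous (fun y : R => plateau' (g y / d) / d).
  move=> cg x; apply: cvgM; last exact: cvg_cst.
  apply: (@continuous_comp _ _ _ (fun y : R => g y / d) (@plateau' R)); last exact: plateau'_continuous.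
  by apply: cvgM; [exact: cg|exact: cvg_cst].
split; apply: h => x; first by apply: cvgB; [exact: cvg_id|exact: cvg_cst].
by apply: cvgB; [exact: cvg_cst|exact: cvg_id].
Qed.

Lemma integral_scaled_plateau' (d t : R) : 0 < d -> 3 * d <= t ->
  \int[mu]_(x in `[0, t]) (plateau' ((x - d) / d) / d) = 1 /\
  \int[mu]_(x in `[0, t]) (plateau' ((t - x) / d) / d) = 1.
Proof.
move=> d0 dt; have t0 : 0 < t by lra.
have FTC (P p : R -> R) : continuous p -> (forall x : R, is_derive x (1 : R) P (p x)) ->
    \int[mu]_(x in `[0, t]) p x = P t - P 0.
  move=> cp dP; rewrite /Rintegral (@continuous_FTC2 _ p P 0 t t0)//.
  - exact: continuous_subspaceT.
  - have cP : continuous P.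
      by move=> x; apply: differentiable_continuous; apply/derivable1_diffP; case: (dP x).
    split => [x _||]; first by case: (dP x).
      exact: cvg_at_right_filter (cP 0).
    exact: cvg_at_left_filter (cP t).
  - by move=> x _; rewrite derive1E; case: (dP x).
have [c1 _] := scaled_plateau'_continuous d d; have [_ c2] := scaled_plateau'_continuous t d.
split.
  rewrite (FTC _ _ c1 (fun x => (plateau_scaled_derive d d x).1)).
  rewrite plateau_1 ?plateau_0 ?subr0//.
    by rewrite pmulr_lle0 ?invr_gt0//; lra.
  by rewrite ler_pdivlMr//; lra.
have dN x : is_derive x (1 : R) (fun y : R => - plateau ((t - y) / d) : R)
    (plateau' ((t - x) / d) / d).
  have [_ h] := plateau_scaled_derive t d x.
  by have := is_deriveN h; rewrite opprK.
rewrite (FTC _ _ c2 dN).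
have e0 : (t - t) / d = 0 by rewrite subrr mul0r.
have e1 : 1 <= (t - 0) / d by rewrite ler_pdivlMr//; lra.
by rewrite e0 (plateau_0 (lexx 0)) (plateau_1 e1) oppr0 sub0r opprK.
Qed.

(* cutoff' is the difference of two approximate unit masses at 0+ and t-. *)
Lemma cvg_cutoff' (m : R -> R) (t : R) : 0 < t ->
  {within `[0, t], continuous m} ->
  (\int[mu]_(x in `[0, t]) (cutoff' (t / n.+3%:R) t x * m x)) @[n --> \oo] --> m 0 - m t.
Proof.
move=> t0 cm; apply/cvgrPdist_le => e e0.
have itv0 : `[0, t]%classic (0 : R) by rewrite /= in_itv/= lexx ltW.
have itvt : `[0, t]%classic t by rewrite /= in_itv/= lexx ltW.
have h0 : \forall x \near within `[0, t] (nbhs 0), `|m 0 - m x| <= e / 2.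
  rewrite (nbhs_subspace_in itv0).
  by have /cvgrPdist_le := cm 0; apply; rewrite divr_gt0.
have ht : \forall x \near within `[0, t] (nbhs t), `|m t - m x| <= e / 2.
  rewrite (nbhs_subspace_in itvt).
  by have /cvgrPdist_le := cm t; apply; rewrite divr_gt0.
case: h0 => r0 /= r00 h0; case: ht => r1 /= r10 ht.
pose r := Num.min r0 r1; have r_gt0 : 0 < r by rewrite lt_min r00.
near=> n.
(* The shift by 3 gives 3 d <= t, which keeps the two ramps of the cutoff apart. *)
set d := t / n.+3%:R.
have d0 : 0 < d by rewrite divr_gt0.
have dt : 3 * d <= t.
  by rewrite /d mulrCA ler_piMr ?(ltW t0)// ler_pdivrMr// mul1r ler_nat.
(* The two masses live on [d, 2 d] and [t - d, t], within distance r of 0 and of t. *)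
have dr : 2 * d < r.
  rewrite /d mulrA ltr_pdivrMr// -ltr_pdivrMl//.
  near: n; exists (Num.bound (r^-1 * (2 * t))) => // k /= hk.
  apply: lt_le_trans (archi_boundP _) _; first by rewrite mulr_ge0 ?invr_ge0 ?ltW// mulr_gt0.
  by rewrite ler_nat; apply: leq_trans hk _; rewrite -addn3 leq_addr.
have [i1 i2] := integral_scaled_plateau' d0 dt.
have [c1 _] := scaled_plateau'_continuous d d; have [_ c2] := scaled_plateau'_continuous t d.
have mD : measurable (`[0, t]%classic : set (measurableTypeR R)) by exact: measurable_itv.
have ci (k : R -> R) : {within `[0, t], continuous k} -> mu.-integrable `[0, t] (EFin \o k).
  by move=> ck; apply: continuous_compact_integrable => //; exact: segment_compact.
have cwm (w : R -> R) : continuous w -> {within `[0, t], continuous (fun x => w x * m x)}.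
  by move=> cw x; apply: cvgM; [exact: continuous_subspaceT|exact: cm].
have -> : \int[mu]_(x in `[0, t]) (cutoff' d t x * m x) =
    \int[mu]_(x in `[0, t]) (plateau' ((x - d) / d) / d * m x) -
    \int[mu]_(x in `[0, t]) (plateau' ((t - x) / d) / d * m x).
  rewrite -(RintegralB mD (ci _ (cwm _ c1)) (ci _ (cwm _ c2))).
  by apply: eq_Rintegral => x _; rewrite /cutoff' mulrBl.
have e20 : 0 <= e / 2 by rewrite divr_ge0 ?ltW.
have cw1 : {within `[0, t], continuous (fun x => plateau' ((x - d) / d) / d)}.
  exact: continuous_subspaceT.
have cw2 : {within `[0, t], continuous (fun x => plateau' ((t - x) / d) / d)}.
  exact: continuous_subspaceT.
have p0 (y : R) : 0 <= plateau' y / d by rewrite divr_ge0 ?plateau'_ge0 ?ltW.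
have a1 : `|\int[mu]_(x in `[0, t]) (plateau' ((x - d) / d) / d * m x) - m 0| <= e / 2.
  apply: (average_close (ltW t0) e20 cw1 cm (fun x => p0 _) i1).
  move=> x x0 xt; apply: contraNle => hx; apply/eqP; rewrite plateau'_ge1 ?mul0r//.
  rewrite ler_pdivlMr// mul1r lerBrDr leNgt; apply/negP => xd; move: hx; apply/negP.
  rewrite -leNgt distrC; apply: h0 => /=; last by rewrite in_itv/= x0.
  rewrite sub0r normrN ger0_norm//; apply: lt_le_trans (_ : r <= _); last by rewrite ge_min lexx.
  by apply: lt_trans xd _; rewrite -mulr2n -mulr_natl.
have a2 : `|\int[mu]_(x in `[0, t]) (plateau' ((t - x) / d) / d * m x) - m t| <= e / 2.
  apply: (average_close (ltW t0) e20 cw2 cm (fun x => p0 _) i2).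
  move=> x x0 xt; apply: contraNle => hx; apply/eqP; rewrite plateau'_ge1 ?mul0r//.
  rewrite ler_pdivlMr// mul1r leNgt; apply/negP => xd; move: hx; apply/negP.
  rewrite -leNgt distrC; apply: ht => /=; last by rewrite in_itv/= x0.
  rewrite ger0_norm ?subr_ge0//; apply: lt_le_trans (_ : r <= _); last by rewrite ge_min lexx orbT.
  apply: lt_trans xd (lt_trans _ dr); by rewrite ltr_pMl// ltr1n.
set A := \int[mu]_(x in _) _ in a1 *; set B := \int[mu]_(x in _) _ in a2 *.
have -> : m 0 - m t - (A - B) = - (A - m 0) + (B - m t) by ring.
by apply: le_trans (ler_normD _ _) _; rewrite normrN [leRHS]splitr lerD.
Unshelve. all: by end_near. Qed.

End Averaging.

Lemma measurable_sheared_box (R : realType) (a b : R) p :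
  measurable (sheared_box a b p : set (spacetime (measurableTypeR R))).
Proof.
rewrite -[X in measurable X]setTI; apply: (measurable_unshear measurableT).
by apply: measurableX; [exact: measurable_itv|exact: measurable_cbox].
Qed.

Section Cubes.
Variable R : realType.

Definition cube (n : nat) : (plane R * plane R) * (plane R * plane R) :=
  ((((- n%:R), n%:R), ((- n%:R), n%:R)), (((- n%:R), n%:R), ((- n%:R), n%:R))).

Lemma obox_cube (z : phase R) : exists n, forall m, (n <= m)%N -> obox (cube m) z.
Proof.
pose M := Num.max (Num.max `|z.1.1| `|z.1.2|) (Num.max `|z.2.1| `|z.2.2|).
have M0 : 0 <= M by rewrite !le_max normr_ge0.
have hM := archi_boundP M0; exists (Num.bound M) => m Mm.
have {hM} : M < m%:R by apply: lt_le_trans hM _; rewrite ler_nat.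
rewrite /M !gt_max => /andP[/andP[h1 h2] /andP[h3 h4]].
by split; split => /=; rewrite in_itv/= -ltr_norml.
Qed.

End Cubes.
Arguments cube R n : clear implicits.

(** * The weak transport equation in Lagrangian coordinates *)

Section Mild.
Variable R : realType.
Local Notation mR := (measurableTypeR R).
Variables F G : spacetime mR -> R.
Hypotheses (mF : measurable_fun (future R) F) (mG : measurable_fun (future R) G).
Hypothesis LF : forall t p, leb5.-integrable (sheared_box 0 t p) (EFin \o F).
Hypothesis LG : forall t p, leb5.-integrable (sheared_box 0 t p) (EFin \o G).
Hypothesis iF : forall t : R, 0 <= t -> leb4.-integrable setT (fun z => (F (t, z))%:E).
Hypothesis cF : forall t0 : R, 0 <= t0 ->
  (\int[leb4]_z (`|F (t, z) - F (t0, z)|)%:E)%E @[t --> within `[0, +oo[ (nbhs t0)] --> 0%E.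
Hypothesis W : forall (d t : R) n p, 0 < d -> 3 * d <= t ->
  (- (\int[leb5]_(z in future R) (F z * (cutoff' d t z.1 * bumps n p (unshear z).2))%:E) =
   \int[leb5]_(z in future R) (G z * testfun d t n p z)%:E)%E.

(** In Lagrangian coordinates the equation to be integrated is d_t [Fs] = [Gs], with the phase point
    as a mere parameter. *)
Let Fs : spacetime mR -> R := F \o @shear R.
Let Gs : spacetime mR -> R := G \o @shear R.

Local Notation slab t p := (`[0, t]%classic `*` cbox p).

Lemma measurable_slab t p : measurable (slab t p : set (spacetime mR)).
Proof. by apply: measurableX; [exact: measurable_itv|exact: measurable_cbox]. Qed.

Lemma sheared_integrable (H : spacetime mR -> R) t p :
  leb5.-integrable (sheared_box 0 t p) (EFin \o H) ->
  leb5.-integrable (slab t p) (EFin \o (H \o @shear R)).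
Proof.
move=> iS.
have := preserves_integrable (@preserves_shear R) (measurable_sheared_box 0 t p) iS.
rewrite (_ : @shear R @^-1` _ = slab t p)//.
by apply/seteqP; split => z; rewrite /sheared_box /preimage /mkset shearK.
Qed.

(** The slab enters as a factor and not as the domain of integration, so that Fubini applies on the
    whole product. Nothing is lost, since the test functions and their transports vanish off the
    slab. *)
Definition cut (H : spacetime mR -> R) t p (z : spacetime mR) : R :=
  H z * \1_(slab t p) z.

Lemma cut_integrable (H : spacetime mR -> R) t p :
  leb5.-integrable (slab t p) (EFin \o H) -> leb5.-integrable setT (EFin \o cut H t p).
Proof.
move=> /(integrable_mkcond _ (measurable_slab t p)).1.
apply: eq_integrable => // z _ /=; rewrite /patch /cut indicE.
by case: ifPn => _; rewrite ?mulr1 ?mulr0.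
Qed.

Lemma weak_sheared (d t : R) n p : 0 < d -> 3 * d <= t ->
  (- (\int[leb5]_(z in future R) (Fs z * (cutoff' d t z.1 * bumps n p z.2))%:E) =
   \int[leb5]_(z in future R) (Gs z * (cutoff d t z.1 * bumps n p z.2))%:E)%E.
Proof.
move=> d0 dt; have := W n p d0 dt.
have mcv (H : spacetime mR -> R) (c : mR -> mR) : measurable_fun (future R) H -> measurable_fun setT c ->
  (\int[leb5]_(z in future R) (H z * (c z.1 * bumps n p (unshear z).2))%:E =
   \int[leb5]_(z in future R) (H (shear z) * (c z.1 * bumps n p z.2))%:E)%E.
  move=> mH mc.
  have mk : measurable_fun (future R)
     (fun z : spacetime mR => (H z * (c z.1 * bumps n p (unshear z).2))%:E).
    apply/measurable_EFinP; apply: measurable_funM => //.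
    apply: measurable_funTS; apply: measurable_funM.
      by apply: (measurableT_comp mc); exact: measurable_fst.
    apply: (measurableT_comp (measurable_bumps n p)).
    by apply: (measurableT_comp measurable_snd); exact: measurable_unshear.
  rewrite -(preserves_integral (@preserves_shear R) (measurable_future R) mk).
  apply: eq_integral => z _; rewrite shearK//.
rewrite (mcv F _ mF (measurable_cutoff' d t)) => ->.
by rewrite /testfun (mcv G _ mG (measurable_cutoff d t)).
Qed.

Lemma weak_cut (d t : R) n p : 0 < d -> 3 * d <= t ->
  (- (\int[leb5]_z (cut Fs t p z * (cutoff' d t z.1 * bumps n p z.2))%:E) =
   \int[leb5]_z (cut Gs t p z * (cutoff d t z.1 * bumps n p z.2))%:E)%E.
Proof.
move=> d0 dt; have := weak_sheared n p d0 dt.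
have E (H : spacetime mR -> R) (c : R -> R) : (forall x, ~ `[0, t]%classic x -> c x = 0) ->
  (\int[leb5]_(z in future R) (H z * (c z.1 * bumps n p z.2))%:E =
  \int[leb5]_z (cut H t p z * (c z.1 * bumps n p z.2))%:E)%E.
  move=> hc; rewrite integral_mkcond; apply: eq_integral => z _; rewrite /patch /cut indicE.
  have [|nz] := pselect (slab t p z).
    move=> zs; rewrite [z \in slab _ _]mem_set// mulr1 ifT//; apply/mem_set.
    by case: zs => /= + _; rewrite in_itv/= => /andP[].
  rewrite [z \in slab _ _]memNset// mulr0 mul0r.
  have -> : c z.1 * bumps n p z.2 = 0.
    have [h1|h1] := pselect (`[0, t]%classic z.1); last by rewrite hc// mul0r.
    by rewrite bumps_out ?mulr0// => /obox_cbox h2; apply: nz.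
  by rewrite mulr0; case: ifP.
rewrite (E Fs); last by move=> x; exact: cutoff'_out.
rewrite (E Gs)// => x hx; rewrite cutoff_out// => /=; rewrite in_itv/= => /andP[h1 h2].
by apply: hx; rewrite /= in_itv/= !ltW// (lt_trans d0).
Qed.

(** The moment of the solution at time t against a weight that is carried along by the free flow. *)
Definition momentum (psi : phase R -> R) (t : R) : R :=
  \int[leb4]_z (Fs (t, z) * psi z).

Lemma sheared_slice_integrable (t : R) : 0 <= t ->
  leb4.-integrable setT (fun z => (Fs (t, z))%:E).
Proof.
move=> t0; have := preserves_integrable (preserves_transl t) measurableT (iF t0).
by rewrite preimage_setT.
Qed.

Lemma sheared_slice_psi_integrable (psi : phase mR -> R) (t : R) : 0 <= t ->
  measurable_fun setT psi -> (forall z, 0 <= psi z <= 1) ->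
  leb4.-integrable setT (EFin \o (fun z => Fs (t, z) * psi z)).
Proof.
move=> t0 mpsi psi01.
have bpsi : [bounded psi z | z in [set: phase R]].
  exists 1; split; first exact: num_real.
  move=> M hM z _ /=; have /andP[h0 h1] := psi01 z; rewrite ger0_norm//.
  exact: le_trans h1 (ltW hM).
have := @integrableMl _ _ _ leb4 setT measurableT _ psi (sheared_slice_integrable t0) mpsi bpsi.
by apply: eq_integrable => // z _ /=; rewrite EFinM.
Qed.

(** The change of variables moves the free flow from [F], which is only integrable, to the weight,
    which is continuous in the application. Continuity in time can then be read off from that of [F]
    in L^1. *)
Lemma momentum_untransl (psi : phase mR -> R) (t : R) : 0 <= t -> measurable_fun setT psi ->
  momentum psi t = \int[leb4]_z (F (t, z) * psi (untransl t z)).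
Proof.
move=> t0 mpsi; rewrite /momentum /Rintegral; congr fine.
have mk : measurable_fun setT (fun z : phase mR => (F (t, z) * psi (untransl t z))%:E).
  apply/measurable_EFinP; apply: measurable_funM.
    by apply/measurable_EFinP; case/integrableP: (iF t0).
  apply: (measurableT_comp mpsi).
  by apply: (measurable_fun_pair2 (f := fun z : spacetime mR => untransl z.1 z.2)); exact: measurable_untransl2.
rewrite -(preserves_integral (preserves_transl t) measurableT mk) preimage_setT.
by apply: eq_integral => z _; rewrite translK.
Qed.

(** The moment splits as A + B. In A the increment F(t) - F(t0) is tested against a weight bounded
    by 1, which is small in L^1; in B only the weight depends on t, and dominated convergence
    applies. *)
Lemma momentum_continuous n p (t0 : R) : 0 <= t0 ->
  momentum (bumps n p) t @[t --> within `[0, +oo[ (nbhs t0)] --> momentum (bumps n p) t0.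
Proof.
move=> t00; pose psi := bumps n p.
have mpsi := measurable_bumps n p.
have psi01 z : 0 <= psi z <= 1 by rewrite bumps_ge0 bumps_le1.
have mpu t : measurable_fun setT (fun z : phase mR => psi (untransl t z) : mR).
  apply: (measurableT_comp mpsi).
  by apply: (measurable_fun_pair2 (f := fun z : spacetime mR => untransl z.1 z.2)); exact: measurable_untransl2.
have bpu t : [bounded psi (untransl t z) | z in [set: phase R]].
  exists 1; split; first exact: num_real.
  move=> M hM z _ /=; have /andP[h0 h1] := psi01 (untransl t z); rewrite ger0_norm//.
  exact: le_trans h1 (ltW hM).
have ipu s t : 0 <= s -> leb4.-integrable setT (EFin \o (fun z => F (s, z) * psi (untransl t z))).
  move=> s0; have := @integrableMl _ _ _ leb4 setT measurableT _ _ (iF s0) (mpu t) (bpu t).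
  by apply: eq_integrable => // z _ /=; rewrite EFinM.
pose B (t : R) : R := \int[leb4]_z (F (t0, z) * psi (untransl t z)).
have cB : B t @[t --> t0] --> B t0.
  have := @continuity_under_integral R _ _ leb4 (fun t z => F (t0, z) * psi (untransl t z))
    setT measurableT (t0 - 1) (t0 + 1) (fun t _ => ipu t0 t t00) _ (fun z => `|F (t0, z)|) _ _ t0.
  apply.
  - apply/aeW => z _ t _.
    apply: cvgM; first exact: cvg_cst.
    have h a b x v : bump n a b (x - s * v) @[s --> t] --> bump n a b (x - t * v).
      apply: (@continuous_cvg _ _ _ _ _ (fun s => x - s * v) (bump n a b)).
        exact: elementary_continuous (elementary_bump n a b) _.
      apply: cvgB; first exact: cvg_cst.
      by apply: cvgM; [exact: cvg_id|exact: cvg_cst].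
    exact: (cvgM (cvgM (h _ _ _ _) (h _ _ _ _)) (cvg_cst _)).
  - exact: (integrable_abse (iF t00)).
  - move=> t _; apply/aeW => z _ /=; rewrite normrM ler_piMr//.
    by have /andP[h0 h1] := psi01 (untransl t z); rewrite ger0_norm.
  - by rewrite inE/= in_itv/=; apply/andP; split; lra.
have -> : momentum psi t0 = 0 + B t0 by rewrite add0r momentum_untransl.
pose A (t : R) : R := \int[leb4]_z ((F (t, z) - F (t0, z)) * psi (untransl t z)).
have cA : A t @[t --> within `[0, +oo[ (nbhs t0)] --> 0.
  pose N (t : R) := (\int[leb4]_z (`|F (t, z) - F (t0, z)|)%:E)%E.
  have cN : fine (N t) @[t --> within `[0, +oo[ (nbhs t0)] --> 0.
    by apply: fine_cvg; exact: cF.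
  have iD t : 0 <= t -> leb4.-integrable setT (EFin \o (fun z => F (t, z) - F (t0, z))).
    move=> t1; have := integrableB measurableT (iF t1) (iF t00).
    by apply: eq_integrable => // z _ /=; rewrite EFinB.
  have iDp t : 0 <= t -> leb4.-integrable setT (EFin \o (fun z => (F (t, z) - F (t0, z)) * psi (untransl t z))).
    move=> t1; have := @integrableMl _ _ _ leb4 setT measurableT _ _ (iD t t1) (mpu t) (bpu t).
    by apply: eq_integrable => // z _ /=; rewrite EFinM.
  apply: (@squeeze_cvgr _ _ _ _ (fun t => - fine (N t)) (fun t => fine (N t)) A).
  - near=> t; rewrite -ler_norml.
    have t1 : 0 <= t.
      have : `[0, +oo[%classic t by near: t; exact: withinT.
      by rewrite /= in_itv/= andbT.
    apply: le_trans (le_normr_Rintegral measurableT (iDp t t1)) _.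
    apply: le_Rintegral => //; [exact: integrable_norm (iDp t t1)|exact: integrable_norm (iD t t1)|].
    move=> z _; rewrite normrM ler_piMr//.
    by have /andP[h0 h1] := psi01 (untransl t z); rewrite ger0_norm.
  - have h := cvgN cN; rewrite oppr0 in h; exact: h.
  - exact: cN.
apply: cvg_trans (cvgD cA (cvg_within_filter `[0, +oo[ cB)).
apply: near_eq_cvg; near=> t.
have t1 : 0 <= t.
  have : `[0, +oo[%classic t by near: t; exact: withinT.
  by rewrite /= in_itv/= andbT.
have iDp : leb4.-integrable setT (EFin \o (fun z => (F (t, z) - F (t0, z)) * psi (untransl t z))).
  have := integrableB measurableT (ipu t t t1) (ipu t0 t t00).
  by apply: eq_integrable => // z _ /=; rewrite mulrBl EFinB.
suff e : momentum psi t = A t + B t by rewrite e.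
rewrite momentum_untransl// /A /B -(RintegralD measurableT iDp (ipu t0 t t00)).
by apply: eq_Rintegral => z _; ring.
Unshelve. all: by end_near. Qed.

Lemma integral_cut_momentum (k : mR -> mR) n p (t : R) :
  measurable_fun setT k -> [bounded k tau | tau in [set: R]] ->
  (\int[leb5]_z (cut Fs t p z * (k z.1 * bumps n p z.2))%:E =
   \int[leb1]_(tau in `[0%R, t]) (k tau * momentum (bumps n p) tau)%:E)%E.
Proof.
move=> mk [K [_ bk]].
have psi01 z : 0 <= bumps n p z <= 1 by rewrite bumps_ge0 bumps_le1.
have mkp : measurable_fun setT (fun z : spacetime mR => k z.1 * bumps n p z.2 : mR).
  apply: measurable_funM.
    by apply: (measurableT_comp mk); exact: measurable_fst.
  by apply: (measurableT_comp (measurable_bumps n p)); exact: measurable_snd.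
have bkp : [bounded k z.1 * bumps n p z.2 | z in [set: spacetime R]].
  exists K; split; first exact: num_real.
  move=> M hM z _ /=; rewrite normrM; have /andP[h0 h1] := psi01 z.2.
  by rewrite (ger0_norm h0); apply: le_trans (ler_piMr _ h1) _ => //; exact: bk.
have iC := cut_integrable (sheared_integrable (LF t p)).
have iP : leb5.-integrable setT (EFin \o (fun z : spacetime mR => cut Fs t p z * (k z.1 * bumps n p z.2))).
  have := @integrableMl _ _ _ leb5 setT measurableT _ _ iC mkp bkp.
  by apply: eq_integrable => // z _ /=; rewrite EFinM.
rewrite -[LHS](integral12_prod_meas1 (m1 := leb1) (m2 := leb4) iP).
rewrite [RHS]integral_mkcond; apply: eq_integral => tau _; rewrite /fubini_F /patch.
case: ifPn => [/set_mem ht|ht]; last first.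
  apply: integral0_eq => z _ /=; rewrite /cut indicE memNset ?mulr0 ?mul0r//.
  by move=> [/= h _]; move/negP: ht; apply; exact/mem_set.
have tau0 : 0 <= tau by move: ht; rewrite /= in_itv/= => /andP[].
have iS := sheared_slice_psi_integrable tau0 (measurable_bumps n p) psi01.
transitivity (\int[leb4]_z ((k tau)%:E * (Fs (tau, z) * bumps n p z)%:E))%E.
  apply: eq_integral => z _ /=; rewrite -EFinM; congr EFin; rewrite /cut indicE.
  have [hz|hz] := pselect (cbox p z).
    by rewrite mem_set ?mulr1; [ring|split].
  by rewrite (@bumps_out _ n p z) ?mulr0// => /obox_cbox.
rewrite (integralZl measurableT iS) /momentum /Rintegral EFinM; congr (_ * _)%E.
by rewrite fineK//; exact: integrable_fin_num.
Qed.

Lemma momentum_within n p (t : R) : {within `[0, t], continuous (momentum (bumps n p))}.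
Proof.
have h : {within `[0, +oo[, continuous (momentum (bumps n p))}.
  apply/subspace_continuousP => x /=; rewrite in_itv/= andbT => x0.
  exact: momentum_continuous.
by apply: continuous_subspaceW h => x /=; rewrite !in_itv/= => /andP[->].
Qed.

Lemma cvg_cutoff (t tau : R) : 0 < t ->
  cutoff (t / n.+3%:R) t tau @[n --> \oo] --> (\1_(`]0, t[%classic) tau : R).
Proof.
move=> t0; rewrite indicE.
have d0 n : 0 < t / n.+3%:R :> R by rewrite divr_gt0.
have [|ht] := pselect (`]0, t[%classic tau); last first.
  rewrite memNset//; apply: cvg_near_cst; apply: nearW => n; rewrite cutoff_out// => h.
  by apply: ht; move: h; rewrite /= !in_itv/= => /andP[/(lt_trans (d0 n)) -> ->].
move=> ht; rewrite mem_set//; move: ht; rewrite /= in_itv/= => /andP[h0 h1].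
pose r := Num.min tau (t - tau).
have r0 : 0 < r by rewrite lt_min h0 subr_gt0.
apply: cvg_near_cst; near=> n.
have dr : 2 * (t / n.+3%:R) < r.
  rewrite mulrA ltr_pdivrMr// -ltr_pdivrMl//.
  near: n; exists (Num.bound (r^-1 * (2 * t))) => // k /= hk.
  apply: lt_le_trans (archi_boundP _) _; first by rewrite mulr_ge0 ?invr_ge0 ?ltW// mulr_gt0.
  by rewrite ler_nat; apply: leq_trans hk _; rewrite -addn3 leq_addr.
move: dr; rewrite lt_min => /andP[]; have := d0 n.
move: (t / n.+3%:R) => d dn dr1 dr2.
rewrite /cutoff !plateau_1 ?mulr1//.
  by rewrite ler_pdivlMr//; lra.
by rewrite ler_pdivlMr//; lra.
Unshelve. all: by end_near. Qed.

Lemma momentum_increment n p (t : R) : 0 < t ->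
  ((momentum (bumps n p) t - momentum (bumps n p) 0)%:E =
   \int[leb5]_z (cut Gs t p z * (\1_(`]0%R, t[%classic) z.1 * bumps n p z.2))%:E)%E.
Proof.
move=> t0.
have d0 k : 0 < t / k.+3%:R :> R by rewrite divr_gt0.
have dt k : 3 * (t / k.+3%:R) <= t.
  by rewrite mulrCA ler_piMr ?(ltW t0)// ler_pdivrMr// mul1r ler_nat.
have cA := cvg_cutoff' t0 (@momentum_within n p t).
have E k : (\int[leb5]_z (cut Gs t p z * (cutoff (t / k.+3%:R) t z.1 * bumps n p z.2))%:E =
   (- \int[lebesgue_measure]_(x in `[0, t]) (cutoff' (t / k.+3%:R) t x * momentum (bumps n p) x))%:E)%E.
  rewrite -(weak_cut n p (d0 k) (dt k)).
  rewrite (integral_cut_momentum _ _ _ (measurable_cutoff' _ _) (cutoff'_bounded t (d0 k))) EFinN.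
  congr (- _)%E; rewrite /Rintegral fineK//.
  have := @continuous_compact_integrable R
    (fun x => cutoff' (t / k.+3%:R) t x * momentum (bumps n p) x) `[0, t]%classic (@segment_compact R 0 t).
  move=> h; apply: integrable_fin_num => //; apply: h.
  have [c1 _] := scaled_plateau'_continuous (t / k.+3%:R) (t / k.+3%:R).
  have [_ c2] := scaled_plateau'_continuous t (t / k.+3%:R).
  have cc : continuous (cutoff' (t / k.+3%:R) t) by move=> x; exact: (cvgB (c1 x) (c2 x)).
  have cs : {within `[0, t], continuous (cutoff' (t / k.+3%:R) t)} by exact: continuous_subspaceT.
  by move=> x; apply: cvgM; [exact: cs|exact: momentum_within].
have psi01 z : 0 <= bumps n p z <= 1 by rewrite bumps_ge0 bumps_le1.
have iC := cut_integrable (sheared_integrable (LG t p)).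
have mC : measurable_fun setT (cut Gs t p).
  by apply/measurable_EFinP; case/integrableP: iC.
have mI : measurable_fun setT (\1_(`]0, t[%classic) : mR -> mR) by exact: measurable_indic.
have mprod (k : mR -> mR) : measurable_fun setT k ->
    measurable_fun setT (fun z : spacetime mR => cut Gs t p z * (k z.1 * bumps n p z.2)).
  move=> mk; apply: measurable_funM => //; apply: measurable_funM.
    by apply: (measurableT_comp mk); exact: measurable_fst.
  by apply: (measurableT_comp (measurable_bumps n p)); exact: measurable_snd.
have bnd (k : nat) (z : spacetime mR) : `|cut Gs t p z * (cutoff (t / k.+3%:R) t z.1 * bumps n p z.2)| <= `|cut Gs t p z|.
  have c0 := cutoff_ge0 (t / k.+3%:R) t z.1; have c1 := cutoff_le1 (t / k.+3%:R) t z.1.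
  have b0 := bumps_ge0 n p z.2; have b1 := bumps_le1 n p z.2.
  rewrite normrM; apply: ler_piMr => //.
  by rewrite ger0_norm; [exact: mulr_ile1|exact: mulr_ge0].
have cB : (\int[leb5]_z (cut Gs t p z * (cutoff (t / k.+3%:R) t z.1 * bumps n p z.2))%:E)%E @[k --> \oo]
    --> (\int[leb5]_z (cut Gs t p z * (\1_(`]0%R, t[%classic) z.1 * bumps n p z.2))%:E)%E.
  apply: (@dominated_cvg_real _ _ _ leb5 _ _ (fun z => `|cut Gs t p z|)).
  - by move=> k; apply: mprod; exact: measurable_cutoff.
  - move=> z; apply: cvgM; first exact: cvg_cst.
    by apply: cvgM; [exact: cvg_cutoff|exact: cvg_cst].
  - exact: (integrable_abse iC).
  - exact: bnd.
have cL : (\int[leb5]_z (cut Gs t p z * (cutoff (t / k.+3%:R) t z.1 * bumps n p z.2))%:E)%E @[k --> \oo]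
    --> (momentum (bumps n p) t - momentum (bumps n p) 0)%:E.
  under eq_fun do rewrite E.
  apply: cvg_EFin; first exact: nearW.
  have h := cvgN cA; rewrite opprB in h; exact: h.
exact: (cvg_unique (@ereal_hausdorff R) cL cB).
Qed.

Let one01 (n : nat) p (z : phase mR) : 0 <= bumps n p z <= 1.
Proof. by rewrite bumps_ge0 bumps_le1. Qed.

Let cut_measurable t p : measurable_fun setT (cut Gs t p).
Proof.
by apply/measurable_EFinP; case/integrableP: (cut_integrable (sheared_integrable (LG t p))).
Qed.

Lemma increment_integrable (t : R) : 0 <= t ->
  leb4.-integrable setT (EFin \o (fun z => Fs (t, z) - Fs (0, z))).
Proof.
move=> t0; have := integrableB measurableT (sheared_slice_integrable t0)
  (sheared_slice_integrable (lexx 0)).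
by apply: eq_integrable => // z _ /=; rewrite EFinB.
Qed.

Lemma box_increment p (t : R) : 0 < t ->
  (\int[leb4]_z ((Fs (t, z) - Fs (0, z)) * \1_(obox p) z)%:E =
   \int[leb5]_z (cut Gs t p z * (\1_(`]0%R, t[%classic) z.1 * \1_(obox p) z.2))%:E)%E.
Proof.
move=> t0.
have iI := increment_integrable (ltW t0).
have mI : measurable_fun setT (fun z => Fs (t, z) - Fs (0, z)).
  by apply/measurable_EFinP; case/integrableP: iI.
have E n : (\int[leb4]_z ((Fs (t, z) - Fs (0, z)) * bumps n p z)%:E =
    \int[leb5]_z (cut Gs t p z * (\1_(`]0%R, t[%classic) z.1 * bumps n p z.2))%:E)%E.
  rewrite -momentum_increment// /momentum.
  have i1 := sheared_slice_psi_integrable (ltW t0) (measurable_bumps n p) (one01 n p).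
  have i2 := sheared_slice_psi_integrable (lexx 0) (measurable_bumps n p) (one01 n p).
  rewrite -(RintegralB measurableT i1 i2) /Rintegral fineK; last first.
    apply: integrable_fin_num => //; have := integrableB measurableT i1 i2.
    by apply: eq_integrable => // z _ /=; rewrite EFinB.
  by apply: eq_integral => z _; rewrite mulrBl.
have cL : (\int[leb4]_z ((Fs (t, z) - Fs (0, z)) * bumps n p z)%:E)%E @[n --> \oo] -->
    (\int[leb4]_z ((Fs (t, z) - Fs (0, z)) * \1_(obox p) z)%:E)%E.
  apply: (@dominated_cvg_real _ _ _ leb4 _ _ (fun z => `|Fs (t, z) - Fs (0, z)|)).
  - by move=> n; apply: measurable_funM => //; exact: measurable_bumps.
  - by move=> z; apply: cvgM; [exact: cvg_cst|exact: cvg_bumps].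
  - exact: (integrable_abse iI).
  - move=> n z; rewrite normrM; apply: ler_piMr => //.
    by rewrite ger0_norm ?bumps_ge0 ?bumps_le1.
have cR : (\int[leb5]_z (cut Gs t p z * (\1_(`]0%R, t[%classic) z.1 * bumps n p z.2))%:E)%E @[n --> \oo] -->
    (\int[leb5]_z (cut Gs t p z * (\1_(`]0%R, t[%classic) z.1 * \1_(obox p) z.2))%:E)%E.
  apply: (@dominated_cvg_real _ _ _ leb5 _ _ (fun z => `|cut Gs t p z|)).
  - move=> n; apply: measurable_funM; first exact: cut_measurable.
    apply: measurable_funM.
      apply: (measurableT_comp (f := \1_(`]0, t[%classic) : mR -> mR)); last exact: measurable_fst.
      exact: measurable_indic.
    by apply: (measurableT_comp (measurable_bumps n p)); exact: measurable_snd.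
  - move=> z; apply: cvgM; first exact: cvg_cst.
    by apply: cvgM; [exact: cvg_cst|exact: cvg_bumps].
  - exact: (integrable_abse (cut_integrable (sheared_integrable (LG t p)))).
  - move=> n z; rewrite normrM; apply: ler_piMr => //.
    have b0 := bumps_ge0 n p z.2; have b1 := bumps_le1 n p z.2.
    rewrite indicE; case: (_ \in _); rewrite ?mul1r ?mul0r ?normr0 ?ler01//.
    by rewrite ger0_norm.
move: cL; under eq_fun do rewrite E.
by move=> cL; exact: (cvg_unique (@ereal_hausdorff R) cL cR).
Qed.

(** [G] is integrable over bounded boxes only, whence the localization to [q]. By [box_increment]
    and Fubini, the increment and the primitive have equal integrals over the intersection of
    [obox q] with any open box, which is again an open box; since open boxes are determining, their
    difference [V] vanishes almost everywhere. *)
Lemma box_mild q (t : R) : 0 < t ->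
  {ae leb4, forall z, obox q z ->
    leb1.-integrable `[0, t] (EFin \o (fun tau => Gs (tau, z))) /\
    Fs (t, z) = Fs (0, z) + primitive (fun tau => Gs (tau, z)) t}.
Proof.
move=> t0.
pose K (z : spacetime mR) := cut Gs t q z * (\1_(`]0%R, t[%classic) z.1 * \1_(obox q) z.2).
have iC := cut_integrable (sheared_integrable (LG t q)).
have mo (r : (plane R * plane R) * (plane R * plane R)) :
    measurable_fun setT (fun z : spacetime mR => \1_(obox r) z.2 : mR).
  apply: (measurableT_comp (f := \1_(obox r) : phase mR -> mR)); last exact: measurable_snd.
  by apply: measurable_indic; exact: measurable_obox.
have mi : measurable_fun setT (fun z : spacetime mR => \1_(`]0, t[%classic) z.1 : mR).
  apply: (measurableT_comp (f := \1_(`]0, t[%classic) : mR -> mR)); last exact: measurable_fst.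
  exact: measurable_indic.
have iprod (k : spacetime mR -> R) (k' : spacetime mR -> R) : measurable_fun setT k' ->
    (forall z, `|k' z| <= 1) ->
    leb5.-integrable setT (EFin \o k) -> leb5.-integrable setT (EFin \o (fun z => k z * k' z)).
  move=> mk' b1 ik.
  have bk' : [bounded k' z | z in [set: spacetime R]].
    exists 1; split; first exact: num_real.
    by move=> M hM z _ /=; exact: le_trans (b1 z) (ltW hM).
  have := @integrableMl _ _ _ leb5 setT measurableT _ _ ik mk' bk'.
  by apply: eq_integrable => // z _ /=; rewrite EFinM.
have ind1 (T : Type) (A : set T) (x : T) : `|\1_A x : R| <= 1.
  by rewrite indicE; case: (_ \in _); rewrite ?normr1 ?normr0.
have iK : leb5.-integrable setT (EFin \o K).
  apply: iprod iC; first exact: (measurable_funM mi (mo q)).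
  by move=> z; rewrite normrM; apply: mulr_ile1.
pose g := fubini_G leb1 (EFin \o K).
have mg : measurable_fun setT g by exact: measurable_fubini_G iK.
have ig : leb4.-integrable setT g.
  apply/integrableP; split => //.
  have := (integrable21ltyP leb1 leb4 (measurable_int _ iK)).1 iK.
  apply: le_lt_trans; apply: ge0_le_integral => //.
  - exact: measurableT_comp.
  - apply: (measurable_fun_fubini_tonelli_G (m1 := leb1) (abse \o (EFin \o K)) _ (fun z => abse_ge0 _)).
    by apply: measurableT_comp => //; exact: measurable_int iK.
  - move=> z _; apply: le_abse_integral => //.
    by apply: measurable_fun_pair1; exact: measurable_int iK.
have iI := increment_integrable (ltW t0).
pose J (z : phase mR) := (Fs (t, z) - Fs (0, z)) * \1_(obox q) z.
have iJ : leb4.-integrable setT (EFin \o J).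
  have mq : measurable_fun setT (\1_(obox q) : phase mR -> mR).
    by apply: measurable_indic; exact: measurable_obox.
  have bq : [bounded (\1_(obox q) z : R) | z in [set: phase R]].
    exists 1; split; first exact: num_real.
    by move=> M hM z _ /=; exact: le_trans (ind1 _ _ z) (ltW hM).
  have := @integrableMl _ _ _ leb4 setT measurableT _ _ iI mq bq.
  by apply: eq_integrable => // z _ /=; rewrite EFinM.
pose V (z : phase mR) : \bar R := ((J z)%:E - g z)%E.
have iV : leb4.-integrable setT V by exact: integrableB.
have V0 : {ae leb4, forall z, V z = 0%E}.
  apply: (determining_ae0 (determining_obox R) iV) => _ [p _ <-].
  have mp := measurable_obox p.
  have iJp := integrableS measurableT mp (@subsetT _ _) iJ.
  have igp := integrableS measurableT mp (@subsetT _ _) ig.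
  rewrite (integralB mp iJp igp).
  have [r hr] := obox_setI p q.
  have oneI (z : phase R) : \1_(obox r) z = \1_(obox q) z * \1_(obox p) z :> R.
    by rewrite -hr setIC indicI.
  have -> : (\int[leb4]_(z in obox p) (EFin \o J) z =
      \int[leb4]_z ((Fs (t, z) - Fs (0, z)) * \1_(obox r) z)%:E)%E.
    rewrite integral_mkcond; apply: eq_integral => z _; rewrite /patch /J oneI mulrA.
    by rewrite [\1_(obox p) z]indicE; case: ifPn => hz; rewrite ?mulr1 ?mulr0.
  rewrite box_increment//.
  have -> : (\int[leb4]_(z in obox p) g z =
      \int[leb5]_z (cut Gs t r z * (\1_(`]0%R, t[%classic) z.1 * \1_(obox r) z.2))%:E)%E.
    have iKp : leb5.-integrable setT (EFin \o (fun z => K z * \1_(obox p) z.2)).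
      by apply: iprod iK; [exact: mo|move=> z; exact: ind1].
    transitivity (\int[leb5]_z (K z * \1_(obox p) z.2)%:E)%E.
      rewrite -[RHS](integral21_prod_meas1 (m1 := leb1) (m2 := leb4) iKp).
      rewrite integral_mkcond; apply: eq_integral => z _; rewrite /fubini_G /patch /=.
      rewrite [\1_(obox p) z]indicE; case: ifPn => hz.
        by apply: eq_integral => tau _; rewrite mulr1.
      by rewrite integral0_eq// => tau _; rewrite mulr0.
    apply: eq_integral => z _; congr EFin; rewrite oneI /K.
    have [hz|hz] := pselect (obox r z.2); last first.
      have : \1_(obox q) z.2 * \1_(obox p) z.2 = 0 :> R by rewrite -oneI indicE memNset.
      move=> h; rewrite h !mulr0 -!mulrA h !mulr0//.
    have hq : obox q z.2 by move: hz; rewrite -hr => -[].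
    have -> : cut Gs t r z = cut Gs t q z.
      rewrite /cut; congr (_ * _); rewrite !indicE; congr (nat_of_bool _)%:R.
      apply/idP/idP => /set_mem[h1 h2]; apply/mem_set; split => //; exact: obox_cbox.
    by rewrite !mulrA.
  rewrite subee//.
  have iKr : leb5.-integrable setT (EFin \o
      (fun z => cut Gs t r z * (\1_(`]0, t[%classic) z.1 * \1_(obox r) z.2))).
    apply: iprod (cut_integrable (sheared_integrable (LG t r))).
      exact: (measurable_funM mi (mo r)).
    by move=> z; rewrite normrM; apply: mulr_ile1.
  exact: integrable_fin_num iKr.
have aeC := ae_integrable2 (m1 := leb1) (m2 := leb4) iC.
apply: (ae_imp (ae_and V0 aeC)) => z [Vz iz] hq.
have mD : measurable (`[0, t]%classic : set mR) by exact: measurable_itv.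
have iz' : leb1.-integrable `[0, t] (EFin \o (fun tau => Gs (tau, z))).
  apply/(integrable_mkcond _ mD); apply: eq_integrable iz => // tau _ /=.
  rewrite /patch /cut indicE.
  have hc := obox_cbox hq.
  case: ifPn => [/set_mem h|h]; first by rewrite mem_set ?mulr1.
  by rewrite memNset ?mulr0// => -[/= h' _]; move/negP: h; apply; exact/mem_set.
split => //.
move: Vz; rewrite /V /J indicE mem_set// mulr1 /g /fubini_G.
have iz'' : leb1.-integrable `]0, t[ (EFin \o (fun tau => Gs (tau, z))).
  by apply: integrableS iz' => //; exact: subset_itv_oo_cc.
have -> : (\int[leb1]_tau (EFin \o K) (tau, z) = (primitive (fun tau => Gs (tau, z)) t)%:E)%E.
  have -> : (\int[leb1]_tau (EFin \o K) (tau, z) = \int[leb1]_(tau in `]0%R, t[) (Gs (tau, z))%:E)%E.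
    rewrite [RHS]integral_mkcond; apply: eq_integral => tau _ /=.
    rewrite /K /patch /cut !indicE [z \in _]mem_set// mulr1.
    have [h|h] := pselect (`]0, t[%classic tau); last first.
      by rewrite [tau \in _]memNset//= mulr0.
    rewrite [tau \in _]mem_set//= mulr1 mem_set ?mulr1//; split; last exact: obox_cbox.
    exact: subset_itv_oo_cc h.
  have iz3 : leb1.-integrable `]0, t] (EFin \o (fun tau => Gs (tau, z))).
    by apply: integrableS iz' => //; exact: subset_itv_oc_cc.
  rewrite /primitive -(Rintegral_itv_obnd_cbnd iz3) -(Rintegral_itv_bndo_bndc iz'').
  rewrite /Rintegral fineK//; apply: integrable_fin_num => //.
rewrite -EFinB => -[] /eqP; rewrite subr_eq0 subr_eq addrC => /eqP ->.
by [].
Qed.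

(* As d -> 0, cutoff' d t tends to delta_0 - delta_t, while the bumps increase to indicators of
   boxes, which determine a function almost everywhere. *)
Theorem mild (t : R) : 0 < t ->
  {ae leb4, forall z,
    leb1.-integrable `[0, t] (EFin \o (fun tau => G (tau, transl tau z))) /\
    F (t, transl t z) = F (0, z) + primitive (fun tau => G (tau, transl tau z)) t}.
Proof.
move=> t0.
have := ae_foralln (fun n => box_mild (cube R n) t0).
move=> h; apply: (ae_imp h) => z hz.
have [n hn] := obox_cube z.
have [h1 h2] := hz n (hn n (leqnn n)); split => //.
by move: h2; rewrite /Fs /= /shear /= scale0r addr0 -surjective_pairing.
Qed.

End Mild.

(** * Null sets in products *)

Section AeProduct.
Context d1 d2 (T1 : measurableType d1) (T2 : measurableType d2) (R : realType).
Variables (m1 : {sigma_finite_measure set T1 -> \bar R}).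
Variables (m2 : {sigma_finite_measure set T2 -> \bar R}).

Lemma ae_prod1 (P : T1 * T2 -> Prop) : {ae (m1 \x m2)%E, forall z, P z} ->
  {ae m1, forall x, {ae m2, forall y, P (x, y)}}.
Proof.
move=> [N [mN N0 PN]].
have mx := measurable_fun_xsection m2 mN.
have h : {ae m1, forall x, setT x -> (m2 \o xsection N) x = 0%E}.
  apply/ae_eq_integral_abs => //.
  by under eq_integral do rewrite gee0_abs//; exact: N0.
apply: (ae_imp h) => x /(_ I) h0; exists (xsection N x); split => //.
  exact: measurable_xsection.
by move=> y nP; rewrite /xsection /= inE; exact: PN.
Qed.

Lemma ae_prod2 (P : T1 * T2 -> Prop) : {ae (m1 \x m2)%E, forall z, P z} ->
  {ae m2, forall y, {ae m1, forall x, P (x, y)}}.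
Proof.
move=> [N [mN N0 PN]].
have my := measurable_fun_ysection m1 mN.
have h : {ae m2, forall y, setT y -> (m1 \o ysection N) y = 0%E}.
  apply/ae_eq_integral_abs => //.
  under eq_integral do rewrite gee0_abs//.
  by rewrite -[LHS]/((m1 \x^ m2)%E N) -product_measure12.
apply: (ae_imp h) => y /(_ I) h0; exists (ysection N y); split => //.
  exact: measurable_ysection.
by move=> x nP; rewrite /ysection /= inE; exact: PN.
Qed.

(** The measurability of [P], established at each use by exhibiting [P] as a set where measurable
    functions agree, allows the measure of its complement to be computed from the sections. *)
Lemma ae_prod_intro (P : set (T1 * T2)) : measurable P ->
  {ae m1, forall x, {ae m2, forall y, P (x, y)}} -> {ae (m1 \x m2)%E, forall z, P z}.
Proof.
move=> mP h; have mN : measurable (~` P) by exact: measurableC.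
exists (~` P); split => //.
rewrite /product_measure1.
have mx := measurable_fun_xsection m2 mN.
transitivity (\int[m1]_x (cst 0%E) x)%E; last exact: integral0.
apply: ge0_ae_eq_integral => //.
apply: (ae_imp h) => x [N [mNx N0 PN]] _ /=.
apply: subset_measure0 N0 => //; first exact: measurable_xsection.
by move=> y; rewrite /xsection /= inE => nP; exact: PN.
Qed.

End AeProduct.

Section LowerIntegral.
Context d (T : measurableType d) (R : realType) (m : {measure set T -> \bar R}).
Local Open Scope ereal_scope.

(* No measurability: both sides are suprema over simple functions. *)
Lemma le_lower_integral (f g : T -> \bar R) : (forall x, 0 <= f x) ->
  (forall x, f x <= g x) -> \int[m]_x f x <= \int[m]_x g x.
Proof.
move=> f0 fg; have g0 x : 0 <= g x by exact: le_trans (fg x).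
rewrite !ge0_integralTE//; apply: le_ereal_sup => _ [h hf <-].
by exists h => // x; exact: le_trans (hf x) (fg x).
Qed.

End LowerIntegral.

(** * The collision operators *)

Section QplusLemmas.
Variable R : realType.
Local Notation mR := (measurableTypeR R).
Local Open Scope ereal_scope.
Implicit Types g h : phase mR -> mR.

Lemma Qplus_ge0 g h z : (forall z, 0 <= g z)%R -> (forall z, 0 <= h z)%R -> 0 <= Qplus g h z.
Proof.
move=> g0 h0; rewrite /Qplus mule_ge0//.
  by rewrite lee_fin invr_ge0 mulr_ge0// pi_ge0.
by apply: integral_ge0 => wt _; rewrite lee_fin mulr_ge0.
Qed.

Lemma density_ge0 h x : (forall z, 0 <= h z)%R -> 0 <= density h x.
Proof. by move=> h0; apply: integral_ge0 => v _; rewrite lee_fin. Qed.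

Lemma measurable_density_param d (T : measurableType d) (h : T * phase mR -> R) :
  measurable_fun setT h -> (forall z, 0 <= h z)%R ->
  measurable_fun setT (fun z : T * plane mR => density (fun y => h (z.1, y)) z.2).
Proof.
move=> mh h0.
apply: (@measurable_integral_param _ _ _ _ _ leb2 setT
  (fun u : (T * plane mR) * plane mR => (h (u.1.1, (u.1.2, u.2)))%:E)) => //; last first.
  by move=> u; rewrite lee_fin.
apply/measurable_EFinP.
have mu : measurable_fun setT (fun u : (T * plane mR) * plane mR => (u.1.1, (u.1.2, u.2))) by mf.
exact: (measurableT_comp mh mu).
Qed.

Lemma measurable_density h : measurable_fun setT h -> (forall z, 0 <= h z)%R ->
  measurable_fun setT (density h : plane mR -> \bar R).
Proof.
move=> mh h0.
apply: (@measurable_integral_param _ _ _ _ _ leb2 setT (fun u : plane mR * plane mR => (h u)%:E) measurableT).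
  exact/measurable_EFinP.
by move=> u; rewrite lee_fin; exact: h0.
Qed.

Lemma integral_density h : measurable_fun setT h -> (forall z, 0 <= h z)%R ->
  \int[leb2]_x density h x = \int[leb4]_z (h z)%:E.
Proof.
move=> mh h0.
by rewrite [RHS](fubini_tonelli1 (m1 := leb2) (m2 := leb2) (fun z => (h z)%:E))//; exact/measurable_EFinP.
Qed.

Lemma post_measurable (v : plane mR) : measurable_fun setT (fun wt : plane mR * mR =>
  (vpost v wt.1 wt.2, vpost_star v wt.1 wt.2) : phase mR).
Proof.
have mg : measurable_fun setT (fun wt : plane mR * mR => ((v, wt.1), wt.2)) by mf.
exact: (measurableT_comp (@measurable_post R) mg).
Qed.

Lemma pair_measurable g h (x : plane mR) : measurable_fun setT g -> measurable_fun setT h ->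
  measurable_fun setT (fun w : phase mR => (g (x, w.1) * h (x, w.2))%R).
Proof.
move=> mg mh; apply: measurable_funM.
  by apply: (measurableT_comp mg); mf.
by apply: (measurableT_comp mh); mf.
Qed.

Lemma Qplus_iterated g h z : measurable_fun setT g -> measurable_fun setT h ->
  (forall z, 0 <= g z)%R -> (forall z, 0 <= h z)%R ->
  Qplus g h z = ((2 * pi)^-1)%:E * \int[leb2]_w \int[leb1]_(t in angles)
    (g (z.1, vpost z.2 w t) * h (z.1, vpost_star z.2 w t))%:E.
Proof.
move=> mg mh g0 h0; rewrite /Qplus; congr (_ * _).
rewrite (@tonelli_setX _ _ _ _ _ leb2 leb1 setT angles (fun wt : plane mR * mR =>
  (g (z.1, vpost z.2 wt.1 wt.2) * h (z.1, vpost_star z.2 wt.1 wt.2))%:E))//.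
- exact: measurable_angles.
- apply: measurable_funTS; apply/measurable_EFinP.
  exact: (measurableT_comp (pair_measurable z.1 mg mh) (post_measurable z.2)).
- by move=> wt _; rewrite lee_fin mulr_ge0.
Qed.

(** At fixed x the integral over v is [collision_integral] for the product of g(x, v) and h(x, w);
    its factor 2 pi cancels the normalization of [Qplus]. *)
Lemma integral_Qplus g h : measurable_fun setT g -> measurable_fun setT h ->
  (forall z, 0 <= g z)%R -> (forall z, 0 <= h z)%R ->
  measurable_fun setT (Qplus g h : phase mR -> \bar R) ->
  \int[leb4]_z Qplus g h z = \int[leb2]_x (density g x * density h x).
Proof.
move=> mg mh g0 h0 mQ.
rewrite [LHS](fubini_tonelli1 (m1 := leb2) (m2 := leb2) _ mQ (fun z => Qplus_ge0 z g0 h0)).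
apply: eq_integral => x _; rewrite /fubini_F /Qplus /=.
pose Phi (w : phase mR) := (g (x, w.1) * h (x, w.2))%:E.
have mP : measurable_fun setT Phi by apply/measurable_EFinP; exact: pair_measurable.
have P0 w : 0 <= Phi w by rewrite lee_fin mulr_ge0.
have c0 : (0 < 2 * pi :> R)%R by rewrite mulr_gt0// pi_gt0.
have cinv : 0 <= ((2 * pi)^-1 : R)%:E by rewrite lee_fin invr_ge0 ltW.
have mpost : measurable_fun setT (fun v : plane mR => \int[leb2 \x leb1]_(wt in setT `*` angles)
    Phi (vpost v wt.1 wt.2, vpost_star v wt.1 wt.2)).
  have := measurable_fun_pair2 x mQ; rewrite /Qplus /= => mQx.
  have e : (fun v : plane mR => \int[leb2 \x leb1]_(wt in setT `*` angles)
    Phi (vpost v wt.1 wt.2, vpost_star v wt.1 wt.2)) = (fun v => (2 * pi)%:E * Qplus g h (x, v)).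
    by apply/funext => v; rewrite /Qplus muleA -EFinM divff ?gt_eqF// mul1e.
  by rewrite e; exact: measurable_funeM mQx.
have Q0 v : 0 <= \int[leb2 \x leb1]_(wt in setT `*` angles) Phi (vpost v wt.1 wt.2, vpost_star v wt.1 wt.2).
  by apply: integral_ge0 => *; exact: P0.
rewrite ge0_integralZl//; last by move=> v _; exact: Q0.
rewrite (collision_integral mP P0) muleA -EFinM mulVf; last by rewrite gt_eqF.
rewrite mul1e.
rewrite [LHS](fubini_tonelli1 (m1 := leb2) (m2 := leb2) Phi mP P0).
have mgx : measurable_fun setT (fun v : plane mR => g (x, v)) by exact: measurable_fun_pair2.
have mhx : measurable_fun setT (fun v : plane mR => h (x, v)) by exact: measurable_fun_pair2.
transitivity (\int[leb2]_v ((g (x, v))%:E * density h x)).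
  apply: eq_integral => v _; rewrite /fubini_F /Phi /=.
  under eq_integral do rewrite EFinM.
  rewrite ge0_integralZl//.
  - by apply/measurable_EFinP; exact: mhx.
  - by move=> w _; rewrite lee_fin.
  - by rewrite lee_fin.
rewrite ge0_integralZr//.
- by apply/measurable_EFinP; exact: mgx.
- by move=> v _; rewrite lee_fin.
- exact: density_ge0.
Qed.

Lemma measurable_Qplus_param d (T : measurableType d) (g h : T * phase mR -> R) :
  measurable_fun setT g -> measurable_fun setT h ->
  (forall z, 0 <= g z)%R -> (forall z, 0 <= h z)%R ->
  measurable_fun setT (fun z : T * phase mR =>
    Qplus (fun y => g (z.1, y)) (fun y => h (z.1, y)) z.2).
Proof.
move=> mg mh g0 h0.
have ms (k : T * phase mR -> R) t : measurable_fun setT k -> measurable_fun setT (fun y => k (t, y)).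
  by move=> mk; exact: measurable_fun_pair2.
have -> : (fun z : T * phase mR => Qplus (fun y => g (z.1, y)) (fun y => h (z.1, y)) z.2) =
  (fun z => ((2 * pi)^-1)%:E * \int[leb2]_w \int[leb1]_(t in angles)
    (g (z.1, (z.2.1, vpost z.2.2 w t)) * h (z.1, (z.2.1, vpost_star z.2.2 w t)))%:E).
  by apply/funext => z; rewrite Qplus_iterated//; exact: ms.
apply: measurable_funeM.
pose k (u : ((T * phase mR) * plane mR) * mR) : \bar R :=
  (g (u.1.1.1, (u.1.1.2.1, vpost u.1.1.2.2 u.1.2 u.2)) *
   h (u.1.1.1, (u.1.1.2.1, vpost_star u.1.1.2.2 u.1.2 u.2)))%:E.
have mk : measurable_fun setT k.
  have mp : measurable_fun setT (fun u : ((T * phase mR) * plane mR) * mR => ((u.1.1.2.2, u.1.2), u.2)) by mf.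
  have mpost := measurableT_comp (@measurable_post R) mp.
  apply/measurable_EFinP; apply: measurable_funM.
    apply: (measurableT_comp mg); apply: measurable_fun_pair; first by mf.
    apply: measurable_fun_pair; first by mf.
    exact: (measurableT_comp measurable_fst mpost).
  apply: (measurableT_comp mh); apply: measurable_fun_pair; first by mf.
  apply: measurable_fun_pair; first by mf.
  exact: (measurableT_comp measurable_snd mpost).
have k0 u : 0 <= k u by rewrite lee_fin mulr_ge0.
have mk1 := @measurable_integral_param _ _ _ _ _ leb1 angles k (@measurable_angles R) mk k0.
have := @measurable_integral_param _ _ _ _ _ leb2 setT _ measurableT mk1
  (fun z => integral_ge0 _ (fun y _ => k0 (z, y))).
by [].
Qed.

Lemma measurable_Qplus g h : measurable_fun setT g -> measurable_fun setT h ->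
  (forall z, 0 <= g z)%R -> (forall z, 0 <= h z)%R ->
  measurable_fun setT (Qplus g h : phase mR -> \bar R).
Proof.
move=> mg mh g0 h0.
have mz (k : phase mR -> mR) : measurable_fun setT k -> measurable_fun setT (fun u : mR * phase mR => k u.2).
  by move=> mk; apply: (measurableT_comp mk); exact: measurable_snd.
have := @measurable_Qplus_param _ mR (fun u => g u.2) (fun u => h u.2) (mz _ mg) (mz _ mh)
  (fun u => g0 u.2) (fun u => h0 u.2).
move=> /(measurable_fun_pair2 (0%R : mR)); exact.
Qed.

End QplusLemmas.

Lemma integral_indic_null d (T : measurableType d) (R : realType)
    (m : {measure set T -> \bar R}) (N : set T) :
  measurable N -> m N = 0%E -> (\int[m]_z (\1_N z : R)%:E = 0)%E.
Proof. by move=> mN N0; rewrite integral_indic// setIT. Qed.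

Section QplusCongruence.
Variable R : realType.
Local Notation mR := (measurableTypeR R).
Local Open Scope ereal_scope.
Implicit Types g h : phase mR -> mR.

(** The integral of this nonnegative function is that of rho_g rho_h, and one of the two densities
    vanishes almost everywhere. *)
Lemma Qplus_null g h : measurable_fun setT g -> measurable_fun setT h ->
  (forall z, 0 <= g z)%R -> (forall z, 0 <= h z)%R ->
  \int[leb4]_z (g z)%:E = 0 \/ \int[leb4]_z (h z)%:E = 0 ->
  {ae leb4, forall z, Qplus g h z = 0}.
Proof.
move=> mg mh g0 h0 z0.
have mQ := measurable_Qplus mg mh g0 h0.
have d0 (k : phase mR -> mR) : measurable_fun setT k -> (forall z, 0 <= k z)%R -> \int[leb4]_z (k z)%:E = 0 ->
    {ae leb2, forall x, density k x = 0}.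
  move=> mk k0; rewrite -integral_density// => e.
  have : ae_eq leb2 setT (density k) (cst 0).
    apply/(ae_eq_integral_abs _ measurableT (measurable_density mk k0)).
    by under eq_integral do rewrite gee0_abs ?density_ge0//.
  by move=> H; apply: (ae_imp H) => x; exact.
have : ae_eq leb4 setT (Qplus g h) (cst 0).
  apply/(ae_eq_integral_abs _ measurableT mQ).
  under eq_integral do rewrite gee0_abs ?Qplus_ge0//.
  rewrite integral_Qplus// (_ : 0 = \int[leb2]_x (cst 0 x)); last by rewrite integral0.
  apply: ge0_ae_eq_integral => //.
  - by apply: emeasurable_funM; exact: measurable_density.
  - by move=> x _; rewrite mule_ge0// density_ge0.
  case: z0 => z0; first by apply: (ae_imp (d0 g mg g0 z0)) => x -> _ /=; rewrite mul0e.
  by apply: (ae_imp (d0 h mh h0 z0)) => x -> _ /=; rewrite mule0.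
by move=> H; apply: (ae_imp H) => x; exact.
Qed.

(** [Qplus] evaluates its arguments at the velocities after collision, so it is not obvious that
    null sets go unseen. [Qplus_null], applied to the indicator of an exceptional set paired with
    the constant 1, says that for almost every (x, v) almost no collision leads into that set. *)
Lemma Qplus_ae g g' h h' : measurable_fun setT g -> measurable_fun setT g' ->
  measurable_fun setT h -> measurable_fun setT h' ->
  {ae leb4, forall z, g z = g' z} -> {ae leb4, forall z, h z = h' z} ->
  {ae leb4, forall z, Qplus g h z = Qplus g' h' z}.
Proof.
move=> mg mg' mh mh' [N1 [mN1 N10 gN]] [N2 [mN2 N20 hN]].
have one_m : measurable_fun setT (cst 1%R : phase mR -> mR) by exact: measurable_cst.
have ind_m (N : set (phase mR)) : measurable N -> measurable_fun setT (\1_N : phase mR -> mR).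
  by move=> mN; exact: measurable_indic.
have ind0 (N : set (phase mR)) z : (0 <= \1_N z :> R)%R by rewrite indicE.
have i0 (N : set (phase mR)) : measurable N -> leb4 N = 0 -> \int[leb4]_z (\1_N z : R)%:E = 0.
  by move=> mN N0; exact: integral_indic_null.
have q1 := Qplus_null (ind_m _ mN1) one_m (ind0 N1) (fun=> ler01) (or_introl (i0 _ mN1 N10)).
have q2 := Qplus_null one_m (ind_m _ mN2) (fun=> ler01) (ind0 N2) (or_intror (i0 _ mN2 N20)).
apply: (ae_imp (ae_and q1 q2)) => -[x v] [Q1 Q2].
have mD : measurable (setT `*` angles : set (plane mR * mR)).
  by apply: measurableX => //; exact: measurable_angles.
have c0 : ((2 * pi)^-1 : R)%:E != 0.
  by rewrite eqe invr_eq0 mulf_neq0// gt_eqF// pi_gt0.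
have mk (k k' : phase mR -> mR) : measurable_fun setT k -> measurable_fun setT k' ->
   measurable_fun (setT `*` angles) (fun wt : plane mR * mR =>
     (k (x, vpost v wt.1 wt.2) * k' (x, vpost_star v wt.1 wt.2))%:E).
  move=> m1 m2; apply: measurable_funTS; apply/measurable_EFinP.
  exact: (measurableT_comp (pair_measurable x m1 m2) (post_measurable v)).
have zero (k k' : phase mR -> mR) : measurable_fun setT k -> measurable_fun setT k' ->
   (forall z, 0 <= k z)%R -> (forall z, 0 <= k' z)%R -> Qplus k k' (x, v) = 0 ->
   {ae leb2 \x leb1, forall wt : plane mR * mR, (setT `*` angles) wt ->
     (k (x, vpost v wt.1 wt.2) * k' (x, vpost_star v wt.1 wt.2))%:E = 0}.
  move=> m1 m2 k0 k0' /eqP; rewrite /Qplus /= mule_eq0 (negbTE c0)/= => /eqP e.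
  have : ae_eq (leb2 \x leb1) (setT `*` angles) (fun wt : plane mR * mR =>
     (k (x, vpost v wt.1 wt.2) * k' (x, vpost_star v wt.1 wt.2))%:E) (cst 0).
    apply/(ae_eq_integral_abs _ mD (mk _ _ m1 m2)).
    by under eq_integral do rewrite gee0_abs ?lee_fin ?mulr_ge0//.
  by move=> H; apply: (ae_imp H).
have z1 := zero _ _ (ind_m _ mN1) one_m (ind0 N1) (fun=> ler01) Q1.
have z2 := zero _ _ one_m (ind_m _ mN2) (fun=> ler01) (ind0 N2) Q2.
rewrite /Qplus /=; congr (_ * _).
apply: ae_eq_integral => //; [exact: mk|exact: mk|].
apply: (ae_imp (ae_and z1 z2)) => wt [e1 e2] hD.
have n1 : ~ N1 (x, vpost v wt.1 wt.2).
  move=> h1; have := e1 hD; rewrite indicE mem_set//= mulr1 => -[] /eqP.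
  by rewrite oner_eq0.
have n2 : ~ N2 (x, vpost_star v wt.1 wt.2).
  move=> h2; have := e2 hD; rewrite indicE mem_set//= mul1r => -[] /eqP.
  by rewrite oner_eq0.
have -> : g (x, vpost v wt.1 wt.2) = g' (x, vpost v wt.1 wt.2).
  by apply: contrapT => ne; apply: n1; apply: gN.
have -> : h (x, vpost_star v wt.1 wt.2) = h' (x, vpost_star v wt.1 wt.2).
  by apply: contrapT => ne; apply: n2; apply: hN.
by [].
Qed.

(* f f_* <= h h_* + u f_* + f u_* as soon as f <= h + u, u >= 0 *)
Lemma Qplus_le (f h u : phase mR -> mR) (z : phase mR) :
  measurable_fun setT f -> measurable_fun setT h -> measurable_fun setT u ->
  (forall z, 0 <= f z)%R -> (forall z, 0 <= h z)%R -> (forall z, 0 <= u z)%R ->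
  (forall z, f z <= h z + u z)%R ->
  Qplus f f z <= Qplus h h z + (Qplus u f z + Qplus f u z).
Proof.
move=> mf mh mu f0 h0 u0 fhu.
have mD : measurable (setT `*` angles : set (plane mR * mR)).
  by apply: measurableX => //; exact: measurable_angles.
have cinv : 0 <= ((2 * pi)^-1 : R)%:E by rewrite lee_fin invr_ge0 mulr_ge0// pi_ge0.
have mk (k k' : phase mR -> mR) : measurable_fun setT k -> measurable_fun setT k' ->
   measurable_fun (setT `*` angles) (fun wt : plane mR * mR =>
     (k (z.1, vpost z.2 wt.1 wt.2) * k' (z.1, vpost_star z.2 wt.1 wt.2))%:E).
  move=> m1 m2; apply: measurable_funTS; apply/measurable_EFinP.
  exact: (measurableT_comp (pair_measurable z.1 m1 m2) (post_measurable z.2)).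
have i0 (k k' : phase mR -> mR) : (forall z, 0 <= k z)%R -> (forall z, 0 <= k' z)%R ->
   0 <= \int[leb2 \x leb1]_(wt in setT `*` angles)
     (k (z.1, vpost z.2 wt.1 wt.2) * k' (z.1, vpost_star z.2 wt.1 wt.2))%:E.
  by move=> k0 k0'; apply: integral_ge0 => wt _; rewrite lee_fin mulr_ge0.
have n0 (k k' : phase mR -> mR) (k0 : (forall z, 0 <= k z)%R) (k0' : (forall z, 0 <= k' z)%R) :
   forall wt : plane mR * mR, (setT `*` angles) wt ->
     0 <= (k (z.1, vpost z.2 wt.1 wt.2) * k' (z.1, vpost_star z.2 wt.1 wt.2))%:E.
  by move=> wt _; rewrite lee_fin mulr_ge0.
rewrite /Qplus -(ge0_muleDr _ (i0 u f u0 f0) (i0 f u f0 u0)).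
rewrite -(ge0_muleDr _ (i0 h h h0 h0) (adde_ge0 (i0 u f u0 f0) (i0 f u f0 u0))).
apply: lee_wpmul2l; first exact: cinv.
rewrite -ge0_integralD//; [|exact: n0|exact: mk|exact: n0|exact: mk].
rewrite -ge0_integralD//.
- apply: ge0_le_integral => //.
  + exact: n0.
  + exact: mk.
  + by apply: emeasurable_funD; [exact: mk|apply: emeasurable_funD; exact: mk].
  move=> wt _; rewrite -!EFinD lee_fin.
  set a := (z.1, vpost _ _ _); set b := (z.1, vpost_star _ _ _).
  have := f0 a; have := f0 b; have := h0 a; have := h0 b; have := u0 a; have := u0 b.
  have := fhu a; have := fhu b.
  (* If f a <= h a, expand f b in f a * f b; otherwise expand f a first, and the remaining h a * u b
     is at most f a * u b. *)
  by case: (leP (f a) (h a)) => H; nra.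
- exact: n0.
- exact: mk.
- by move=> wt D; apply: adde_ge0; exact: n0.
- by apply: emeasurable_funD; exact: mk.
Qed.

End QplusCongruence.

Lemma ae_fst d1 d2 (T1 : measurableType d1) (T2 : measurableType d2) (R : realType)
    (m1 : {sigma_finite_measure set T1 -> \bar R})
    (m2 : {sigma_finite_measure set T2 -> \bar R}) (P : T1 -> Prop) :
  {ae m1, forall x, P x} -> {ae (m1 \x m2)%E, forall z, P z.1}.
Proof.
move=> [N [mN N0 PN]]; exists (N `*` setT); split.
- exact: measurableX.
- by rewrite product_measure1E// (_ : _ N = 0%E) ?mul0e.
- by move=> z nP; split => //; exact: PN.
Qed.

Lemma ae_eq_integrable d (T : measurableType d) (R : realType) (m : {measure set T -> \bar R})
    (D : set T) (f g : T -> \bar R) : measurable D -> measurable_fun D f ->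
  {ae m, forall x, D x -> f x = g x} -> m.-integrable D g -> m.-integrable D f.
Proof.
move=> mD mf fg /integrableP[mg ig]; apply/integrableP; split => //.
rewrite (ae_eq_integral (fun x => `|g x|)%E)//.
- exact: measurableT_comp.
- exact: measurableT_comp.
- by apply: (ae_imp fg) => x h Dx; rewrite h.
Qed.

(** * Renormalized solutions are mild solutions *)

Section LogLipschitz.
Variable R : realType.

(** Transfers integrability and continuity in L^1 from f to log (1 + f). *)
Lemma ln1D_lipschitz (a b : R) : 0 <= a -> 0 <= b -> `|ln (1 + a) - ln (1 + b)| <= `|a - b|.
Proof.
wlog ab : a b / b <= a => [th a0 b0|a0 b0].
  have [h|/ltW h] := leP b a; first exact: th.
  by rewrite distrC [leRHS]distrC; exact: th.
have p (x : R) : 0 <= x -> 1 + x \is Num.pos by move=> x0; rewrite posrE; lra.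
have b1 : 0 < 1 + b by lra.
rewrite !ger0_norm ?subr_ge0 ?ler_ln ?p ?lerD2l//.
rewrite -ln_div ?p//.
have -> : (1 + a) / (1 + b) = 1 + (a - b) / (1 + b) by field; rewrite gt_eqF.
have q0 : 0 <= (a - b) / (1 + b) by rewrite divr_ge0 ?subr_ge0// ltW.
apply: le_trans (le_ln1Dx _) _; first by apply: lt_le_trans q0; rewrite ltrN10.
by rewrite ler_pdivrMr// ler_peMr ?subr_ge0//; lra.
Qed.

Lemma max0_lipschitz (a b : R) : `|Num.max a 0 - Num.max b 0| <= `|a - b|.
Proof.
have [a0|a0] := leP a 0; have [b0|b0] := leP b 0.
- by rewrite subrr normr0.
- rewrite sub0r normrN gtr0_norm// distrC ger0_norm; lra.
- rewrite subr0 gtr0_norm// ger0_norm; lra.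
- by [].
Qed.

End LogLipschitz.

Section PositivePart.
Variable R : realType.
Local Notation mR := (measurableTypeR R).
Implicit Type g : spacetime mR -> mR.

(* The modification of f that is nonnegative everywhere and vanishes for t < 0. *)
Definition positive_part (f : R -> phase R -> R) (z : spacetime mR) : mR :=
  if 0 <= z.1 then Num.max (f z.1 z.2) 0 else 0.

Definition gain g (z : spacetime mR) : \bar R :=
  Qplus (fun y => g (z.1, y)) (fun y => g (z.1, y)) z.2.

Definition loss g (z : spacetime mR) : \bar R :=
  Qminus (fun y => g (z.1, y)) (fun y => g (z.1, y)) z.2.

(** [fine] sends infinite values to 0; for the modification of a renormalized solution these occur,
    at nonnegative times, only on a null set, by [gain_loss_fin]. *)
Definition renorm_rhs g (z : spacetime mR) : mR :=
  (1 + g z)^-1 * fine (gain g z) - (1 + g z)^-1 * fine (loss g z).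

Lemma positive_part_ge0 f z : 0 <= positive_part f z.
Proof. by rewrite /positive_part; case: ifP => // _; rewrite le_max lexx orbT. Qed.

Lemma measurable_positive_part f : L1loc (fun z => (f z.1 z.2)%:E) ->
  measurable_fun setT (positive_part f).
Proof.
move=> [/measurable_EFinP mf _].
have /(measurable_restrictT _ (measurable_future R)) mr :
  measurable_fun (future R) (fun z : spacetime mR => f z.1 z.2 : mR) := mf.
rewrite (_ : positive_part f = (fun z => Num.max (((fun z : spacetime mR => f z.1 z.2 : mR) \_ (future R)) z) 0)).
  by apply: measurable_maxr => //; exact: measurable_cst.
apply/funext => z; rewrite /positive_part /patch.
case: ifPn => z0; first by rewrite mem_set.
by rewrite memNset ?maxxx//; exact/negP.
Qed.

Lemma gain_ge0 g z : (forall z, 0 <= g z) -> (0 <= gain g z)%E.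
Proof. by move=> g0; apply: Qplus_ge0. Qed.

Lemma loss_ge0 g z : (forall z, 0 <= g z) -> (0 <= loss g z)%E.
Proof. by move=> g0; rewrite /loss /Qminus mule_ge0 ?lee_fin// density_ge0. Qed.

Lemma measurable_gain g : measurable_fun setT g -> (forall z, 0 <= g z) ->
  measurable_fun setT (gain g).
Proof. by move=> mg g0; exact: measurable_Qplus_param. Qed.

Lemma measurable_loss g : measurable_fun setT g -> (forall z, 0 <= g z) ->
  measurable_fun setT (loss g).
Proof.
move=> mg g0; apply: emeasurable_funM.
  rewrite (_ : (fun z => _) = (fun z : spacetime mR => (g z)%:E)); last first.
    by apply/funext => -[].
  exact/measurable_EFinP.
have mp : measurable_fun setT (fun z : spacetime mR => (z.1, z.2.1)) by mf.
exact: (measurableT_comp (measurable_density_param mg g0) mp).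
Qed.

Lemma measurable_inv1D g : measurable_fun setT g -> (forall z, 0 <= g z) ->
  measurable_fun setT (fun z => (1 + g z)^-1 : mR).
Proof.
move=> mg g0.
rewrite (_ : (fun z => _) = (fun z => expR (- ln (1 + g z)) : mR)); last first.
  by apply/funext => z; rewrite expRN lnK// posrE; have := g0 z; lra.
apply: (measurableT_comp (@measurable_expR R)); apply: measurable_funN.
apply: (measurableT_comp (@measurable_ln R)); apply: measurable_funD => //.
Qed.

Lemma measurable_renorm_rhs g : measurable_fun setT g -> (forall z, 0 <= g z) ->
  measurable_fun setT (renorm_rhs g).
Proof.
move=> mg g0; have mi := measurable_inv1D mg g0.
apply: measurable_funB; apply: measurable_funM => //.
  by apply: (measurableT_comp (fine_measurable measurableT)); exact: measurable_gain.
by apply: (measurableT_comp (fine_measurable measurableT)); exact: measurable_loss.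
Qed.

End PositivePart.

Section RenormalizedSections.
Variable R : realType.
Local Notation mR := (measurableTypeR R).
Variable f : R -> phase R -> R.
Hypotheses (rf : renormalized_solution f) (cf : C_Lp `[0, +oo[ 1 f).

Local Notation g := (positive_part f).

Lemma C_L1_measurable t : 0 <= t -> measurable_fun setT (f t : phase mR -> mR).
Proof.
move=> t0; have /cf.1 : `[0, +oo[%classic t by rewrite /= in_itv/= t0.
by rewrite inE => /andP[/[!inE]].
Qed.

Lemma C_L1_integrable t : 0 <= t -> leb4.-integrable setT (EFin \o (f t : phase mR -> mR)).
Proof.
move=> t0; have /cf.1 : `[0, +oo[%classic t by rewrite /= in_itv/= t0.
by move=> /Lfun1_integrable.
Qed.

Lemma measurable_g : measurable_fun setT g.
Proof. exact: measurable_positive_part (renorm_L1loc rf). Qed.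

Lemma ae_positive_part : {ae leb5, forall z : spacetime mR, 0 <= z.1 -> g z = f z.1 z.2}.
Proof.
by apply: (ae_imp (renorm_nonneg rf)) => z h z0; rewrite /positive_part z0 max_l// h.
Qed.

Lemma ae_section : {ae leb1, forall t : mR, 0 <= t ->
  {ae leb4, forall y : phase mR, g (t, y) = f t y}}.
Proof.
apply: (ae_imp (ae_prod1 ae_positive_part)) => t h t0.
by apply: (ae_imp h) => y; exact.
Qed.

Lemma g_integrable t : 0 <= t -> leb4.-integrable setT (fun z : phase mR => (g (t, z))%:E).
Proof.
move=> t0; apply: le_integrable (C_L1_integrable t0) => //.
  apply/measurable_EFinP; apply: measurable_fun_pair2; exact: measurable_g.
move=> z _ /=; rewrite lee_fin /positive_part /= t0.
by have := max0_lipschitz (f t z) 0; rewrite maxxx !subr0.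
Qed.

(** Replacing f by its modification is harmless inside the collision terms: at almost every time the
    two sections agree almost everywhere, which [Qplus_ae] and Fubini pass on to [Qplus] and to the
    density. The local integrability of the renormalized terms includes the measurability needed to
    reassemble the times. *)
Lemma section_gain_loss : {ae leb5, forall z : spacetime mR, (0 <= z.1)%R ->
  renorm_Qplus f z = ((1 + g z)^-1)%R%:E * gain g z /\
  renorm_Qminus f z = ((1 + g z)^-1)%R%:E * loss g z}%E.
Proof.
have g0 := positive_part_ge0 f.
have mi : measurable_fun setT (fun z => ((1 + g z)^-1)%:E).
  by apply/measurable_EFinP; exact: (measurable_inv1D measurable_g g0).
have mp := emeasurable_funM mi (measurable_gain measurable_g g0).
have mm := emeasurable_funM mi (measurable_loss measurable_g g0).
have mF := measurable_future R.
pose P := [set z : spacetime mR | (0 <= z.1)%R ->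
  renorm_Qplus f z = ((1 + g z)^-1)%R%:E * gain g z /\
  renorm_Qminus f z = ((1 + g z)^-1)%R%:E * loss g z]%E.
have mP : measurable P.
  have h1 := measurable_eqe mF (renorm_Qplus_L1loc rf).1 (measurable_funTS mp).
  have h2 := measurable_eqe mF (renorm_Qminus_L1loc rf).1 (measurable_funTS mm).
  have := measurableU _ _ (measurableC mF) (measurableI _ _ h1 h2).
  rewrite (_ : _ `|` _ = P)//; apply/seteqP; split => z.
    by move=> [h /h|[[_ a] [_ b]]].
  move=> h; have [z0|z0] := pselect (future R z); last by left.
  by have [a b] := h z0; right; split; split.
apply: (@ae_prod_intro _ _ _ _ _ leb1 leb4 P mP).
apply: (ae_imp ae_section) => t h.
have [t0|t0] := leP 0 t; last first.
  by apply: aeW => y /= /(lt_le_trans t0); rewrite ltxx.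
have {}h := h t0.
have mft := C_L1_measurable t0.
have mgt : measurable_fun setT (fun y => g (t, y)).
  by apply: measurable_fun_pair2; exact: measurable_g.
have hq := Qplus_ae mgt mft mgt mft h h.
have hd : {ae leb2, forall x, density (fun y => g (t, y)) x = density (f t) x}.
  apply: (ae_imp (ae_prod1 h)) => x hx; rewrite /density.
  apply: ae_eq_integral => //.
  - by apply/measurable_EFinP; exact: (measurable_fun_pair2 x mgt).
  - by apply/measurable_EFinP; exact: (measurable_fun_pair2 x mft).
  - by apply: (ae_imp hx) => v -> _.
have {}hd := @ae_fst _ _ _ _ _ leb2 leb2 _ hd.
apply: (ae_imp (ae_and h (ae_and hq hd))) => -[x v] [e1 [e2 e3]] _.
rewrite /renorm_Qplus /renorm_Qminus /gain /loss /Qminus /= e1 e2.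
by rewrite e3.
Qed.

End RenormalizedSections.

Section RenormalizedMild.
Variable R : realType.
Local Notation mR := (measurableTypeR R).

Lemma sheared_box_future (t : R) p : sheared_box 0 t p `<=` future R.
Proof. by move=> z [/= + _]; rewrite in_itv/= => /andP[]. Qed.

Lemma future_sheared_box (z : spacetime R) : future R z -> exists n : nat, sheared_box 0 n%:R (cube R n) z.
Proof.
move=> z0; have [n hn] := obox_cube (unshear z).2.
have hM := archi_boundP z0; exists (maxn n (Num.bound z.1)); split.
  rewrite /= in_itv/= z0/=; apply: ltW; apply: lt_le_trans hM _.
  by rewrite ler_nat leq_maxr.
by apply: obox_cbox; apply: hn; rewrite leq_maxl.
Qed.

Variable f : R -> phase R -> R.
Hypotheses (rf : renormalized_solution f) (cf : C_Lp `[0, +oo[ 1 f).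

Local Notation g := (positive_part f).
Let g0 := positive_part_ge0 f.
Let mg := measurable_g rf.

Let inv_pos z : 0 < (1 + g z)^-1.
Proof. by rewrite invr_gt0; have := g0 z; lra. Qed.

(** The future is covered by countably many compact moving boxes, and an integrable function is
    finite almost everywhere. *)
Lemma renorm_integrable_fin (H : spacetime mR -> \bar R) :
  (forall K, K `<=` future R -> compact K -> leb5.-integrable K H) ->
  {ae leb5, forall z, future R z -> H z \is a fin_num}.
Proof.
move=> LH.
have h n : {ae leb5, forall z, sheared_box 0 n%:R (cube R n) z -> H z \is a fin_num}.
  apply: (@integrable_ae _ _ _ leb5) (measurable_sheared_box _ _ _) _ _.
  by apply: LH; [exact: sheared_box_future|exact: compact_sheared_box].
apply: (ae_imp (ae_foralln h)) => z hz /future_sheared_box[n]; exact: hz.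
Qed.

(** The renormalized terms are finite almost everywhere, and the factor 1 / (1 + g) is finite and
    positive. *)
Lemma gain_loss_fin : {ae leb5, forall z : spacetime mR, 0 <= z.1 ->
  gain g z \is a fin_num /\ loss g z \is a fin_num}.
Proof.
have h1 := renorm_integrable_fin (renorm_Qplus_L1loc rf).2.
have h2 := renorm_integrable_fin (renorm_Qminus_L1loc rf).2.
apply: (ae_imp (ae_and h1 (ae_and h2 (section_gain_loss rf cf)))) => z [a1 [a2 a3]] z0.
have k (x : \bar R) : (0 <= x -> ((1 + g z)^-1)%R%:E * x \is a fin_num -> x \is a fin_num)%E.
  by case: x => [//||//] _; rewrite gt0_muley// lte_fin.
have [e1 e2] := a3 z0; move: (a1 z0) (a2 z0); rewrite e1 e2 => b1 b2.
by split; apply: k => //; [exact: gain_ge0|exact: loss_ge0].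
Qed.

Lemma renorm_fine : {ae leb5, forall z : spacetime mR, 0 <= z.1 ->
  renorm_Qplus f z = ((1 + g z)^-1 * fine (gain g z))%:E /\
  renorm_Qminus f z = ((1 + g z)^-1 * fine (loss g z))%:E}.
Proof.
apply: (ae_imp (ae_and gain_loss_fin (section_gain_loss rf cf))) => z [a1 a2] z0.
by have [b1 b2] := a1 z0; have [-> ->] := a2 z0; rewrite !EFinM !fineK.
Qed.

Lemma renorm_rhs_integrable t p : leb5.-integrable (sheared_box 0 t p) (EFin \o renorm_rhs g).
Proof.
have mB := measurable_sheared_box (R:=R) 0 t p.
have LK : sheared_box 0 t p `<=` future R := @sheared_box_future t p.
have i1 := (renorm_Qplus_L1loc rf).2 _ LK (@compact_sheared_box R 0 t p).
have i2 := (renorm_Qminus_L1loc rf).2 _ LK (@compact_sheared_box R 0 t p).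
apply: (@ae_eq_integrable _ _ _ leb5 _ _ (fun z => renorm_Qplus f z - renorm_Qminus f z)%E mB).
- by apply: measurable_funTS; apply/measurable_EFinP; exact: measurable_renorm_rhs.
- apply: (ae_imp renorm_fine) => z h /LK z0; have [-> ->] := h z0.
  by rewrite -EFinB.
- exact: integrableB.
Qed.

Let F (z : spacetime mR) : R := ln (1 + g z).

Let mF : measurable_fun setT F.
Proof.
by apply: (measurableT_comp (@measurable_ln R)); exact: measurable_funD.
Qed.

Let F_le z : `|F z| <= `|g z|.
Proof.
by have := ln1D_lipschitz (g0 z) (lexx 0); rewrite addr0 ln1 !subr0.
Qed.

Lemma log_integrable t : 0 <= t -> leb4.-integrable setT (fun z : phase mR => (F (t, z))%:E).
Proof.
move=> t0; apply: le_integrable (g_integrable rf cf t0) => //.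
  by apply/measurable_EFinP; apply: measurable_fun_pair2; exact: mF.
by move=> z _ /=; rewrite lee_fin.
Qed.

Lemma log_loc_integrable t p : leb5.-integrable (sheared_box 0 t p) (EFin \o F).
Proof.
have mB := measurable_sheared_box (R:=R) 0 t p.
have LK : sheared_box 0 t p `<=` future R := @sheared_box_future t p.
have i1 := (renorm_L1loc rf).2 _ LK (@compact_sheared_box R 0 t p).
apply: le_integrable i1 => //.
  by apply: measurable_funTS; apply/measurable_EFinP; exact: mF.
move=> z /LK z0 /=; rewrite lee_fin; apply: le_trans (F_le z) _.
rewrite /positive_part z0.
by have := max0_lipschitz (f z.1 z.2) 0; rewrite maxxx !subr0.
Qed.

Lemma log_continuous t0 : 0 <= t0 ->
  (\int[leb4]_z (`|F (t, z) - F (t0, z)|)%:E)%E @[t --> within `[0, +oo[ (nbhs t0)] --> 0%E.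
Proof.
move=> h0.
have m0 : `[0, +oo[%classic t0 by rewrite /= in_itv/= h0.
apply: (@squeeze_cvge _ _ _ R (fun=> 0%E) _ (fun t => 'N[leb4]_1[EFin \o (f t \- f t0)%R])%E).
- near=> t.
  have t_ge0 : 0 <= t.
    suff : `[0, +oo[%classic t by rewrite /= in_itv/= andbT.
    by near: t; exact: withinT.
  rewrite Lnorm1; apply/andP; split; first exact: integral_ge0.
  have mF' s : measurable_fun setT (fun z : phase mR => F (s, z) : mR).
    by apply: measurable_fun_pair2; exact: mF.
  apply: ge0_le_integral => //.
  + apply/measurable_EFinP; apply: measurableT_comp => //.
    exact: (measurable_funB (mF' t) (mF' t0)).
  + apply: measurableT_comp => //; apply/measurable_EFinP.
    exact: (measurable_funB (C_L1_measurable cf t_ge0) (C_L1_measurable cf h0)).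
  move=> z _ /=; rewrite lee_fin; apply: le_trans (ln1D_lipschitz (g0 _) (g0 _)) _.
  by rewrite /positive_part t_ge0 h0; exact: max0_lipschitz.
- exact: cvg_cst.
- exact: cf.2 m0.
Unshelve. all: by end_near. Qed.

Lemma renorm_weak (d t : R) n p : 0 < d -> 3 * d <= t ->
  (- (\int[leb5]_(z in future R) (F z * (cutoff' d t z.1 * bumps n p (unshear z).2))%:E) =
   \int[leb5]_(z in future R) (renorm_rhs g z * testfun d t n p z)%:E)%E.
Proof.
move=> d0 dt; have := renorm_eq rf (test_function_testfun n p d0 dt).
have mu : measurable_fun setT (fun z : spacetime mR => (unshear z).2).
  exact: (measurableT_comp measurable_snd (@measurable_unshear R)).
have mb : measurable_fun setT (fun z : spacetime mR => bumps n p (unshear z).2 : mR).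
  exact: (measurableT_comp (measurable_bumps n p) mu).
have mc : measurable_fun setT (fun z : spacetime mR => cutoff' d t z.1 * bumps n p (unshear z).2 : mR).
  apply: measurable_funM => //.
  exact: (measurableT_comp (@measurable_cutoff' R d t) measurable_fst).
have mFu := measurable_future R.
have -> : (\int[leb5]_(z in future R)
    (ln (1 + f z.1 z.2) * transport (testfun d t n p) z)%:E =
  \int[leb5]_(z in future R) (F z * (cutoff' d t z.1 * bumps n p (unshear z).2))%:E)%E.
  under eq_integral do rewrite transport_testfun//.
  apply: ae_eq_integral => //.
  - apply/measurable_EFinP; apply: measurable_funM; last exact: measurable_funTS.
    apply: (measurableT_comp (@measurable_ln R)).
    by apply: measurable_funD => //; apply/measurable_EFinP; exact: (renorm_L1loc rf).1.
  - by apply: measurable_funTS; apply/measurable_EFinP; exact: measurable_funM.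
  - by apply: (ae_imp (ae_positive_part rf)) => z h z0; rewrite /F h.
have mt : measurable_fun setT (testfun d t n p : spacetime mR -> mR).
  apply: measurable_funM => //.
  exact: (measurableT_comp (@measurable_cutoff R d t) measurable_fst).
move=> ->; apply: ae_eq_integral => //.
- apply: emeasurable_funM; last by apply: measurable_funTS; exact/measurable_EFinP.
  by apply: emeasurable_funB; [exact: (renorm_Qplus_L1loc rf).1|exact: (renorm_Qminus_L1loc rf).1].
- apply: measurable_funTS; apply/measurable_EFinP; apply: measurable_funM => //.
  exact: measurable_renorm_rhs.
- apply: (ae_imp renorm_fine) => z h z0; have [-> ->] := h z0.
  by rewrite -EFinB -EFinM.
Qed.

End RenormalizedMild.

(** * Mild solutions and the dependence of their null sets on time *)

Section MildSolutions.
Variable R : realType.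
Local Notation mR := (measurableTypeR R).

(** The variable end point is absorbed into a jointly measurable integrand on the whole line.
    Positive and negative parts are treated separately, since the integrand need not be integrable
    for every z. *)
Lemma measurable_primitive_transl (H : spacetime mR -> mR) : measurable_fun setT H ->
  measurable_fun setT (fun z : spacetime mR =>
    primitive (fun s : R => H (s, transl s z.2) : R) z.1 : mR).
Proof.
move=> mH.
pose k (u : spacetime mR * mR) : \bar R :=
  if (0 <= u.2) && (u.2 <= u.1.1) then (H (u.2, transl u.2 u.1.2))%:E else 0%E.
have mk : measurable_fun setT k.
  apply: measurable_fun_ifT => //.
    apply: measurable_and; apply: measurable_fun_ler => //; by mf.
  apply/measurable_EFinP; apply: (measurableT_comp mH).
  apply: measurable_fun_pair; first by mf.
  have mp : measurable_fun setT (fun u : spacetime mR * mR => (u.2, u.1.2)) by mf.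
  exact: (measurableT_comp (@measurable_transl2 R) mp).
have e (z : spacetime mR) : primitive (fun s : R => H (s, transl s z.2) : R) z.1 =
    fine (\int[leb1]_s ((fun u => k u)^\+ (z, s)) - \int[leb1]_s ((fun u => k u)^\- (z, s)))%E.
  rewrite /primitive /Rintegral integral_mkcond integralE; congr (fine (_ - _)).
    by apply: eq_integral => s _; rewrite !funeposE /patch /k /= mem_setE in_itv.
  by apply: eq_integral => s _; rewrite !funenegE /patch /k /= mem_setE in_itv.
rewrite (_ : (fun z => _) = (fun z : spacetime mR => fine (\int[leb1]_s ((fun u => k u)^\+ (z, s)) - \int[leb1]_s ((fun u => k u)^\- (z, s)))%E)); last first.
  by apply/funext.
apply: (measurableT_comp (fine_measurable measurableT)).
have hp := @measurable_integral_param _ _ _ _ _ leb1 setT k^\+%E measurableT (measurable_funepos mk) (@funepos_ge0 _ _ k).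
have hn := @measurable_integral_param _ _ _ _ _ leb1 setT k^\-%E measurableT (measurable_funeneg mk) (@funeneg_ge0 _ _ k).
exact: emeasurable_funB hp hn.
Qed.

(** The equation is kept for log (1 + g), and in [mild_at] the exceptional set of characteristics
    may depend on t; [mild_ae] exchanges the quantifiers. *)
Record mild_solution (g : spacetime mR -> mR) : Prop := {
  mild_measurable : measurable_fun setT g ;
  mild_ge0 : forall z, 0 <= g z ;
  mild_integrable : forall t, 0 <= t ->
    leb4.-integrable setT (fun z : phase mR => (g (t, z))%:E) ;
  mild_fin : {ae leb5, forall z : spacetime mR, 0 <= z.1 ->
    gain g z \is a fin_num /\ loss g z \is a fin_num} ;
  mild_at : forall t, 0 < t -> {ae leb4, forall z : phase mR,
    leb1.-integrable `[0, t] (EFin \o (fun tau : mR => renorm_rhs g (tau, transl tau z) : mR)) /\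
    ln (1 + g (t, transl t z)) =
    ln (1 + g (0, z)) + primitive (fun tau => renorm_rhs g (tau, transl tau z)) t}
}.

Lemma renormalized_mild (f : R -> phase R -> R) :
  renormalized_solution f -> C_Lp `[0, +oo[ 1 f -> mild_solution (positive_part f).
Proof.
move=> rf cf; have mg := measurable_g rf; have g0 := positive_part_ge0 f.
split => //; [exact: g_integrable|exact: gain_loss_fin|].
move=> t t0.
apply: (@mild R (fun z => ln (1 + positive_part f z)) (renorm_rhs (positive_part f))) t0.
- apply: measurable_funTS; apply: (measurableT_comp (@measurable_ln R)).
  exact: measurable_funD.
- by apply: measurable_funTS; exact: measurable_renorm_rhs.
- exact: log_loc_integrable.
- exact: renorm_rhs_integrable.
- exact: log_integrable.
- exact: log_continuous.
- exact: renorm_weak.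
Qed.

(** Both sides are jointly measurable, so the exceptional set is null in space-time and can be
    sliced in the other direction: on almost every characteristic the equation holds at almost every
    time. *)
Lemma mild_ae (g : spacetime mR -> mR) : mild_solution g ->
  {ae leb4, forall z : phase mR, {ae leb1, forall t : mR, 0 < t ->
    ln (1 + g (t, transl t z)) =
    ln (1 + g (0, z)) + primitive (fun tau => renorm_rhs g (tau, transl tau z)) t}}.
Proof.
move=> mg; have m := mild_measurable mg; have g0 := mild_ge0 mg.
pose A (z : spacetime mR) : \bar R := (ln (1 + g (z.1, transl z.1 z.2)))%:E.
pose B (z : spacetime mR) : \bar R :=
  (ln (1 + g (0, z.2)) + primitive (fun tau : R => renorm_rhs g (tau, transl tau z.2) : R) z.1)%:E.
have mA : measurable_fun setT A.
  apply/measurable_EFinP; apply: (measurableT_comp (@measurable_ln R)).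
  apply: measurable_funD => //; apply: (measurableT_comp m).
  exact: measurable_fun_pair (@measurable_fst _ _ _ _) (@measurable_transl2 R).
have mB : measurable_fun setT B.
  apply/measurable_EFinP; apply: measurable_funD.
    apply: (measurableT_comp (@measurable_ln R)); apply: measurable_funD => //.
    by apply: (measurableT_comp m); mf.
  exact: (measurable_primitive_transl (measurable_renorm_rhs m g0)).
pose P := [set z : spacetime mR | 0 < z.1 -> A z = B z].
have mpos : measurable ([set z : spacetime mR | 0 < z.1]).
  rewrite (_ : mkset _ = `]0, +oo[%classic `*` setT); first exact: measurableX.
  apply/seteqP; split => z /=; rewrite in_itv/= andbT; first by [].
  by case.
have mP : measurable P.
  have := measurableU _ _ (measurableC mpos) (measurable_eqe measurableT mA mB).
  rewrite (_ : _ `|` _ = P)//; apply/seteqP; split => z.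
    by case=> [h z0|[_ e] _]; [case: h|exact: e].
  by move=> h; have [z0|z0] := pselect (0 < z.1); [right; split => //; exact: h|left].
have : {ae leb5, forall z, P z}.
  apply: (@ae_prod_intro _ _ _ _ _ leb1 leb4 P mP).
  apply: aeW => t.
  have [t0|t0] := ltP 0 t; last by apply: aeW => z /=; rewrite /P /= ltNge t0.
  by apply: (ae_imp (mild_at mg t0)) => z [_ e] _; rewrite /A /B /= e.
move=> /(@ae_prod2 _ _ _ _ _ leb1 leb4 P) h.
apply: (ae_imp h) => z hz; apply: (ae_imp hz) => t ht t0.
by have [] := ht t0.
Qed.

End MildSolutions.

(** The common constant [a] makes the difference of the exponentials vanish at time 0, so that it is
    itself a primitive, as [primitive_pos_le] requires. *)
Lemma expR_primitiveB (R : realType) (G H : R -> R) (a T : R) : 0 <= T ->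
  lebesgue_measure.-integrable `[0, T] (EFin \o G) ->
  lebesgue_measure.-integrable `[0, T] (EFin \o H) ->
  let alpha s := expR (a + primitive G s) * G s - expR (a + primitive H s) * H s in
  lebesgue_measure.-integrable `[0, T] (EFin \o alpha) /\
  forall s, 0 <= s -> s <= T ->
    primitive alpha s = expR (a + primitive G s) - expR (a + primitive H s).
Proof.
move=> T0 iG iH alpha.
have jG := expR_primitive_integrable a T0 iG.
have jH := expR_primitive_integrable a T0 iH.
split; first by have := integrableB _ jG jH; exact.
move=> s s0 sT; rewrite /primitive /alpha RintegralB//; last 2 first.
- exact: itv0_integrable sT jG.
- exact: itv0_integrable sT jH.
have := expR_primitive a T0 iG s0 sT; have := expR_primitive a T0 iH s0 sT.
rewrite /primitive /= => <- <-; by rewrite opprB addrA subrK.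
Qed.

(** * Contraction estimate for two mild solutions *)

Section Comparison.
Variable R : realType.
Local Notation mR := (measurableTypeR R).
Variables g h : spacetime mR -> mR.
Hypotheses (mild_g : mild_solution g) (mild_h : mild_solution h).

Definition excess (z : spacetime mR) : mR := Num.max (g z - h z) 0.
Definition deficit (z : spacetime mR) : mR := Num.max (h z - g z) 0.

(* Upper bound for Q(g,g) - Q(h,h) where h < g. *)
Definition growth (z : spacetime mR) : \bar R :=
  (Qplus (fun y => excess (z.1, y)) (fun y => g (z.1, y)) z.2 +
   Qplus (fun y => g (z.1, y)) (fun y => excess (z.1, y)) z.2 +
   (g z)%:E * density (fun y => deficit (z.1, y)) z.2.1)%E.

Let g0 := mild_ge0 mild_g.
Let h0 := mild_ge0 mild_h.
Let mg := mild_measurable mild_g.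
Let mh := mild_measurable mild_h.

Lemma excess_ge0 z : 0 <= excess z. Proof. by rewrite le_max lexx orbT. Qed.
Lemma deficit_ge0 z : 0 <= deficit z. Proof. by rewrite le_max lexx orbT. Qed.

Lemma measurable_excess : measurable_fun setT excess.
Proof. by apply: measurable_maxr; [exact: measurable_funB|exact: measurable_cst]. Qed.

Lemma measurable_deficit : measurable_fun setT deficit.
Proof. by apply: measurable_maxr; [exact: measurable_funB|exact: measurable_cst]. Qed.

Let sec (k : spacetime mR -> mR) t : measurable_fun setT k ->
  measurable_fun setT (fun y : phase mR => k (t, y)).
Proof. by move=> mk; exact: measurable_fun_pair2. Qed.

Lemma growth_ge0 z : (0 <= growth z)%E.
Proof.
rewrite /growth; apply: adde_ge0; first apply: adde_ge0.
- by apply: Qplus_ge0 => y; [exact: excess_ge0|exact: g0].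
- by apply: Qplus_ge0 => y; [exact: g0|exact: excess_ge0].
- by apply: mule_ge0; [rewrite lee_fin|apply: density_ge0 => y; exact: deficit_ge0].
Qed.

Lemma measurable_growth : measurable_fun setT growth.
Proof.
apply: emeasurable_funD; first apply: emeasurable_funD.
- exact: (measurable_Qplus_param measurable_excess mg excess_ge0 g0).
- exact: (measurable_Qplus_param mg measurable_excess g0 excess_ge0).
apply: emeasurable_funM; first exact/measurable_EFinP.
have mp : measurable_fun setT (fun z : spacetime mR => (z.1, z.2.1)) by mf.
exact: (measurableT_comp (measurable_density_param measurable_deficit deficit_ge0) mp).
Qed.

(** The inequality Q(g,g) - Q(h,h) <= growth, rearranged without subtraction because the terms may
    be infinite. The gain part is [Qplus_le]; the loss part, h rho_h <= g (rho_g + rho_deficit), is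
    where h <= g at z is needed. *)
Lemma collision_le z : h z <= g z ->
  (gain g z + loss h z <= gain h z + loss g z + growth z)%E.
Proof.
case: z => t y hg.
have q := Qplus_le (y : phase mR) (sec t mg) (sec t mh) (sec t measurable_excess)
  (fun y => g0 (t, y)) (fun y => h0 (t, y)) (fun y => excess_ge0 (t, y)).
have gh y' : g (t, y') <= h (t, y') + excess (t, y') by rewrite -lerBlDl le_max lexx.
have {}q := q gh.
have d : (density (fun y => h (t, y)) y.1 <=
    density (fun y => g (t, y)) y.1 + density (fun y => deficit (t, y)) y.1)%E.
  have mx (k : spacetime mR -> mR) : measurable_fun setT k ->
      measurable_fun setT (fun v : plane mR => (k (t, (y.1, v)))%:E).
    by move=> mk; apply/measurable_EFinP; exact: (measurable_fun_pair2 y.1 (sec t mk)).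
  rewrite /density -ge0_integralD//.
  - apply: ge0_le_integral => //.
    + by move=> v _; rewrite lee_fin; exact: h0.
    + exact: mx.
    + by apply: emeasurable_funD; apply: mx => //; exact: measurable_deficit.
    + by move=> v _; rewrite -EFinD lee_fin -lerBlDl le_max lexx.
  - by move=> v _; rewrite lee_fin; exact: g0.
  - exact: mx.
  - by move=> v _; rewrite lee_fin; exact: deficit_ge0.
  - by apply: mx; exact: measurable_deficit.
have l : (loss h (t, y) <= loss g (t, y) + (g (t, y))%:E * density (fun y => deficit (t, y)) y.1)%E.
  rewrite /loss /Qminus /= -ge0_muleDr; last 2 first.
  - by apply: density_ge0 => z; exact: g0.
  - by apply: density_ge0 => z; exact: deficit_ge0.
  apply: lee_pmul => //; first by rewrite lee_fin.
  by apply: density_ge0 => z; exact: h0.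
apply: le_trans (leeD q l) _.
by rewrite /growth /gain /= addeACA.
Qed.

Lemma collision_le_fine z : gain g z \is a fin_num -> loss g z \is a fin_num ->
  gain h z \is a fin_num -> loss h z \is a fin_num -> h z <= g z ->
  ((fine (gain g z) - fine (loss g z) - (fine (gain h z) - fine (loss h z)))%:E <= growth z)%E.
Proof.
move=> a1 a2 a3 a4 /collision_le; have := growth_ge0 z.
case: (growth z) => [b| |]//; last by move=> _ _; rewrite leey.
move: (gain g z) (loss g z) (gain h z) (loss h z) a1 a2 a3 a4.
move=> [x1| |] [x2| |] [x3| |] [x4| |]//= _ _ _ _ _; rewrite -!EFinD !lee_fin.
by lra.
Qed.

Hypothesis init : {ae leb4, forall z : phase mR, g (0, z) = h (0, z)}.

(** Multiplication by 1 + g = e^(log (1 + g)) undoes the renormalization, so that along the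
    characteristic g - h is represented by the primitive of [alpha], almost everywhere the
    difference of the two collision terms. [growth] is known to dominate [alpha] only where h <= g,
    and [primitive_pos_le] asks for no more. *)
Lemma excess_le t : 0 < t -> {ae leb4, forall z : phase mR,
  ((excess (t, transl t z))%:E <= \int[leb1]_(s in `[0%R, t]) growth (s, transl s z))%E}.
Proof.
move=> t0.
have fin (k : spacetime mR -> mR) : mild_solution k ->
  {ae leb4, forall z : phase mR, {ae leb1, forall s : mR, 0 <= s ->
    gain k (s, transl s z) \is a fin_num /\ loss k (s, transl s z) \is a fin_num}}.
  move=> /mild_fin /(preserves_ae (@preserves_shear R)) hk.
  exact: (@ae_prod2 _ _ _ _ _ leb1 leb4 _ hk).
(* [mild_at] serves at the end time t, [mild_ae] at almost every time in between. *)
apply: (ae_imp (ae_and init (ae_and (mild_at mild_g t0) (ae_and (mild_at mild_h t0)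
  (ae_and (ae_and (mild_ae mild_g) (mild_ae mild_h)) (ae_and (fin _ mild_g) (fin _ mild_h))))))).
move=> z [e0 [[ig eg] [[ih eh] [[ag ah] [fg fh]]]]].
pose Gg (s : R) : R := renorm_rhs g (s, transl s z).
pose Gh (s : R) : R := renorm_rhs h (s, transl s z).
pose Fg (s : R) : R := ln (1 + g (0, z)) + primitive Gg s.
pose Fh (s : R) : R := ln (1 + h (0, z)) + primitive Gh s.
have t0' := ltW t0.
pose alpha (s : R) : R := expR (Fg s) * Gg s - expR (Fh s) * Gh s.
have eF s : Fh s = ln (1 + g (0, z)) + primitive Gh s by rewrite /Fh e0.
have [ia pa] : leb1.-integrable `[0, t] (EFin \o alpha) /\
    forall s, 0 <= s -> s <= t -> primitive alpha s = expR (Fg s) - expR (Fh s).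
  have -> : alpha = (fun s => expR (Fg s) * Gg s -
      expR (ln (1 + g (0, z)) + primitive Gh s) * Gh s).
    by apply/funext => s; rewrite /alpha eF.
  have [? e] := expR_primitiveB (ln (1 + g (0, z))) t0' ig ih.
  by split => // s s0 st; rewrite eF; exact: e.
have pos (k : spacetime mR -> mR) y : (forall y, 0 <= k y) -> expR (ln (1 + k y)) = 1 + k y.
  by move=> k0; rewrite lnK// posrE; have := k0 y; lra.
have -> : excess (t, transl t z) = Num.max (primitive alpha t) 0.
  rewrite pa// /Fg /Fh -eg -eh !pos// /excess; congr Num.max; lra.
have mgr : measurable_fun setT (fun s : mR => growth (s, transl s z)).
  have mp : measurable_fun setT (fun s : mR => (s, transl s z)).
    apply: measurable_fun_pair; first exact: measurable_id.
    exact: (measurable_fun_pair1 z (@measurable_transl2 R)).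
  exact: (measurableT_comp measurable_growth mp).
apply: primitive_pos_le => //.
- exact: measurable_funTS.
- by move=> s; exact: growth_ge0.
apply: (ae_imp (ae_and (ae_and ag ah) (ae_and fg fh))) => s [[bg bh] [cg ch]].
rewrite /= in_itv/= => /andP[s0 st]; rewrite pa// => ps.
have sp : 0 < s.
  rewrite lt_neqAle s0 andbT; apply/eqP => es; move: ps.
  by rewrite -es /Fg /Fh !primitive0 e0 subrr ltxx.
have [x1 x2] := cg s0; have [y1 y2] := ch s0.
move: ps; rewrite /Fg /Fh -(bg sp) -(bh sp) !pos// => ps.
apply: le_trans (collision_le_fine x1 x2 y1 y2 _); last first.
  by move: ps; rewrite opprD addrACA subrr add0r subr_gt0 => /ltW.
rewrite lee_fin /alpha /Fg /Fh -(bg sp) -(bh sp) !pos// /Gg /Gh /renorm_rhs.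
have n1 : 1 + g (s, transl s z) != 0 by rewrite gt_eqF// ltr_pwDl.
have n2 : 1 + h (s, transl s z) != 0 by rewrite gt_eqF// ltr_pwDl.
by rewrite !mulrBr !mulrA !divff// !mul1r.
Qed.

End Comparison.

Section DensityProduct.
Variable R : realType.
Local Notation mR := (measurableTypeR R).
Local Open Scope ereal_scope.
Variables a b : phase mR -> mR.
Hypotheses (ma : measurable_fun setT a) (mb : measurable_fun setT b).
Hypotheses (a0 : forall z, (0 <= a z)%R) (b0 : forall z, (0 <= b z)%R).

Lemma integral_mul_density : \int[leb4]_z ((b z)%:E * density a z.1) =
  \int[leb2]_x (density a x * density b x).
Proof.
have md := measurable_density ma a0.
have mf : measurable_fun setT (fun z : phase mR => (b z)%:E * density a z.1).
  apply: emeasurable_funM; first exact/measurable_EFinP.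
  exact: (measurableT_comp md measurable_fst).
have d0 x : 0 <= density a x by exact: density_ge0.
have f0 (z : phase mR) : 0 <= (b z)%:E * density a z.1 by rewrite mule_ge0 ?lee_fin.
rewrite [LHS](fubini_tonelli1 (m1 := leb2) (m2 := leb2) _ mf f0).
apply: eq_integral => x _; rewrite /fubini_F /=.
rewrite ge0_integralZr//; first by rewrite muleC.
- by apply/measurable_EFinP; exact: measurable_fun_pair2.
- by move=> v _; rewrite lee_fin.
Qed.

Lemma density_product_le (c : R) : (0 <= c)%R ->
  {ae leb2, forall x : plane mR, density b x <= c%:E} ->
  \int[leb2]_x (density a x * density b x) <= c%:E * \int[leb4]_z (a z)%:E.
Proof.
move=> c0 bc; have md := measurable_density ma a0; have me := measurable_density mb b0.
have d0 x : 0 <= density a x by exact: density_ge0.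
have e0 x : 0 <= density b x by exact: density_ge0.
rewrite -(integral_density ma a0) -ge0_integralZl//.
apply: ae_ge0_le_integral => //.
- by move=> x _; rewrite mule_ge0.
- exact: emeasurable_funM.
- by move=> x _; rewrite mule_ge0.
- exact: emeasurable_funM.
- by apply: (ae_imp bc) => x h _; rewrite muleC lee_wpmul2r.
Qed.

End DensityProduct.

Section Contraction.
Variable R : realType.
Local Notation mR := (measurableTypeR R).
Variables g h : spacetime mR -> mR.
Hypotheses (mild_g : mild_solution g) (mild_h : mild_solution h).
Hypothesis init : {ae leb4, forall z : phase mR, g (0, z) = h (0, z)}.

Let g0 := mild_ge0 mild_g.
Let h0 := mild_ge0 mild_h.
Let mg := mild_measurable mild_g.
Let mh := mild_measurable mild_h.
Let u := excess g h.
Let w := deficit g h.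
Let mu_ : measurable_fun setT u := measurable_excess mild_g mild_h.
Let mw : measurable_fun setT w := measurable_deficit mild_g mild_h.
Let u0 : forall z, 0 <= u z := excess_ge0 g h.
Let w0 : forall z, 0 <= w z := deficit_ge0 g h.

Let sec (k : spacetime mR -> mR) t : measurable_fun setT k ->
  measurable_fun setT (fun y : phase mR => k (t, y)).
Proof. by move=> mk; exact: measurable_fun_pair2. Qed.

Definition total (k : spacetime mR -> mR) (t : R) : \bar R := (\int[leb4]_z (k (t, z))%:E)%E.

Lemma total_ge0 (k : spacetime mR -> mR) t : (forall z, 0 <= k z) -> (0 <= total k t)%E.
Proof. by move=> k0; apply: integral_ge0 => z _; rewrite lee_fin. Qed.

Lemma measurable_total (k : spacetime mR -> mR) : measurable_fun setT k ->
  (forall z, 0 <= k z) -> measurable_fun setT (total k : mR -> \bar R).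
Proof.
move=> mk k0.
apply: (@measurable_integral_param _ _ _ _ _ leb4 setT (fun z : spacetime mR => (k z)%:E) measurableT).
  exact/measurable_EFinP.
by move=> z; rewrite lee_fin.
Qed.

Lemma integral_growth_le (t c : R) : 0 <= c ->
  {ae leb2, forall x : plane mR, (density (fun y => g (t, y)) x <= c%:E)%E} ->
  (\int[leb4]_z growth g h (t, z) <= c%:E * (total u t + total u t + total w t))%E.
Proof.
move=> c0 gc.
have mu1 := sec t mu_; have mw1 := sec t mw; have mg1 := sec t mg.
have u1 y : 0 <= u (t, y) by []; have w1 y : 0 <= w (t, y) by []; have g1 y : 0 <= g (t, y) by [].
have q1 := measurable_Qplus mu1 mg1 u1 g1.
have q2 := measurable_Qplus mg1 mu1 g1 u1.
have q3 : measurable_fun setT (fun z : phase mR => (g (t, z))%:E * density (fun y => w (t, y)) z.1)%E.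
  apply: emeasurable_funM; first exact/measurable_EFinP.
  exact: (measurableT_comp (measurable_density mw1 w1) measurable_fst).
have p1 z : (0 <= Qplus (fun y => u (t, y)) (fun y => g (t, y)) z)%E by exact: Qplus_ge0.
have p2 z : (0 <= Qplus (fun y => g (t, y)) (fun y => u (t, y)) z)%E by exact: Qplus_ge0.
have p3 (z : phase mR) : (0 <= (g (t, z))%:E * density (fun y => w (t, y)) z.1)%E.
  by rewrite mule_ge0 ?lee_fin ?density_ge0.
rewrite /growth ge0_integralD//; last 2 first.
- by move=> z _; exact: adde_ge0.
- exact: emeasurable_funD.
rewrite ge0_integralD//.
have tu := total_ge0 t u0; have tw := total_ge0 t w0.
rewrite (ge0_muleDr _ (adde_ge0 tu tu) tw) (ge0_muleDr _ tu tu).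
have l1 := density_product_le mu1 mg1 u1 g1 c0 gc.
have l2 := density_product_le mw1 mg1 w1 g1 c0 gc.
apply: leeD; first apply: leeD.
- rewrite (integral_Qplus mu1 mg1 u1 g1 q1); exact: l1.
- rewrite (integral_Qplus mg1 mu1 g1 u1 q2).
  by under eq_integral do rewrite muleC; exact: l1.
- rewrite (integral_mul_density mw1 mg1 w1 g1); exact: l2.
Qed.

(** Integrate [excess_le] over all characteristics; the free flow preserves the measure, both at
    time t and at each time s under the integral. *)
Lemma total_excess_le t : 0 < t ->
  (total u t <= \int[leb1]_(s in `[0%R, t]) \int[leb4]_z growth g h (s, z))%E.
Proof.
move=> t0.
have mgr := measurable_growth mild_g mild_h.
have gr0 := growth_ge0 h mild_g.
pose G (z : phase mR * mR) := growth g h (z.2, transl z.2 z.1).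
have mG : measurable_fun setT G.
  have mp : measurable_fun setT (fun z : phase mR * mR => (z.2, transl z.2 z.1)).
    apply: measurable_fun_pair; first by mf.
    have ms : measurable_fun setT (fun z : phase mR * mR => (z.2, z.1)) by mf.
    exact: (measurableT_comp (@measurable_transl2 R) ms).
  exact: (measurableT_comp mgr mp).
have G0 z : (0 <= G z)%E by exact: gr0.
have mI : measurable (`[0, t]%classic : set mR) by exact: measurable_itv.
have mut : measurable_fun setT (fun z : phase mR => (u (t, z))%:E).
  by apply/measurable_EFinP; exact: sec.
have -> : (total u t = \int[leb4]_z (u (t, transl t z))%:E)%E.
  have p0 (z : phase mR) : setT z -> (0 <= (u (t, z))%:E)%E by rewrite lee_fin.
  have := preserves_ge0_integral (preserves_transl t) measurableT mut p0.
  by rewrite preimage_setT => e; exact: esym e.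
have le1 : (\int[leb4]_z (u (t, transl t z))%:E <=
    \int[leb4]_z \int[leb1]_(s in `[0%R, t]) G (z, s))%E.
  apply: ae_ge0_le_integral => //.
  - by move=> z _; rewrite lee_fin.
  - exact: (measurableT_comp mut (preserves_transl t).1).
  - by move=> z _; apply: integral_ge0.
  - exact: (@measurable_integral_param _ _ _ _ _ leb1 _ G mI mG G0).
  - by apply: (ae_imp (excess_le mild_g mild_h init t0)) => z.
apply: le_trans le1 _.
rewrite (@tonelli_swap _ _ _ _ _ leb4 leb1 _ G mI mG G0).
rewrite le_eqVlt; apply/orP; left; apply/eqP; apply: eq_integral => s _.
have ms : measurable_fun setT (fun z : phase mR => growth g h (s, z)).
  exact: measurable_fun_pair2.
have := preserves_ge0_integral (preserves_transl s) measurableT ms (fun z _ => gr0 (s, z)).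
by rewrite preimage_setT.
Qed.

Variables (T : R) (k : mR -> mR).
Hypothesis k0 : forall s, 0 <= k s.
Hypothesis ik : leb1.-integrable `[0, T] (EFin \o k).
Hypothesis gk : {ae leb1, forall s : mR, 0 <= s -> s <= T ->
  {ae leb2, forall x : plane mR, (density (fun y => g (s, y)) x <= (k s)%:E)%E}}.
Variable m : R.
Hypothesis mass : {ae leb1, forall s : mR, 0 <= s -> total g s = m%:E /\ total h s = m%:E}.

Lemma total_excess_fin t : 0 <= t -> total u t \is a fin_num.
Proof.
move=> t0; rewrite ge0_fin_numE; last exact: total_ge0.
have ig := mild_integrable mild_g t0.
apply: (@le_lt_trans _ _ (total g t)).
  apply: ge0_le_integral => //.
  - by move=> z _; rewrite lee_fin.
  - by apply/measurable_EFinP; exact: sec.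
  - by apply/measurable_EFinP; exact: sec.
  - move=> z _; rewrite lee_fin ge_max g0 andbT; have := h0 (t, z); lra.
by have := integrable_fin_num measurableT ig; rewrite ge0_fin_numE//; exact: total_ge0 g0.
Qed.

(** Integrate the pointwise identity u + h = w + g and cancel the equal masses, which are finite. *)
Lemma total_deficit : {ae leb1, forall s : mR, 0 <= s ->
  total w s = total u s /\ (total u s <= m%:E)%E}.
Proof.
apply: (ae_imp mass) => s hm s0; have [e1 e2] := hm s0.
have mu1 := sec s mu_; have mw1 := sec s mw; have mg1 := sec s mg; have mh1 := sec s mh.
have fu := total_excess_fin s0.
have e : (total u s + total h s = total w s + total g s)%E.
  rewrite /total -!ge0_integralD//; try (by move=> z _; rewrite lee_fin); try (by apply/measurable_EFinP).
  apply: eq_integral => z _; rewrite -!EFinD; congr EFin.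
  rewrite /u /w /excess /deficit.
  by case: (leP (g (s, z) - h (s, z)) 0); case: (leP (h (s, z) - g (s, z)) 0); lra.
split.
  move: e fu; rewrite e1 e2; case: (total u s) => [a| |]//; case: (total w s) => [b| |]//.
  by rewrite -!EFinD => -[] ab _; congr EFin; lra.
rewrite -e1; apply: ge0_le_integral => //.
- by move=> z _; rewrite lee_fin.
- exact/measurable_EFinP.
- exact/measurable_EFinP.
- move=> z _; rewrite lee_fin ge_max g0 andbT; have := h0 (s, z); lra.
Qed.

Let U (t : R) : R := fine (total u t).

(** The 3 counts the three terms of [integral_growth_le] after the deficit has been replaced by the
    excess. Time 0 is treated apart, from the common initial data. *)
Lemma excess_gronwall t : 0 <= t -> t <= T ->
  ((U t)%:E <= \int[leb1]_(s in `[0%R, t]) (3 * k s * U s)%:E)%E.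
Proof.
move=> t0 tT; have -> : (U t)%:E = total u t by apply: fineK; exact: total_excess_fin.
have U_ge0 s : 0 <= U s by rewrite /U fine_ge0// total_ge0.
have [tz|tp] := leP t 0.
  have -> : (total u t = 0)%E.
    have {tz t0 tT} -> : t = 0 by apply/eqP; rewrite eq_le tz t0.
    rewrite /total -[RHS](integral0 leb4 setT); apply: ae_eq_integral => //.
      by apply/measurable_EFinP; exact: sec.
    by apply: (ae_imp init) => z e _; rewrite /u /excess e subrr maxxx.
  by apply: integral_ge0 => s _; rewrite lee_fin !mulr_ge0.
apply: le_trans (total_excess_le tp) _.
have mI : measurable (`[0, t]%classic : set mR) by exact: measurable_itv.
have mgr := measurable_growth mild_g mild_h.
have gr0 := growth_ge0 h mild_g.
have mU : measurable_fun setT (U : mR -> mR).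
  by apply: (measurableT_comp (fine_measurable measurableT)); exact: measurable_total.
have mk : measurable_fun (`[0, t]%classic : set mR) k.
  have /integrableP[/measurable_EFinP mk _] := ik.
  apply: measurable_funS mk; first exact: measurable_itv.
  by move=> s /=; rewrite !in_itv/= => /andP[s0 st]; rewrite s0 (le_trans st tT).
apply: ae_ge0_le_integral => //.
- by move=> s _; apply: integral_ge0.
- apply: measurable_funTS.
  exact: (@measurable_integral_param _ _ _ _ _ leb4 setT (growth g h) measurableT mgr gr0).
- by move=> s _; rewrite lee_fin !mulr_ge0.
- apply/measurable_EFinP; apply: measurable_funM; last exact: measurable_funTS.
  by apply: measurable_funM.
apply: (ae_imp (ae_and gk total_deficit)) => s [hk hw].
rewrite /= in_itv/= => /andP[s0 st].
have [ew _] := hw s0; have fu := total_excess_fin s0.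
apply: le_trans (integral_growth_le (k0 s) (hk s0 (le_trans st tT))) _.
rewrite ew -(fineK fu) -!EFinD -EFinM lee_fin /U.
by rewrite le_eqVlt; apply/orP; left; apply/eqP; ring.
Qed.

(** The mass bounds the excess at almost every time only, whereas [gronwall] asks for a bound at
    every time. Inserting the former under the integral of [excess_gronwall] produces the latter,
    namely M. The absolute value of m spares a discussion of its sign. *)
Lemma total_excess0 : 0 <= T -> forall t, 0 <= t -> t <= T -> total u t = 0%E.
Proof.
move=> T0 t t0 tT; have U_ge0 s : 0 <= U s by rewrite /U fine_ge0// total_ge0.
have mI : measurable (`[0, T]%classic : set mR) by exact: measurable_itv.
have ik3 (c : R) : leb1.-integrable `[0, T] (EFin \o (fun s => c * k s)).
  by have := integrableZl mI c ik; apply: eq_integrable => // s _ /=; rewrite EFinM.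
have mU : measurable_fun setT (U : mR -> mR).
  by apply: (measurableT_comp (fine_measurable measurableT)); exact: measurable_total.
have mk : measurable_fun (`[0, T]%classic : set mR) k.
  by have /integrableP[/measurable_EFinP mk _] := ik.
pose M := (\int[leb1]_(s in `[0%R, T]) (3 * k s * `|m|)%:E)%E.
have Mfin : M \is a fin_num.
  have := integrable_fin_num mI (ik3 (3 * `|m|)).
  by rewrite /M; under [X in X \is a fin_num -> _]eq_integral do rewrite /= mulrAC.
have UM s : 0 <= s -> s <= T -> 0 <= U s <= fine M.
  move=> s0 sT; rewrite U_ge0/= -lee_fin (fineK Mfin).
  apply: le_trans (excess_gronwall s0 sT) _.
  have sub : (`[0, s] `<=` `[0, T])%classic.
    by move=> r /=; rewrite !in_itv/= => /andP[r0 rs]; rewrite r0 (le_trans rs sT).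
  have mJ : measurable (`[0, s]%classic : set mR) by exact: measurable_itv.
  apply: (@le_trans _ _ (\int[leb1]_(r in `[0%R, s]) (3 * k r * `|m|)%:E)%E).
    apply: ae_ge0_le_integral => //.
    - by move=> r _; rewrite lee_fin !mulr_ge0.
    - apply/measurable_EFinP; apply: measurable_funM; last exact: measurable_funTS.
      by apply: measurable_funM => //; exact: measurable_funS mk.
    - by move=> r _; rewrite lee_fin !mulr_ge0.
    - apply/measurable_EFinP; apply: measurable_funM => //.
      by apply: measurable_funM => //; exact: measurable_funS mk.
    apply: (ae_imp total_deficit) => r hr; rewrite /= in_itv/= => /andP[r0 _].
    have [_ le] := hr r0; rewrite lee_fin ler_wpM2l ?mulr_ge0//.
    apply: (le_trans _ (ler_norm m)); rewrite -lee_fin /U fineK//.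
    exact: total_excess_fin.
  apply: ge0_subset_integral => //.
  - apply/measurable_EFinP; apply: measurable_funM => //.
    by apply: measurable_funM.
  - by move=> r _; rewrite lee_fin !mulr_ge0.
have := gronwall T0 (ik3 3) (measurable_funTS mU) _ UM _ t0 tT.
have h3 (s : R) : 0 <= s -> s <= T -> 0 <= 3 * k s by move=> _ _; rewrite mulr_ge0.
move=> /(_ h3 excess_gronwall) e.
by rewrite -(fineK (total_excess_fin t0)) -/(U t) e.
Qed.

End Contraction.

(** * Essential suprema and almost everywhere equality in norms *)

Lemma Lnormy_ge d (T : measurableType d) (R : realType) (m : {measure set T -> \bar R})
    (F : T -> \bar R) : {ae m, forall x, (`|F x| <= 'N[m]_(+oo)[F])%E}.
Proof.
rewrite unlock /=; case: ifPn => [_|]; first exact: ess_sup_ge.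
(* On a space of measure zero the norm is 0 by convention, but there every statement holds almost
   everywhere. *)
rewrite lt_neqAle measure_ge0 andbT negbK => /eqP m0.
by exists setT; split => //; rewrite -m0.
Qed.

(** The essential supremum of F(t, .) exceeds y exactly when the section at t of the set F > y has
    nonzero measure, and the measure of a section is a measurable function of t. *)
Lemma measurable_ess_sup_param d1 d2 (T1 : measurableType d1) (T2 : measurableType d2)
    (R : realType) (m : {sigma_finite_measure set T2 -> \bar R}) (F : T1 * T2 -> \bar R) :
  measurable_fun setT F -> measurable_fun setT (fun t => ess_sup m (fun x => F (t, x))).
Proof.
move=> mF _; apply: (measurability _ (ErealGenOInfty.measurableE R)) => // _ [_ [y ->] <-].
rewrite setTI.
have mS : measurable (F @^-1` `]y%:E, +oo[).
  by rewrite -[X in measurable X]setTI; apply: mF => //; exact: emeasurable_itv.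
have mx := measurable_fun_xsection m mS.
have -> : (fun t => ess_sup m (fun x => F (t, x))) @^-1` `]y%:E, +oo[ =
    ~` ((m \o xsection (F @^-1` `]y%:E, +oo[)) @^-1` [set 0%E]).
  apply/seteqP; split => t /=.
    rewrite in_itv/= andbT ltNge => /negP h e; apply: h; apply/ess_supP.
    apply/ae_le_measureP; first exact: measurable_fun_pair2.
    by rewrite -e; congr (m _); rewrite xsectionE.
  move=> h; rewrite in_itv/= andbT ltNge; apply/negP => /ess_supP.
  move=> /(ae_le_measureP _ _ (measurable_fun_pair2 t mF)) e; apply: h.
  by rewrite -e; congr (m _); rewrite xsectionE.
apply: measurableC; rewrite -[X in measurable X]setTI; apply: mx => //.
Qed.

Lemma L2norm_ae d (T : measurableType d) (R : realType) (m : {measure set T -> \bar R})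
    (a b : T -> R) : measurable_fun setT a -> measurable_fun setT b ->
  {ae m, forall y, a y = b y} -> ('N[m]_(2%:E)[EFin \o a] = 'N[m]_(2%:E)[EFin \o b])%E.
Proof.
move=> ma mb ab; rewrite unlock; congr (_ `^ _)%E.
have mp (k : T -> R) : measurable_fun setT k ->
    measurable_fun setT (fun y => (`|(k y)%:E| `^ 2)%E).
  move=> mk; apply: (measurableT_comp (measurable_poweR _)); apply: measurableT_comp => //.
  exact/measurable_EFinP.
apply: ae_eq_integral => //; [exact: mp|exact: mp|].
by apply: (ae_imp ab) => y /= ->.
Qed.

(** * Bound on the density *)

Section WeightedDensity.
Variable R : realType.
Local Notation mR := (measurableTypeR R).
Local Open Scope ereal_scope.

Lemma japanese_sqr (v : plane R) : (japanese v ^+ 2 = 1 + v.1 ^+ 2 + v.2 ^+ 2)%R.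
Proof. by rewrite /japanese sqr_sqrtr /sqnorm ?addrA//; nra. Qed.

(** <v>^(-2), the conjugate factor in the Cauchy-Schwarz inequality; its square <v>^(-4) is
    integrable over the plane. *)
Definition weight (v : plane mR) : mR := ((japanese v ^+ 2)^-1)%R.

Lemma integral_oneDsqr : \int[leb1]_x ((1 + (x : mR) ^+ 2)^-1)%R%:E < +oo.
Proof.
have p (x : R) : (0 <= (oneDsqr x)^-1)%R by rewrite invr_ge0 (le_trans ler01)// oneDsqr_ge1.
have e (x : R) : ((oneDsqr x)^-1 = (oneDsqr (- x))^-1)%R by rewrite /oneDsqr sqrrN.
have := ge0_symfun_integralT p (@continuous_oneDsqrV R) e.
rewrite -set_itvcy integral0y_oneDsqr -EFinM => E.
by rewrite [ltLHS]E ltry.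
Qed.

Lemma measurable_oneDsqrV : measurable_fun setT (fun x : mR => (1 + x ^+ 2)^-1 : mR)%R.
Proof. exact: continuous_measurable_fun (@continuous_oneDsqrV R). Qed.

Lemma japanese_sqr_gt0 (v : plane R) : (0 < japanese v ^+ 2)%R.
Proof. by rewrite japanese_sqr; nra. Qed.

Lemma measurable_japanese_sqr : measurable_fun setT (fun v : plane mR => japanese v ^+ 2 : mR)%R.
Proof.
rewrite (_ : (fun v => _) = (fun v : plane mR => 1 + v.1 ^+ 2 + v.2 ^+ 2 : mR)%R); last first.
  by apply/funext => v; exact: japanese_sqr.
have ms : measurable_fun (setT : set mR) (fun x : mR => x ^+ 2 : mR)%R.
  exact: continuous_measurable_fun (@exprn_continuous R 2).
apply: measurable_funD; first apply: measurable_funD => //.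
  exact: (measurableT_comp ms measurable_fst).
exact: (measurableT_comp ms measurable_snd).
Qed.

Lemma measurable_weight : measurable_fun setT weight.
Proof.
rewrite (_ : weight = (fun v => expR (- ln (japanese v ^+ 2))%R)); last first.
  by apply/funext => v; rewrite expRN lnK// posrE japanese_sqr_gt0.
apply: (measurableT_comp (@measurable_expR R)); apply: measurable_funN.
exact: (measurableT_comp (@measurable_ln R) measurable_japanese_sqr).
Qed.

(* (1 + x^2 + y^2)^2 >= (1 + x^2) (1 + y^2) separates the variables *)
Lemma weight_L2 : 'N[leb2]_(2%:E)[EFin \o weight] < +oo.
Proof.
rewrite unlock; apply: poweR_lty.
have w0 (v : plane mR) : (0 <= weight v)%R by rewrite invr_ge0 sqr_ge0.
pose q (x : mR) : mR := ((1 + x ^+ 2)^-1)%R.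
have q0 x : (0 <= q x)%R by rewrite invr_ge0 addr_ge0// sqr_ge0.
have mq : measurable_fun setT q by exact: measurable_oneDsqrV.
apply: (@le_lt_trans _ _ (\int[leb2]_v (q v.1 * q v.2)%:E)).
  apply: ge0_le_integral => //.
  - by move=> v _; exact: poweR_ge0.
  - apply: (measurableT_comp (measurable_poweR _)); apply: measurableT_comp => //.
    by apply/measurable_EFinP; exact: measurable_weight.
  - apply/measurable_EFinP; apply: measurable_funM.
      exact: (measurableT_comp mq measurable_fst).
    exact: (measurableT_comp mq measurable_snd).
  move=> v _ /=; rewrite ger0_norm// lee_fin powR_mulrn// /weight /q exprVn -invfM.
  rewrite lef_pV2; first by rewrite japanese_sqr; have := sqr_ge0 v.1; have := sqr_ge0 v.2; nra.
    by rewrite posrE exprn_gt0// japanese_sqr_gt0.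
  by rewrite posrE mulr_gt0// ltr_pwDl// sqr_ge0.
have mqq : measurable_fun setT (fun v : plane mR => (q v.1 * q v.2)%:E).
  apply/measurable_EFinP; apply: measurable_funM.
    exact: (measurableT_comp mq measurable_fst).
  exact: (measurableT_comp mq measurable_snd).
rewrite (fubini_tonelli1 (m1 := leb1) (m2 := leb1) _ mqq) /fubini_F /=; last first.
  by move=> v; rewrite lee_fin mulr_ge0.
have I0 : 0 <= \int[leb1]_x (q x)%:E by apply: integral_ge0 => x _; rewrite lee_fin.
have Ifin : \int[leb1]_x (q x)%:E \is a fin_num by rewrite ge0_fin_numE//; exact: integral_oneDsqr.
have mqE : measurable_fun setT (fun x : mR => (q x)%:E) by exact/measurable_EFinP.
have qE0 (x : mR) : setT x -> 0 <= (q x)%:E by rewrite lee_fin.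
have -> : \int[leb1]_x \int[leb1]_y (q x * q y)%:E =
    \int[leb1]_x ((q x)%:E * \int[leb1]_y (q y)%:E).
  apply: eq_integral => x _; rewrite -(ge0_integralZl leb1 measurableT mqE qE0 (qE0 x I)).
  by apply: eq_integral => y _; rewrite EFinM.
rewrite (ge0_integralZr leb1 measurableT mqE qE0 I0).
by rewrite -(fineK Ifin) -EFinM ltry.
Qed.

(** Cauchy-Schwarz for b = <v>^(-2) (<v>^2 b). *)
Lemma integral_le_weighted (b : plane mR -> mR) : measurable_fun setT b -> (forall v, 0 <= b v)%R ->
  \int[leb2]_v (b v)%:E <= 'N[leb2]_(2%:E)[EFin \o weight] *
    'N[leb2]_(2%:E)[(fun v => (japanese v ^+ 2 * b v)%R%:E)].
Proof.
move=> mb b0.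
have mjb : measurable_fun setT (fun v : plane mR => japanese v ^+ 2 * b v : mR)%R.
  by apply: measurable_funM => //; exact: measurable_japanese_sqr.
have p2 : (0 < 2 :> R)%R by [].
have pq : (2^-1 + 2^-1 = 1 :> R)%R by field.
have := hoelder leb2 measurable_weight mjb p2 p2 pq.
rewrite Lnorm1; apply: le_trans.
rewrite le_eqVlt; apply/orP; left; apply/eqP; apply: eq_integral => v _ /=.
rewrite /weight mulKf ?gt_eqF ?japanese_sqr_gt0//.
by rewrite ger0_norm.
Qed.

End WeightedDensity.

Section DensityBound.
Variable R : realType.
Local Notation mR := (measurableTypeR R).
Local Open Scope ereal_scope.
Variables (g : spacetime mR -> mR) (T : R) (N : mR -> \bar R).
Hypotheses (mg : measurable_fun setT g) (g0 : forall z, (0 <= g z)%R).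
Hypothesis N0 : forall t, 0 <= N t.
Hypothesis NT : \int[leb1]_(t in `[0%R, T]) (N t `^ 2) < +oo.
Hypothesis gN : {ae leb1, forall t : mR, (0 <= t)%R -> (t <= T)%R ->
  {ae leb2, forall x : plane mR,
    'N[leb2]_(2%:E)[(fun v => (japanese v ^+ 2 * g (t, (x, v)))%R%:E)] <= N t}}.

Let rho (t : mR) (x : plane mR) := density (fun y => g (t, y)) x.
(** The optimal bound in x, taken instead of [N] because it is measurable in t by
    [measurable_ess_sup_param]; the maximum with 0 settles its sign. *)
Let kb (t : mR) : \bar R := maxe (ess_sup leb2 (rho t)) 0.
(** Adding 1 makes the constant positive, so that it can be inverted. *)
Let C : R := (fine ('N[leb2]_(2%:E)[EFin \o @weight R]) + 1)%R.

Let C0 : (0 < C)%R.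
Proof. by rewrite /C ltr_wpDl// fine_ge0// Lnorm_ge0. Qed.

Let mkb : measurable_fun setT kb.
Proof.
apply: measurable_maxe => //.
have mr := measurable_density_param mg g0.
exact: (measurable_ess_sup_param leb2 mr).
Qed.

Let kb_le : {ae leb1, forall t : mR, (0 <= t)%R -> (t <= T)%R -> kb t <= C%:E * N t}.
Proof.
apply: (ae_imp gN) => t h t0 tT; rewrite /kb ge_max mule_ge0 ?lee_fin ?(ltW C0)// andbT.
apply/ess_supP; apply: (ae_imp (h t0 tT)) => x hx.
have mb : measurable_fun setT (fun v : plane mR => g (t, (x, v))).
  exact: (measurable_fun_pair2 x (measurable_fun_pair2 t mg)).
apply: le_trans (integral_le_weighted mb (fun v => g0 _)) _.
apply: lee_pmul => //; try exact: Lnorm_ge0.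
have fN : 'N[leb2]_(2%:E)[EFin \o @weight R] \is a fin_num.
  by rewrite ge0_fin_numE ?Lnorm_ge0// weight_L2.
by rewrite -(fineK fN) lee_fin /C lerDl.
Qed.

(** On a bounded time interval this places L^2 in L^1. *)
Lemma le_1D_sqr (q : \bar R) : 0 <= q -> q <= 1 + q `^ 2.
Proof.
case: q => [r| |]// r0; last by rewrite poweRyr ?pnatr_eq0// addey.
by rewrite poweR_EFin -EFinD lee_fin powR_mulrn//; nra.
Qed.

(** The comparison with [N] goes through [le_lower_integral], which tolerates a nonmeasurable
    right-hand side but wants an inequality at every time. Hence [K], which is [kb] set to 0 on the
    exceptional null set [A]; it is finite almost everywhere by integrability, and its finite part
    is the desired bound. *)
Lemma density_bound : exists k : mR -> mR, [/\ forall s, (0 <= k s)%R,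
  leb1.-integrable `[0%R, T] (EFin \o k) &
  {ae leb1, forall t : mR, (0 <= t)%R -> (t <= T)%R ->
    {ae leb2, forall x : plane mR, density (fun y => g (t, y)) x <= (k t)%:E}}].
Proof.
have [A [mA A0 bad]] := kb_le.
have mI : measurable (`[0%R, T]%classic : set mR) by exact: measurable_itv.
pose K := kb \_ (~` A).
have mK : measurable_fun setT K.
  by apply/(measurable_restrictT _ (measurableC mA)); exact: measurable_funTS.
have kb0 t : 0 <= kb t by rewrite /kb le_max lexx orbT.
have K0 t : 0 <= K t by rewrite /K /patch; case: ifP.
have KN t : (0 <= t)%R -> (t <= T)%R -> K t <= C%:E * N t.
  move=> t0 tT; rewrite /K /patch; case: ifPn => [|_].
    rewrite inE => At; apply: contrapT => h; apply: At; apply: bad => /(_ t0 tT).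
    exact: h.
  by rewrite mule_ge0// lee_fin ltW.
pose q t := (C^-1)%:E * K t.
have q0 t : 0 <= q t by rewrite mule_ge0// lee_fin invr_ge0 ltW.
have mq : measurable_fun setT q by exact: measurable_funeM.
have q2 : \int[leb1]_(t in `[0%R, T]) (q t `^ 2) < +oo.
  apply: le_lt_trans NT; rewrite integral_mkcond [leRHS]integral_mkcond.
  apply: le_lower_integral => t; first by rewrite /patch; case: ifP => // _; exact: poweR_ge0.
  rewrite /patch; case: ifPn => //; rewrite inE/= in_itv/= => /andP[t0 tT].
  apply: gt0_ler_poweR; rewrite ?in_itv/= ?leey ?andbT//.
  rewrite /q (@le_trans _ _ ((C^-1)%:E * (C%:E * N t)))//.
    by apply: lee_wpmul2l; [rewrite lee_fin invr_ge0 ltW|exact: KN].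
  by rewrite muleA -EFinM mulVf ?gt_eqF// mul1e.
have q1 : \int[leb1]_(t in `[0%R, T]) q t < +oo.
  apply: (@le_lt_trans _ _ (\int[leb1]_(t in `[0%R, T]) (1 + q t `^ 2))).
    apply: ge0_le_integral => //.
    - exact: measurable_funTS.
    - apply: emeasurable_funD => //; apply: measurable_funTS.
      exact: (measurableT_comp (measurable_poweR _) mq).
    - by move=> t _; exact: le_1D_sqr.
  rewrite ge0_integralD//; last 2 first.
  - by move=> t _; exact: poweR_ge0.
  - by apply: measurable_funTS; exact: (measurableT_comp (measurable_poweR _) mq).
  apply: lte_add_pinfty => //; rewrite integral_cst// mul1e.
  by rewrite /leb1 /= lebesgue_measure_itv/=; case: ifP => // _; rewrite ltry.
have iK : leb1.-integrable `[0%R, T] K.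
  apply/integrableP; split; first exact: measurable_funTS.
  under eq_integral do rewrite gee0_abs//.
  have -> : \int[leb1]_(t in `[0%R, T]) K t = C%:E * \int[leb1]_(t in `[0%R, T]) q t.
    rewrite -ge0_integralZl//; last by rewrite lee_fin ltW.
      by apply: eq_integral => t _; rewrite muleA -EFinM divff ?gt_eqF// mul1e.
    exact: measurable_funTS.
  by rewrite lte_mul_pinfty// ?lee_fin ?ltW.
have Kfin := integrable_ae mI iK.
exists (fun t => fine (K t)); split.
- by move=> t; exact: fine_ge0.
- apply: ae_eq_integrable mI _ _ iK.
    apply: measurable_funTS; apply/measurable_EFinP.
    exact: (measurableT_comp (fine_measurable measurableT) mK).
  by apply: (ae_imp Kfin) => t h tI; rewrite /= fineK// h.
have nA : {ae leb1, forall t, ~ A t}.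
  by exists A; split => // t /contrapT.
apply: (ae_imp (ae_and nA Kfin)) => t [At h] t0 tT.
rewrite fineK; last by apply: h; rewrite /= in_itv/= t0.
rewrite /K /patch mem_set//.
apply: (ae_imp (ess_sup_ge leb2 (rho t))) => x hx.
by rewrite le_max hx.
Qed.

End DensityBound.

(** * Uniqueness and maximal times *)

Section Uniqueness.
Variable R : realType.
Local Notation mR := (measurableTypeR R).
Variables (f0 : phase R -> R) (f h : R -> phase R -> R) (Tf Th : \bar R).
Hypotheses (f_star : star_solution f0 f Tf) (h_star : star_solution f0 h Th).
Hypothesis f_weight : forall T : R, 0 < T -> (T%:E < Tf)%E ->
  Bochner `[0, T] 2 (@Linfty_L2norm R) (fun t z => (japanese z.2 ^+ 2 * f t z)%:E).

Let rf := star_renorm f_star.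
Let rh := star_renorm h_star.
Let cf := star_C_L1 f_star.
Let ch := star_C_L1 h_star.
Let g := positive_part f.
Let k := positive_part h.
Let g_mild : mild_solution g := renormalized_mild rf cf.
Let k_mild : mild_solution k := renormalized_mild rh ch.

Lemma star_total (e : R -> phase R -> R) (S : \bar R) : star_solution f0 e S ->
  {ae leb1, forall s : mR, 0 <= s ->
    total (positive_part e) s = (fine (\int[leb4]_z (f0 z)%:E))%:E}.
Proof.
move=> e_star; have re := star_renorm e_star; have ce := star_C_L1 e_star.
apply: (ae_imp (ae_and (star_balance e_star) (ae_section re))) => s [bal sec] s0.
have mp : measurable_fun setT (fun y : phase mR => positive_part e (s, y)).
  by apply: measurable_fun_pair2; exact: measurable_g re.
have eq0 : total (positive_part e) s = (\int[leb4]_z (f0 z)%:E)%E.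
  rewrite -(bal_mass (bal s0)); apply: ae_eq_integral => //.
  - exact/measurable_EFinP.
  - by apply/measurable_EFinP; exact: (C_L1_measurable ce s0).
  - by apply: (ae_imp (sec s0)) => y ->.
have fin : total (positive_part e) s \is a fin_num.
  by have := integrable_fin_num measurableT (g_integrable re ce s0).
by rewrite -eq0 fineK.
Qed.

Lemma star_init_eq : {ae leb4, forall z : phase mR, g (0, z) = k (0, z)}.
Proof.
apply: (ae_imp (ae_and (star_init f_star) (star_init h_star))) => z [e1 e2].
by rewrite /g /k /positive_part /= lexx e1 e2.
Qed.

Lemma star_density_bound (T : R) : 0 < T -> (T%:E < Tf)%E ->
  exists c : mR -> mR, [/\ forall s, 0 <= c s,
  leb1.-integrable `[0, T] (EFin \o c) &
  {ae leb1, forall t : mR, 0 <= t -> t <= T ->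
    {ae leb2, forall x : plane mR, (density (fun y => g (t, y)) x <= (c t)%:E)%E}}].
Proof.
move=> T0 TTf; have [_ NT] := f_weight T0 TTf.
apply: (@density_bound R g T (fun t => Linfty_L2norm (fun z => (japanese z.2 ^+ 2 * f t z)%:E))) => //.
- exact: measurable_g rf.
- by move=> z; exact: positive_part_ge0.
- by move=> t; exact: Lnorm_ge0.
apply: (ae_imp (ae_section rf)) => t sec t0 tT.
have mft := C_L1_measurable cf t0.
have mgt : measurable_fun setT (fun y : phase mR => g (t, y)).
  by apply: measurable_fun_pair2; exact: measurable_g rf.
have mj (b : phase mR -> mR) x : measurable_fun setT b ->
    measurable_fun setT (fun v : plane mR => japanese v ^+ 2 * b (x, v) : mR).
  move=> mb; apply: measurable_funM; first exact: measurable_japanese_sqr.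
  exact: (measurable_fun_pair2 x mb).
have := Lnormy_ge leb2 (fun x : plane mR => 'N[leb2]_(2%:E)[(fun v => (japanese v ^+ 2 * f t (x, v))%:E)])%E.
move=> le; apply: (ae_imp (ae_and le (ae_prod1 (sec t0)))) => x [hx sx].
have -> : ('N[leb2]_(2%:E)[(fun v => (japanese v ^+ 2 * g (t, (x, v)))%:E)] =
    'N[leb2]_(2%:E)[(fun v => (japanese v ^+ 2 * f t (x, v))%:E)])%E.
  apply: (L2norm_ae (mj _ x mgt) (mj _ x mft)).
  by apply: (ae_imp sx) => v e; rewrite /g e.
by apply: le_trans hx; rewrite gee0_abs// Lnorm_ge0.
Qed.

Lemma star_unique_upto (T : R) : 0 < T -> (T%:E < Tf)%E ->
  {ae leb1, forall t : mR, 0 <= t -> t <= T ->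
    {ae leb4, forall y : phase mR, g (t, y) = k (t, y)}}.
Proof.
move=> T0 TTf; have [c [c0 ic gc]] := star_density_bound T0 TTf.
have mass : {ae leb1, forall s : mR, 0 <= s ->
    total g s = (fine (\int[leb4]_z (f0 z)%:E))%:E /\
    total k s = (fine (\int[leb4]_z (f0 z)%:E))%:E}.
  apply: (ae_imp (ae_and (star_total f_star) (star_total h_star))) => s [e1 e2] s0.
  by split; [exact: e1|exact: e2].
have ex0 := total_excess0 g_mild k_mild star_init_eq c0 ic gc mass (ltW T0).
apply: (ae_imp (total_deficit g_mild k_mild mass)) => t ht t0 tT.
have [wu _] := ht t0; have u_0 := ex0 t t0 tT; rewrite u_0 in wu.
have null (b : spacetime mR -> mR) : measurable_fun setT b -> (forall z, 0 <= b z) ->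
    total b t = 0%E -> {ae leb4, forall y : phase mR, b (t, y) = 0}.
  move=> mb b0 e.
  have mbt : measurable_fun setT (fun y : phase mR => (b (t, y))%:E).
    by apply/measurable_EFinP; exact: measurable_fun_pair2.
  have : ae_eq leb4 setT (fun y : phase mR => (b (t, y))%:E) (cst 0%E).
    apply/(ae_eq_integral_abs _ measurableT mbt).
    by under eq_integral do rewrite gee0_abs ?lee_fin//; exact: e.
  by move=> H; apply: (ae_imp H) => y /(_ I) [].
have n1 := null _ (measurable_excess g_mild k_mild) (excess_ge0 g k) u_0.
have n2 := null _ (measurable_deficit g_mild k_mild) (deficit_ge0 g k) wu.
apply: (ae_imp (ae_and n1 n2)) => y []; rewrite /excess /deficit => a b.
have : g (t, y) - k (t, y) <= 0 by rewrite -a le_max lexx.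
have : k (t, y) - g (t, y) <= 0 by rewrite -b le_max lexx.
by lra.
Qed.

Lemma star_unique_before : {ae leb1, forall t : mR, 0 <= t -> (t%:E < Tf)%E ->
    {ae leb4, forall y : phase mR, g (t, y) = k (t, y)}}.
Proof.
(* The null set of [star_unique_upto] depends on T; rational values of T suffice. The default 0 for
   integers that code no rational is excluded by the condition 0 < q n. *)
pose q (n : nat) : R := ratr (odflt 0 (unpickle n)).
have H n : {ae leb1, forall t : mR, 0 < q n -> ((q n)%:E < Tf)%E -> 0 <= t -> t <= q n ->
    {ae leb4, forall y : phase mR, g (t, y) = k (t, y)}}.
  have [q0|q0] := pselect (0 < q n /\ ((q n)%:E < Tf)%E); last first.
    by apply: aeW => t h1 h2; case: q0.
  by apply: (ae_imp (star_unique_upto q0.1 q0.2)) => t ht _ _; exact: ht.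
apply: (ae_imp (ae_foralln H)) => t ht t0 tT.
have [r tr rT] : exists2 r : R, t < r & (r%:E <= Tf)%E.
  move: tT; case: Tf => [b| |]//.
    by rewrite lte_fin => tb; exists b.
  by move=> _; exists (t + 1); [rewrite ltrDl|rewrite leey].
have [p /[!in_itv]/= /andP[tp pr]] := rat_in_itvoo tr.
have e : q (pickle p) = ratr p by rewrite /q pickleK.
apply: (ht (pickle p)); rewrite ?e ?(ltW tp) ?(le_lt_trans t0 tp)//.
by apply: lt_le_trans rT; rewrite lte_fin.
Qed.

Lemma star_unique_spacetime : {ae leb5, forall z : spacetime R, 0 <= z.1 -> (z.1%:E < Tf)%E ->
  h z.1 z.2 = f z.1 z.2}.
Proof.
pose P := [set z : spacetime mR | 0 <= z.1 -> (z.1%:E < Tf)%E -> g z = k z].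
pose D := [set z : spacetime mR | 0 <= z.1 /\ (z.1%:E < Tf)%E].
have mD : measurable D.
  have m1 := measurable_future R.
  have mz : measurable_fun setT (fun z : spacetime mR => z.1%:E).
    by apply/measurable_EFinP; exact: measurable_fst.
  have := emeasurable_fun_infty_o m1 (measurable_funTS mz) Tf.
  by [].
have mP : measurable P.
  have me : measurable_fun setT (fun z => (g z)%:E) by apply/measurable_EFinP; exact: measurable_g rf.
  have mk : measurable_fun setT (fun z => (k z)%:E) by apply/measurable_EFinP; exact: measurable_g rh.
  have := measurableU _ _ (measurableC mD) (measurable_eqe measurableT me mk).
  rewrite (_ : _ `|` _ = P)//; apply/seteqP; split => z.
    by case=> [nD a b|[_ [e]] _ _]; [case: nD|exact: e].
  move=> hz; have [d|nd] := pselect (D z); [right|by left].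
  by case: d => a b; split => //=; congr EFin; exact: hz a b.
have : {ae leb5, forall z, P z}.
  apply: (@ae_prod_intro _ _ _ _ _ leb1 leb4 P mP).
  apply: (ae_imp star_unique_before) => t ht.
  have [t0|t0] := pselect (0 <= t); last by apply: aeW => y.
  have [tT|tT] := pselect (t%:E < Tf)%E; last by apply: aeW => y.
  by apply: (ae_imp (ht t0 tT)) => y e _ _.
move=> hP; apply: (ae_imp (ae_and hP (ae_and (ae_positive_part rf) (ae_positive_part rh)))).
by move=> z [p [a b]] z0 zT; rewrite -(a z0) -(b z0) -/g -/k p.
Qed.

End Uniqueness.

(** * Passage from almost every time to every time, the end point included *)

Section Continuation.
Variable R : realType.
Local Notation mR := (measurableTypeR R).
Implicit Types (f h : R -> phase R -> R).

Lemma C_L1_near f t e : C_Lp `[0, +oo[ 1 f -> 0 <= t -> 0 < e ->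
  exists2 d : R, 0 < d & forall s, 0 <= s -> `|s - t| < d ->
    ('N[leb4]_1[EFin \o (f s \- f t)%R] < e%:E)%E.
Proof.
move=> cf t0 e0.
have Jt : `[0, +oo[%classic t by rewrite /= in_itv/= t0.
have o : nbhs (0%E : \bar R) [set x | (x < e%:E)%E].
  by apply: open_nbhs_nbhs; split; [exact: open_ereal_lt_ereal|rewrite /= lte_fin].
have /nbhs_ballP[d /= d0 hd] := cf.2 t Jt _ o.
exists d => // s s0 st; apply: (hd s); first by rewrite /ball /= distrC.
by rewrite /= in_itv/= s0.
Qed.

(** Times s < b at which the two functions agree are found arbitrarily close to any t in [0, b],
    because a nonempty open interval is not a null set; continuity in L^1 then bounds the distance
    at t by the sum of the two oscillations. *)
Lemma C_L1_ae_eq f h b : 0 < b -> C_Lp `[0, +oo[ 1 f -> C_Lp `[0, +oo[ 1 h ->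
  {ae leb1, forall s : mR, 0 <= s -> s < b -> {ae leb4, forall y : phase mR, f s y = h s y}} ->
  forall t, 0 <= t -> t <= b -> {ae leb4, forall y : phase mR, f t y = h t y}.
Proof.
move=> b0 cf ch fh t t0 tb.
have mft := C_L1_measurable cf t0; have mht := C_L1_measurable ch t0.
have md : measurable_fun setT (EFin \o (fun y : phase mR => f t y - h t y)).
  by apply/measurable_EFinP; exact: (measurable_funB mft mht).
suff : (\int[leb4]_y `|(f t y - h t y)%R%:E| = 0)%E.
  move/(ae_eq_integral_abs _ measurableT md) => H.
  by apply: (ae_imp H) => y /(_ I) [] /eqP; rewrite subr_eq0 => /eqP.
apply/eqP; rewrite eq_le; apply/andP; split; last exact: integral_ge0.
apply/lee_addgt0Pr => e e0; rewrite add0e.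
have e2 : 0 < e / 2 by rewrite divr_gt0.
have [d1 d10 h1] := C_L1_near cf t0 e2.
have [d2 d20 h2] := C_L1_near ch t0 e2.
pose d := Num.min d1 d2; have d0 : 0 < d by rewrite /d lt_min d10.
pose a := Num.max 0 (t - d); pose c := Num.min b (t + d).
(* The window of radius d around t, clipped to [0, b], keeps a nonempty interior even for t = 0 and
   t = b. *)
have ac : a < c by rewrite /a /c gt_max !lt_min b0/=; apply/andP; split; [|apply/andP; split]; lra.
have [s [s0 sb std fhs]] : exists s : R, [/\ 0 <= s, s < b, `|s - t| < d &
    {ae leb4, forall y : phase mR, f s y = h s y}].
  have [N [mN N0 bad]] := fh; apply: contrapT => no.
  have sub : (`]a, c[%classic : set mR) `<=` N.
    move=> s /=; rewrite in_itv/= /a /c gt_max lt_min => /andP[/andP[s0 s1] /andP[s2 s3]].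
    apply: bad => hs; apply: no; exists s; split => //; first exact: ltW.
      by rewrite ltr_norml; apply/andP; split; lra.
    by apply: hs => //; exact: ltW.
  have : leb1 (`]a, c[%classic : set mR) = 0%E.
    by apply: subset_measure0 N0 => //; exact: measurable_itv.
  by rewrite /leb1 /= lebesgue_measure_itv/= lte_fin ac => -[]; lra.
have st1 : `|s - t| < d1 by apply: lt_le_trans std _; rewrite /d ge_min lexx.
have st2 : `|s - t| < d2 by apply: lt_le_trans std _; rewrite /d ge_min lexx orbT.
have n1 := h1 s s0 st1; have n2 := h2 s s0 st2.
have mfs := C_L1_measurable cf s0; have mhs := C_L1_measurable ch s0.
have m1 : measurable_fun setT (fun y : phase mR => `|(f s y - f t y)%R%:E|%E).
  by apply: measurableT_comp => //; apply/measurable_EFinP; exact: (measurable_funB mfs mft).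
have m2 : measurable_fun setT (fun y : phase mR => `|(h s y - h t y)%R%:E|%E).
  by apply: measurableT_comp => //; apply/measurable_EFinP; exact: (measurable_funB mhs mht).
rewrite [e]splitr EFinD; apply: le_trans (leeD (ltW n1) (ltW n2)).
rewrite !Lnorm1 -ge0_integralD//.
apply: ae_ge0_le_integral => //.
- exact: measurableT_comp.
- by move=> y _; exact: adde_ge0.
- exact: emeasurable_funD.
apply: (ae_imp fhs) => y ey _; rewrite /= -EFinD lee_fin ey.
rewrite [X in _ <= X + _]distrC; apply: le_trans (ler_normD _ _).
by rewrite addrA subrK.
Qed.

Lemma C_L2_ae_eq f h b : C_Lp `[0, +oo[ 1 f -> C_Lp `[0, +oo[ 1 h ->
  (forall t, 0 <= t -> t <= b -> {ae leb4, forall y : phase mR, f t y = h t y}) ->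
  C_Lp `[0, b] 2%:E f -> C_Lp `[0, b] 2%:E h.
Proof.
move=> cf ch fh [f1 f2].
have J t : `[0, b]%classic t -> 0 <= t /\ t <= b by rewrite /= in_itv/= => /andP.
split => [t Jt|t0 Jt].
  have [t0 tb] := J t Jt; have mft := C_L1_measurable cf t0; have mht := C_L1_measurable ch t0.
  have := f1 t Jt; rewrite !inE => /andP[_ +]; rewrite inE => fin.
  apply/andP; split; rewrite inE/=; first exact: mht.
  by move: fin; rewrite /finite_norm /= (L2norm_ae mft mht (fh t t0 tb)).
have [p0 p1] := J t0 Jt; apply: cvg_trans (f2 t0 Jt).
apply: near_eq_cvg; near=> t.
have [q0 q1] : 0 <= t /\ t <= b by apply: J; near: t; exact: withinT.
apply: L2norm_ae.
- exact: (measurable_funB (C_L1_measurable cf q0) (C_L1_measurable cf p0)).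
- exact: (measurable_funB (C_L1_measurable ch q0) (C_L1_measurable ch p0)).
by apply: (ae_imp (ae_and (fh t q0 q1) (fh t0 p0 p1))) => y [/= -> ->].
Unshelve. all: by end_near. Qed.

End Continuation.

Section Maximality.
Variable R : realType.
Local Notation mR := (measurableTypeR R).
Variables (f0 : phase R -> R) (f h : R -> phase R -> R) (Tf Th : \bar R).
Hypotheses (f_star : star_solution f0 f Tf) (h_star : star_solution f0 h Th).
Hypothesis fh : {ae leb1, forall t : mR, 0 <= t -> (t%:E < Tf)%E ->
  {ae leb4, forall y : phase mR, f t y = h t y}}.

(** If the two times differed, the smaller one would be finite and [star_maximal] would apply there.
    It concerns the closed interval, so the agreement must include the end point, which is what
    [C_L1_ae_eq] supplies. *)
Lemma star_time_eq : Th = Tf.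
Proof.
have cf := star_C_L1 f_star; have ch := star_C_L1 h_star.
have eqb (b : R) : 0 < b -> (b%:E <= Tf)%E -> forall t, 0 <= t -> t <= b ->
    {ae leb4, forall y : phase mR, f t y = h t y}.
  move=> b0 bT; apply: (C_L1_ae_eq b0 cf ch); apply: (ae_imp fh) => t ht t0 tb.
  by apply: ht => //; apply: lt_le_trans bT; rewrite lte_fin.
have Tf0 := star_time_gt0 f_star; have Th0 := star_time_gt0 h_star.
apply/eqP; rewrite eq_le !leNgt; apply/andP; split; apply/negP => lt.
  have [b Tb] : exists b : R, Tf = b%:E.
    move: lt Tf0; case: Tf => [b _ _|+ _|_]; [by exists b| |by []].
    by rewrite ltNge leey.
  have b0 : 0 < b by move: Tf0; rewrite Tb lte_fin.
  apply: (star_maximal f_star Tb).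
  apply: (C_L2_ae_eq ch cf) (star_C_L2 h_star (lexx 0) (ltW b0) _); last by rewrite -Tb.
  move=> t t0 tb; have bT : (b%:E <= Tf)%E by rewrite Tb.
  by apply: (ae_imp (eqb b b0 bT t t0 tb)) => y.
have [b Tb] : exists b : R, Th = b%:E.
  move: lt Th0; case: Th => [b _ _|+ _|_]; [by exists b| |by []].
  by rewrite ltNge leey.
have b0 : 0 < b by move: Th0; rewrite Tb lte_fin.
have bT : (b%:E < Tf)%E by rewrite -Tb.
apply: (star_maximal h_star Tb).
apply: (C_L2_ae_eq cf ch) (star_C_L2 f_star (lexx 0) (ltW b0) bT).
exact: eqb b0 (ltW bT).
Qed.

End Maximality.

Unset Implicit Arguments.
Set Strict Implicit.

Theorem theorem19p3 (R : realType) (f0 : phase R -> R)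
    (f : R -> phase R -> R) (Tf : \bar R)
    (f0_ge0 : {ae leb4, forall z, 0 <= f0 z})
    (f0_L2 : f0 \in Lfun leb4 2%:E)
    (f0_L12 : L12 f0)
    (f_star : star_solution f0 f Tf)
    (f0_weight : (fun z => japanese z.2 ^+ 2 * f0 z) \in Lfun leb4 2%:E)
    (f_weight : forall T : R, 0 < T -> (T%:E < Tf)%E ->
      Bochner `[0, T] 2 (@Linfty_L2norm R)
        (fun t z => (japanese z.2 ^+ 2 * f t z)%:E)) :
  forall (h : R -> phase R -> R) (Th : \bar R), star_solution f0 h Th ->
    Th = Tf /\
    {ae leb5, forall z : spacetime R, 0 <= z.1 -> (z.1%:E < Tf)%E ->
      h z.1 z.2 = f z.1 z.2}.
Proof.
move=> h Th h_star; split; last exact: star_unique_spacetime f_star h_star f_weight.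
apply: (star_time_eq f_star h_star).
apply: (ae_imp (ae_and (star_unique_before f_star h_star f_weight)
  (ae_and (ae_section (star_renorm f_star)) (ae_section (star_renorm h_star))))).
move=> t [gk [ef eh]] t0 tT.
apply: (ae_imp (ae_and (gk t0 tT) (ae_and (ef t0) (eh t0)))) => y [e [e1 e2]].
by rewrite -e1 -e2.
Qed.
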